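(* Let $K$ be a perfect field, $E/K$ an elliptic curve and $P\in E(K)$. Then $P$ is magnified if and only if $\delta_m^P$ is reducible over $K$ for some integer $m>1$.
   Context: Definition (magnified): Let $K$ be a field, $E/K$ an elliptic curve, $P\in E(K)$ and $\phi:E'\to E$ an isogeny. If $E'$, $\phi$ and some point of $\phi^{-1}(P)$ are all defined over a finite extension $L/K$ with $[L:K]<\deg\phi$, then $P$ is said to be magnified (by $\phi$). $P$ is called magnified if it is magnified by some isogeny. For $E$ with Weierstrass coordinate functions $x,y$ and $m\in\mathbb{Z}$, $\psi_m$ is the $m$-th division polynomial ($\psi_m^2\in K[x]$), $\theta_m=x\psi_m^2-\psi_{m+1}\psi_{m-1}$, so $x([m]R)=\theta_m(x(R))/\psi_m^2(x(R))$; and $\delta_m^P=\theta_m-x(P)\psi_m^2$ if $P\ne O$, $\delta_m^P=\psi_m^2$ if $P=O$. *)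

(* Defs.v *)
From HB Require Import structures.
From mathcomp Require Import all_boot all_order all_algebra.
From mathcomp Require Import fraction vector falgebra fieldext.
Set Implicit Arguments. Unset Strict Implicit. Unset Printing Implicit Defensive.
Import Order.TTheory GRing.Theory Num.Theory.
Local Open Scope ring_scope.

Definition perfect_field (K : fieldType) : Prop :=
  forall p : nat, p \in [pchar K] -> forall x : K, exists y : K, y ^+ p = x.

(* General Weierstrass curves y^2 + a1 xy + a3 y = x^3 + a2 x^2 + a4 x + a6 *)
Record wcurve (F : Type) := WCurve { wa1 : F; wa2 : F; wa3 : F; wa4 : F; wa6 : F }.

Section Weierstrass.
Variable F : fieldType.
Variable E : wcurve F.
Definition wb2 := wa1 E ^+ 2 + 4%:R * wa2 E.
Definition wb4 := 2%:R * wa4 E + wa1 E * wa3 E.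
Definition wb6 := wa3 E ^+ 2 + 4%:R * wa6 E.
Definition wb8 := wa1 E ^+ 2 * wa6 E + 4%:R * wa2 E * wa6 E - wa1 E * wa3 E * wa4 E
                  + wa2 E * wa3 E ^+ 2 - wa4 E ^+ 2.
Definition wdisc := - wb2 ^+ 2 * wb8 - 8%:R * wb4 ^+ 3 - 27%:R * wb6 ^+ 2
                    + 9%:R * wb2 * wb4 * wb6.
Definition elliptic : bool := wdisc != 0.
End Weierstrass.

Definition wcurve_map (K L : Type) (f : K -> L) (E : wcurve K) : wcurve L :=
  WCurve (f (wa1 E)) (f (wa2 E)) (f (wa3 E)) (f (wa4 E)) (f (wa6 E)).

Inductive point (F : Type) := PInf | PAff of F & F.
Arguments PInf {F}.

Definition point_map (K L : Type) (f : K -> L) (P : point K) : point L :=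
  match P with PInf => PInf | PAff x y => PAff (f x) (f y) end.

Definition on_curve (F : fieldType) (E : wcurve F) (P : point F) : bool :=
  match P with
  | PInf => true
  | PAff x y => y ^+ 2 + wa1 E * x * y + wa3 E * y
                == x ^+ 3 + wa2 E * x ^+ 2 + wa4 E * x + wa6 E
  end.

(* Division polynomials.  f_m = psi_m for m odd, f_m = psi_m / psi_2 for
   m even; all f_m lie in K[x], and psi_2^2 = 4x^3 + b2 x^2 + 2 b4 x + b6. *)
Section DivisionPolynomials.
Variable F : fieldType.
Variable E : wcurve F.

Definition psi2sq : {poly F} :=
  4%:R *: 'X^3 + (wb2 E)%:P * 'X^2 + (2%:R * wb4 E)%:P * 'X + (wb6 E)%:P.

Definition divf3 : {poly F} :=
  3%:R *: 'X^4 + (wb2 E)%:P * 'X^3 + (3%:R * wb4 E)%:P * 'X^2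
  + (3%:R * wb6 E)%:P * 'X + (wb8 E)%:P.

Definition divf4 : {poly F} :=
  2%:R *: 'X^6 + (wb2 E)%:P * 'X^5 + (5%:R * wb4 E)%:P * 'X^4
  + (10%:R * wb6 E)%:P * 'X^3 + (10%:R * wb8 E)%:P * 'X^2
  + (wb2 E * wb8 E - wb4 E * wb6 E)%:P * 'X + (wb4 E * wb8 E - wb6 E ^+ 2)%:P.

Definition divf_next (s : seq {poly F}) (n : nat) : {poly F} :=
  let f := fun i => nth 0 s i in
  if (n == 1)%N then 1 else if (n == 2)%N then 1 else
  if (n == 3)%N then divf3 else if (n == 4)%N then divf4 else
  let m := n./2 in
  if odd n then
    (if odd m then f m.+2 * f m ^+ 3 - psi2sq ^+ 2 * f m.-1 * f m.+1 ^+ 3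
     else psi2sq ^+ 2 * f m.+2 * f m ^+ 3 - f m.-1 * f m.+1 ^+ 3)
  else f m * (f m.-1 ^+ 2 * f m.+2 - f m.-2 * f m.+1 ^+ 2).

Fixpoint divf_seq (n : nat) : seq {poly F} :=
  match n with
  | 0 => [:: 0]
  | n'.+1 => let s := divf_seq n' in rcons s (divf_next s n)
  end.

Definition divf (n : nat) : {poly F} := nth 0 (divf_seq n) n.

Definition psi_sq (m : nat) : {poly F} :=
  if odd m then divf m ^+ 2 else psi2sq * divf m ^+ 2.

(* theta_m = x psi_m^2 - psi_(m+1) psi_(m-1)   (m >= 1) *)
Definition theta (m : nat) : {poly F} :=
  'X * psi_sq m
  - (if odd m then psi2sq * (divf m.+1 * divf m.-1) else divf m.+1 * divf m.-1).

Definition delta (P : point F) (m : nat) : {poly F} :=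
  match P with
  | PInf => psi_sq m
  | PAff xP _ => theta m - xP%:P * psi_sq m
  end.
End DivisionPolynomials.

Definition reducible_poly (F : fieldType) (p : {poly F}) : Prop :=
  (1 < size p)%N /\ ~ irreducible_poly p.

(* Isogenies E' -> E defined over a field L, given by rational functions
   in the Weierstrass coordinates (x, y) of E':
     x o phi = p1/q1 ,   y o phi = (p2/q2) y + (p3/q3),
   each fraction in lowest terms.                                        *)
Record isog_data (L : fieldType) := IsogData {
  iso_p1 : {poly L}; iso_q1 : {poly L};
  iso_p2 : {poly L}; iso_q2 : {poly L};
  iso_p3 : {poly L}; iso_q3 : {poly L} }.

Section Isogenies.
Variable L : fieldType.
Local Notation Fr := {fraction {poly L}}.
Definition cfr (c : L) : Fr := tofrac (c%:P).
Definition pfr (p : {poly L}) : Fr := tofrac p.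

Variables (E' E : wcurve L) (phi : isog_data L).

Definition weq_src : {poly Fr} :=
  'X^2 + (cfr (wa1 E') * pfr 'X + cfr (wa3 E'))%:P * 'X
  - (pfr 'X ^+ 3 + cfr (wa2 E') * pfr 'X ^+ 2 + cfr (wa4 E') * pfr 'X + cfr (wa6 E'))%:P.

Definition weq_pullback : {poly Fr} :=
  let X := pfr (iso_p1 phi) / pfr (iso_q1 phi) in
  let Y := (pfr (iso_p2 phi) / pfr (iso_q2 phi))%:P * 'X
           + (pfr (iso_p3 phi) / pfr (iso_q3 phi))%:P in
  Y ^+ 2 + (cfr (wa1 E) * X + cfr (wa3 E))%:P * Y
  - (X ^+ 3 + cfr (wa2 E) * X ^+ 2 + cfr (wa4 E) * X + cfr (wa6 E))%:P.

(* phi is an isogeny E' -> E defined over L: the rational map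
   (x,y) |-> (p1/q1, (p2/q2) y + p3/q3) maps E' to E (the equation of E
   pulled back vanishes in the function field L(E') = L(x)[Y]/(weq_src))
   and sends O' to O (x o phi has a pole at O', i.e. deg p1 > deg q1). *)
Definition is_isogeny : Prop :=
  [/\ [&& iso_q1 phi != 0, iso_q2 phi != 0 & iso_q3 phi != 0],
      coprimep (iso_p1 phi) (iso_q1 phi) /\ coprimep (iso_p2 phi) (iso_q2 phi)
      /\ coprimep (iso_p3 phi) (iso_q3 phi),
      (size (iso_q1 phi) < size (iso_p1 phi))%N &
      weq_src %| weq_pullback].

(* deg phi = degree of the rational function x o phi (in lowest terms) *)
Definition isog_deg : nat := (size (iso_p1 phi)).-1.

Definition two_torsion (x0 y0 : L) : bool :=
  2%:R * y0 + wa1 E' * x0 + wa3 E' == 0.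

(* phi(Q) = P, for Q in E'(L), P in E(L).
   If Q is affine and not 2-torsion, y o phi is regular at Q and -Q, so
   p2/q2 and p3/q3 are regular at x(Q); if Q is 2-torsion, phi(Q) is
   2-torsion and determined by its x-coordinate.                      *)
Definition isog_maps (Q P : point L) : Prop :=
  match Q with
  | PInf => P = PInf
  | PAff x0 y0 =>
    if (iso_q1 phi).[x0] == 0 then P = PInf else
    match P with
    | PInf => False
    | PAff xP yP =>
        xP = (iso_p1 phi).[x0] / (iso_q1 phi).[x0] /\
        (two_torsion x0 y0 \/
         [/\ (iso_q2 phi).[x0] != 0, (iso_q3 phi).[x0] != 0 &
             yP = (iso_p2 phi).[x0] / (iso_q2 phi).[x0] * y0
                  + (iso_p3 phi).[x0] / (iso_q3 phi).[x0]])
    end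
  end.
End Isogenies.

Definition magnified (K : fieldType) (E : wcurve K) (P : point K) : Prop :=
  exists (L : fieldExtType K) (E' : wcurve L) (phi : isog_data L) (Q : point L),
    [/\ elliptic E',
        is_isogeny E' (wcurve_map (fun a : K => a%:A : L) E) phi,
        on_curve E' Q,
        isog_maps E' phi Q (point_map (fun a : K => a%:A : L) P) &
        (\dim {: L} < isog_deg phi)%N].

(* Main.v *)
(* Characteristic 0.  Write g = 4x^3 + b2 x^2 + 2 b4 x + b6 for the square of 2y + a1 x + a3.
   A rational function f with a pole at infinity is the x-coordinate of an isogeny E' -> E only
   if f'^2 g_E'(x) = c^2 g_E(f) for a constant c, and comparing leading terms at a pole shows
   that this equation has at most one solution for each c.  Uniqueness replaces the group law:
   it identifies theta_m / psi_m^2 with the x-coordinate x_m of m times the generic point,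
   makes m |-> x_m multiplicative, and gives f o x'_m = x_m o f.

   If delta_m^P is reducible, a root z of a factor of degree < m^2 gives a point with
   [m](z, _) = P over an extension of degree < m^2 = deg [m], so [m] magnifies P.

   Conversely let phi : E' -> E of degree n > [L : K] send a point with x-coordinate x0 to P.
   Every pole of x o phi = p/q is a pole of some x'_k with k <= 2n (pigeonhole modulo the pole),
   hence of x'_M with M = (2n)!.  A Pade approximant A/B of x'_M in terms of f is exact: at every
   pole of f the equation relates the order of the error x'_M - (A/B)(f) to its order at infinity,
   which forces more zeros than the degree of its numerator allows.  Thus [M] factors through
   phi, and A - x0 B, of degree M^2 / n, divides delta_M^P over L; an irreducible polynomial over
   K of degree M^2 has no factor of degree < M^2 / [L : K] over L.

   Characteristic p.  Both sides always hold: the Frobenius isogeny, of degree p and defined over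
   the perfect field K, magnifies P, and theta_p' psi_p^2 - theta_p (psi_p^2)' = p psi_2p / psi_2 = 0
   makes an irreducible delta_p^P divide its derivative, so that it is a p-th power. *)

Require Import Defs.
From HB Require Import structures.
From mathcomp Require Import all_boot all_order all_algebra.
From mathcomp Require Import fraction vector falgebra fieldext generic_quotient.
From mathcomp Require Import ring zify.
From Stdlib Require Import Classical_Prop.
Set Implicit Arguments. Unset Strict Implicit. Unset Printing Implicit Defensive.
Import Order.TTheory GRing.Theory Num.Theory.
Local Open Scope ring_scope.

(** * The rational function field with its derivation *)

(** The definition of an isogeny only says that a rational map respects two equations; that it
    behaves like a homomorphism with a kernel and a dual has to be recovered. Squaring removes the
    y-coordinate: with omega = dx/(2y + a1 x + a3), the condition that phi pulls omega_E back to c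
    omega_E' becomes an equation for f = x o phi in L(x) alone, and c = m for [m]. Leading terms
    give f ~ c^(-2) x at infinity, so c is determined up to a sign that x-coordinates do not see.

    No algebraic closure is taken: a pole of f is an irreducible polynomial s, possibly of degree >
    1, and the points above it are handled by divisibility by s or in L[x]/(s). The quotient A/B
    stands for the x-coordinate of an isogeny E -> E' whose composites with phi are [M]; it is found
    by counting coefficients, without constructing a quotient curve.

    Two kinds of points escape the general argument. For P = O, psi_m^2 is visibly a product for m =
    3 or 4. For P of order 2 the y-coordinate of a preimage need not lie in the field generated by
    its x-coordinate; there [3]P = P shows directly that P is magnified. *)

(* The fraction field of {poly L} with its derivation, kept abstract: the field
   tactic is impractically slow on the concrete quotient type {fraction {poly L}}. *)
Record diff_frac (L : fieldType) := DiffFrac {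
  dfF :> fieldType;
  toF : {rmorphism {poly L} -> dfF};
  fD : dfF -> dfF;
  toF_eq0 : forall p, (toF p == 0) = (p == 0);
  fracP : forall x, exists a b, b != 0 /\ x = toF a / toF b;
  fDD : forall x y, fD (x + y) = fD x + fD y;
  fDM : forall x y, fD (x * y) = fD x * y + x * fD y;
  fD_poly : forall p, fD (toF p) = toF p^`() }.

Section ConcreteFractions.

Let cross_mul (F : fieldType) (a b c d : F) : b != 0 -> d != 0 ->
  a / b = c / d -> a * d = c * b.
Proof. by move=> b0 d0 /eqP; rewrite eqr_div // => /eqP. Qed.

Let mul_cross (F : fieldType) (a b c d : F) : b != 0 -> d != 0 ->
  a * d = c * b -> a / b = c / d.
Proof. by move=> b0 d0 /eqP; rewrite -eqr_div // => /eqP. Qed.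

Variable L : fieldType.
Local Notation Fr := {fraction {poly L}}.
Local Notation "p %:F" := (@FracField.tofrac _ p).

Let addf_div_eq (F : fieldType) (a b c d n m : F) : b != 0 -> d != 0 ->
  n = a * d + c * b -> m = b * d -> a / b + c / d = n / m.
Proof. by move=> b0 d0 -> ->; apply: addf_div. Qed.

Let mulf_div_eq (F : fieldType) (a b c d n m : F) :
  n = a * c -> m = b * d -> a / b * (c / d) = n / m.
Proof. by move=> -> ->; apply: mulf_div. Qed.

Let num (x : Fr) : {poly L} := \n_(repr x).
Let den (x : Fr) : {poly L} := \d_(repr x).

Let den_neq0 x : den x != 0.
Proof. exact: denom_ratioP. Qed.

Let frac_numden x : x = (num x)%:F / (den x)%:F.
Proof.
have nz : (den x)%:F != 0 by rewrite tofrac_eq0 den_neq0.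
have key (r : {ratio {poly L}}) :
    \pi_Fr%qT r * (\d_r)%:F = (\n_r)%:F.
  unlock FracField.tofrac; rewrite -[LHS]FracField.pi_mul; apply/eqmodP.
  rewrite /= FracField.equivfE /FracField.mulf !numden_Ratio ?mulr1 ?oner_eq0 ?denom_ratioP //.
  by rewrite mulrC.
apply: (mulIf nz); rewrite divfK // /num /den.
by rewrite -[RHS]key reprK.
Qed.

Lemma fractionP (x : Fr) : exists a b : {poly L}, b != 0 /\ x = a%:F / b%:F.
Proof. by exists (num x), (den x); rewrite den_neq0 -frac_numden. Qed.

Let deriv_frac (x : Fr) : Fr :=
  ((num x)^`() * den x - num x * (den x)^`())%:F / (den x)%:F ^+ 2.

(** Differentiating a d = c b expresses c' b through the other three products; this makes the
    quotient rule independent of the representative that [repr] picks. *)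
Let deriv_frac_welldef (a b c d : {poly L}) : a * d = c * b ->
  (c^`() * d - c * d^`()) * b ^+ 2 = (a^`() * b - a * b^`()) * d ^+ 2.
Proof.
move=> E; have /(congr1 (@deriv L)) := E; rewrite !derivM => E'.
have E1 : c^`() * b = a^`() * d + a * d^`() - c * b^`() by rewrite E'; ring.
have -> : (c^`() * d - c * d^`()) * b ^+ 2 = (c^`() * b) * (b * d) - (c * b) * (d^`() * b) by ring.
have -> : (a^`() * b - a * b^`()) * d ^+ 2 = a^`() * b * d ^+2 - (a * d) * (b^`() * d) by ring.
by rewrite E1 -E; ring: E.
Qed.

Let deriv_fracE a b : b != 0 ->
  deriv_frac (a%:F / b%:F) = (a^`() * b - a * b^`())%:F / b%:F ^+ 2.
Proof.
move=> b0; rewrite /deriv_frac.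
have := frac_numden (a%:F / b%:F); have := den_neq0 (a%:F / b%:F).
move: (num _) (den _) => c d d0 E.
have bF : b%:F != 0 :> Fr by rewrite tofrac_eq0.
have dF : d%:F != 0 :> Fr by rewrite tofrac_eq0.
have {}E : a * d = c * b.
  apply/eqP.
  rewrite -tofrac_eq.
  rewrite (tofracM a d) (tofracM c b).
  apply/eqP.
  apply: (cross_mul bF dF).
  by [].
have b2 := expf_neq0 2 bF; have d2 := expf_neq0 2 dF.
apply: (mul_cross d2 b2).
rewrite -(tofracXn 2 d) -(tofracXn 2 b).
rewrite -[LHS]tofracM -[RHS]tofracM.
by rewrite (deriv_frac_welldef E).
Qed.

Let addf_deriv (F : fieldType) (a b c d a' b' c' d' : F) : b != 0 -> d != 0 ->
  ((a' * d + a * d' + (c' * b + c * b')) * (b * d) - (a * d + c * b) * (b' * d + b * d')) / (b * d) ^+ 2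
  = (a' * b - a * b') / b ^+ 2 + (c' * d - c * d') / d ^+ 2.
Proof. by move=> b0 d0; field; rewrite b0 d0. Qed.

Let mulf_deriv (F : fieldType) (a b c d a' b' c' d' : F) : b != 0 -> d != 0 ->
  ((a' * c + a * c') * (b * d) - a * c * (b' * d + b * d')) / (b * d) ^+ 2
  = (a' * b - a * b') / b ^+ 2 * (c / d) + a / b * ((c' * d - c * d') / d ^+ 2).
Proof. by move=> b0 d0; field; rewrite b0 d0. Qed.

Let deriv_fracD x y : deriv_frac (x + y) = deriv_frac x + deriv_frac y.
Proof.
have [a [b [b0 ->]]] := fractionP x; have [c [d [d0 ->]]] := fractionP y.
have bF : b%:F != 0 :> Fr by rewrite tofrac_eq0.
have dF : d%:F != 0 :> Fr by rewrite tofrac_eq0.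
have E : a%:F / b%:F + c%:F / d%:F = (a * d + c * b)%:F / (b * d)%:F.
  apply: (addf_div_eq bF dF); last exact: tofracM.
  by rewrite tofracD (tofracM a d) (tofracM c b).
rewrite E (deriv_fracE _ (mulf_neq0 b0 d0)) (deriv_fracE _ b0) (deriv_fracE _ d0).
rewrite derivD !derivM (tofracM b d) !tofracB !(tofracM, tofracD).
exact: (@addf_deriv Fr a%:F b%:F c%:F d%:F (a^`())%:F (b^`())%:F (c^`())%:F (d^`())%:F bF dF).
Qed.

Let deriv_fracM x y : deriv_frac (x * y) = deriv_frac x * y + x * deriv_frac y.
Proof.
have [a [b [b0 ->]]] := fractionP x; have [c [d [d0 ->]]] := fractionP y.
have bF : b%:F != 0 :> Fr by rewrite tofrac_eq0.
have dF : d%:F != 0 :> Fr by rewrite tofrac_eq0.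
have E : a%:F / b%:F * (c%:F / d%:F) = (a * c)%:F / (b * d)%:F.
  by apply: mulf_div_eq; apply: tofracM.
rewrite E (deriv_fracE _ (mulf_neq0 b0 d0)) (deriv_fracE _ b0) (deriv_fracE _ d0).
rewrite !derivM (tofracM b d) !tofracB !(tofracM, tofracD).
exact: (@mulf_deriv Fr a%:F b%:F c%:F d%:F (a^`())%:F (b^`())%:F (c^`())%:F (d^`())%:F bF dF).
Qed.

Let deriv_frac_poly a : deriv_frac a%:F = (a^`())%:F.
Proof.
have -> : a%:F = a%:F / 1%:F :> Fr by rewrite tofrac1 divr1.
by rewrite deriv_fracE ?oner_eq0 // derivC mulr0 subr0 mulr1 tofrac1 expr1n divr1.
Qed.

Definition frac_diff : diff_frac L :=
  @DiffFrac L Fr (@FracField.tofrac {poly L}) deriv_frac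
    (@tofrac_eq0 {poly L}) fractionP deriv_fracD deriv_fracM deriv_frac_poly.

End ConcreteFractions.

(** * Places and local solutions of the multiplication equation *)

Section DiffFrac.
Variables (L : fieldType) (F : diff_frac L).
Implicit Types (x y h : F) (p q : {poly L}) (c : L).

Lemma fD0 : fD (0 : F) = 0.
Proof. by rewrite -(rmorph0 (toF F)) fD_poly deriv0. Qed.

Lemma fDN x : fD (- x) = - fD x.
Proof. by apply/eqP; rewrite -addr_eq0 -fDD addNr fD0. Qed.

Lemma fDB x y : fD (x - y) = fD x - fD y.
Proof. by rewrite fDD fDN. Qed.

Lemma fDX x n : fD (x ^+ n.+1) = n.+1%:R * x ^+ n * fD x.
Proof.
elim: n => [|n IH]; first by rewrite expr0 expr1 !mul1r.
by rewrite exprS fDM IH !(exprS x) -[n.+2]addn1 natrD; ring.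
Qed.

Lemma fDV x : x != 0 -> fD x^-1 = - fD x / x ^+ 2.
Proof.
move=> x0; have : fD (x * x^-1) = 0.
  by rewrite divff // -(rmorph1 (toF F)) fD_poly derivC rmorph0.
rewrite fDM => /eqP; rewrite addrC addr_eq0 => /eqP E.
by apply: (mulfI x0); rewrite E; field.
Qed.

Lemma fDdiv x y : y != 0 -> fD (x / y) = (fD x * y - x * fD y) / y ^+ 2.
Proof. by move=> y0; rewrite fDM fDV //; field. Qed.

Definition cst : L -> F := toF F \o polyC.
HB.instance Definition _ := GRing.RMorphism.on cst.

Lemma cstE c : cst c = toF F c%:P. Proof. by []. Qed.

Lemma fDC c : fD (cst c) = 0.
Proof. by rewrite cstE fD_poly derivC rmorph0. Qed.

Definition fev p h : F := (map_poly cst p).[h].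

Lemma fevD p q h : fev (p + q) h = fev p h + fev q h.
Proof. by rewrite /fev rmorphD hornerD. Qed.
Lemma fevN p h : fev (- p) h = - fev p h.
Proof. by rewrite /fev rmorphN hornerN. Qed.
Lemma fevB p q h : fev (p - q) h = fev p h - fev q h.
Proof. by rewrite fevD fevN. Qed.
Lemma fevM p q h : fev (p * q) h = fev p h * fev q h.
Proof. by rewrite /fev rmorphM hornerM. Qed.
Lemma fevXn p n h : fev (p ^+ n) h = fev p h ^+ n.
Proof. by rewrite /fev rmorphXn horner_exp. Qed.
Lemma fevC c h : fev c%:P h = cst c.
Proof. by rewrite /fev map_polyC hornerC. Qed.
Lemma fevX h : fev 'X h = h.
Proof. by rewrite /fev map_polyX hornerX. Qed.
Lemma fev0 h : fev 0 h = 0.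
Proof. by rewrite /fev rmorph0 horner0. Qed.
Lemma fev1 h : fev 1 h = 1.
Proof. by rewrite /fev rmorph1 hornerC. Qed.
Lemma fevZ c p h : fev (c *: p) h = cst c * fev p h.
Proof. by rewrite -mul_polyC fevM fevC. Qed.

Lemma fev_id p : fev p (toF F 'X) = toF F p.
Proof.
elim/poly_ind: p => [|p c IH]; first by rewrite fev0 rmorph0.
by rewrite fevD fevM fevX fevC IH rmorphD rmorphM.
Qed.

Lemma fD_fev p h : fD (fev p h) = fev p^`() h * fD h.
Proof.
elim/poly_ind: p => [|p c IH]; first by rewrite deriv0 fev0 fD0 mul0r.
rewrite derivMXaddC !fevD fDD !fevM fDM fevX fevC fDC IH; ring.
Qed.

Definition vge_of (v : F -> int) (k : int) x := (x == 0) || (k <= v x).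

(** For a local parameter t, [puni] is t / t', so that [puni] times the derivation is the Euler
    operator t d/dt: -x at infinity, where t = 1/x, and s/s' at an irreducible s. The last field
    says that this operator multiplies a leading term by its order, which is all that the
    differential equations need to know about a place. *)
Record place := Place {
  pval :> F -> int;
  puni : F;
  pvalM : forall x y, x != 0 -> y != 0 -> pval (x * y) = pval x + pval y;
  pvalD : forall x y, x != 0 -> y != 0 -> x + y != 0 ->
    Num.min (pval x) (pval y) <= pval (x + y);
  pvalC : forall c, c != 0 -> pval (cst c) = 0;
  pvalder : forall x, x != 0 ->
    vge_of pval 1 (puni * fD x / x - (pval x)%:~R) }.

End DiffFrac.

Arguments cst {L} F c.

Section PlaceTheory.
Variables (L : fieldType) (F : diff_frac L) (v : place F).
Implicit Types (x y h f u : F) (p q : {poly L}) (c d : L) (k l : int).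
Local Notation cst := (cst F).

Lemma cst_eq0 c : (cst c == 0) = (c == 0).
Proof. by rewrite cstE toF_eq0 polyC_eq0. Qed.

Definition vge := vge_of v.

Lemma vge0 k : vge k 0. Proof. by rewrite /vge /vge_of eqxx. Qed.

Lemma vgeP k x : x != 0 -> vge k x = (k <= v x).
Proof. by rewrite /vge /vge_of => /negbTE ->. Qed.

Lemma vge_le k l x : l <= k -> vge k x -> vge l x.
Proof. by move=> lk /orP[/eqP->|]; [rewrite vge0|move=> H; apply/orP; right; lia]. Qed.

Lemma place_val1 : v 1 = 0.
Proof. by rewrite -(rmorph1 cst) pvalC ?oner_eq0. Qed.

Lemma valN x : v (- x) = v x.
Proof.
case: (eqVneq x 0) => [->|x0]; first by rewrite oppr0.
have E : cst (-1) = -1 by rewrite rmorphN1.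
rewrite -mulN1r pvalM // ?oppr_eq0 ?oner_eq0 // -E pvalC ?add0r //.
by rewrite oppr_eq0 oner_eq0.
Qed.

Lemma valV x : x != 0 -> v x^-1 = - v x.
Proof.
move=> x0; have := pvalM v x0 (invr_neq0 x0); rewrite divff // place_val1; lia.
Qed.

Lemma valX x n : x != 0 -> v (x ^+ n) = v x *+ n.
Proof.
move=> x0; elim: n => [|n IH]; first by rewrite expr0 place_val1.
by rewrite exprS pvalM ?expf_neq0 // IH mulrS.
Qed.

Lemma vgeN k x : vge k x -> vge k (- x).
Proof. by rewrite /vge /vge_of oppr_eq0 valN. Qed.

Lemma vgeD k x y : vge k x -> vge k y -> vge k (x + y).
Proof.
case: (eqVneq x 0) => [->|x0]; first by rewrite add0r.
case: (eqVneq y 0) => [->|y0]; first by rewrite addr0.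
rewrite (vgeP k x0) (vgeP k y0) => Hx Hy.
rewrite /vge /vge_of; case: eqVneq => //= s0.
by have := pvalD v x0 y0 s0; lia.
Qed.

Lemma vgeB k x y : vge k x -> vge k y -> vge k (x - y).
Proof. by move=> Hx Hy; apply: vgeD => //; apply: vgeN. Qed.

Lemma vgeM k l x y : vge k x -> vge l y -> vge (k + l) (x * y).
Proof.
case: (eqVneq x 0) => [->|x0]; first by rewrite mul0r !vge0.
case: (eqVneq y 0) => [->|y0]; first by rewrite mulr0 !vge0.
rewrite (vgeP k x0) (vgeP l y0) (vgeP _ (mulf_neq0 x0 y0)) pvalM //; lia.
Qed.

Lemma vgeC c : vge 0 (cst c).
Proof.
case: (eqVneq c 0) => [->|c0]; first by rewrite rmorph0 vge0.
by rewrite vgeP ?cst_eq0 // pvalC.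
Qed.

Lemma val_lt_add x y : x != 0 -> vge (v x + 1) y -> x + y != 0 /\ v (x + y) = v x.
Proof.
move=> x0 Hy; case: (eqVneq y 0) => [->|y0]; first by rewrite addr0.
move: Hy; rewrite vgeP // => Hy.
have s0 : x + y != 0.
  by apply/eqP => /eqP; rewrite addr_eq0 => /eqP E; move: Hy; rewrite E valN; lia.
split=> //; have H1 := pvalD v x0 y0 s0.
have ny0 : - y != 0 by rewrite oppr_eq0.
have := pvalD v s0 ny0; rewrite addrK valN => /(_ x0); lia.
Qed.

(** Congruence modulo the maximal ideal to a constant of L. At a place of degree > 1 the residue
    field is larger than L and an integral element may have no such c; the leading coefficients
    needed below do lie in L. *)
Definition res x c := vge 1 (x - cst c).

Lemma resC c : res (cst c) c. Proof. by rewrite /res subrr vge0. Qed.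
Lemma res_nat n : res n%:R n%:R.
Proof. by have := resC n%:R; rewrite rmorph_nat. Qed.
Lemma res1 : res 1 1. Proof. exact: (res_nat 1). Qed.

Lemma res_vge x c : res x c -> vge 0 x.
Proof.
move=> H; rewrite -[x](subrK (cst c)); apply: vgeD; last exact: vgeC.
by apply: vge_le H.
Qed.

Lemma resD x y c d : res x c -> res y d -> res (x + y) (c + d).
Proof. by move=> Hx Hy; rewrite /res rmorphD opprD addrACA; apply: vgeD. Qed.

Lemma resN x c : res x c -> res (- x) (- c).
Proof. by move=> Hx; rewrite /res rmorphN -opprD; apply: vgeN. Qed.

Lemma resB x y c d : res x c -> res y d -> res (x - y) (c - d).
Proof. by move=> Hx Hy; apply: resD => //; apply: resN. Qed.

Lemma resM x y c d : res x c -> res y d -> res (x * y) (c * d).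
Proof.
move=> Hx Hy; rewrite /res rmorphM.
have -> : x * y - cst c * cst d = (x - cst c) * y + cst c * (y - cst d) by ring.
apply: vgeD; first by rewrite -[1]addr0; apply: vgeM => //; apply: res_vge Hy.
by rewrite -[1]add0r; apply: vgeM => //; apply: vgeC.
Qed.

Lemma resX x c n : res x c -> res (x ^+ n) (c ^+ n).
Proof.
by move=> H; elim: n => [|n IH]; rewrite ?expr0 ?exprS; [apply: res1|apply: resM].
Qed.

Lemma res_neq0 x c : c != 0 -> res x c -> x != 0 /\ v x = 0.
Proof.
move=> c0 H; have C0 : cst c != 0 by rewrite cst_eq0.
have := @val_lt_add (cst c) (x - cst c) C0.
have -> : cst c + (x - cst c) = x by ring.
rewrite pvalC // add0r => lt_add.
exact: lt_add H.
Qed.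

Lemma resV x c : c != 0 -> res x c -> res x^-1 c^-1.
Proof.
move=> c0 H; have [x0 vx] := res_neq0 c0 H.
have C0 : cst c != 0 by rewrite cst_eq0.
rewrite /res fmorphV.
have -> : x^-1 - (cst c)^-1 = - (x - cst c) * (x^-1 * (cst c)^-1).
  by field; rewrite x0 C0.
rewrite -[1]addr0; apply: vgeM; first exact: vgeN.
by rewrite vgeP ?mulf_neq0 ?invr_eq0 // pvalM ?invr_eq0 // !valV // vx pvalC.
Qed.

Lemma resdiv x y c d : d != 0 -> res x c -> res y d -> res (x / y) (c / d).
Proof. by move=> d0 Hx Hy; apply: resM => //; apply: resV. Qed.

Lemma res_uniq x c d : res x c -> res x d -> c = d.
Proof.
move=> Hx Hy; apply/eqP; rewrite -subr_eq0; apply/negPn/negP => e0.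
have := resB Hx Hy; rewrite subrr => /(res_neq0 e0)[]; by rewrite eqxx.
Qed.

Lemma res0 x : res x 0 = vge 1 x.
Proof. by rewrite /res rmorph0 subr0. Qed.

Lemma res_pole x : x != 0 -> v x < 0 -> res x^-1 0.
Proof. by move=> x0 Hx; rewrite res0 vgeP ?invr_eq0 // valV //; lia. Qed.

Hypothesis char0 : forall n, (n%:R == 0 :> L) = (n == 0)%N.

Lemma intr_eq0_char0 k : (k%:~R == 0 :> L) = (k == 0).
Proof.
by case: (intP k) => [|n|n]; rewrite ?eqxx // ?rmorphN /= ?oppr_eq0 -?pmulrn char0.
Qed.

Section LeadingTerms.
Variable f : F.
Hypotheses (f0 : f != 0) (vf : v f < 0).

Lemma res_inv_pole : res f^-1 0. Proof. exact: res_pole. Qed.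

Lemma fev_lead p : p != 0 ->
  res (fev p f / f ^+ (size p).-1) (lead_coef p).
Proof.
elim/poly_ind: p => [|p c IH]; first by rewrite eqxx.
have [->|p0] := eqVneq p 0.
  rewrite mul0r add0r => C0; rewrite fevC lead_coefC size_polyC.
  by move: C0; rewrite polyC_eq0 => ->; rewrite expr0 divr1; apply: resC.
move=> _; rewrite size_MXaddC (negPf p0) /= fevD fevM fevX fevC.
have -> : lead_coef (p * 'X + c%:P) = lead_coef p + c * 0.
  by rewrite mulr0 addr0 lead_coefDl ?lead_coefMX // size_mulX // ltnS (leq_trans (size_polyC_leq1 _)) // lt0n size_poly_eq0.
have -> : (fev p f * f + cst c) / f ^+ size p =
   fev p f / f ^+ (size p).-1 + cst c * (f ^- size p).
  have -> : size p = (size p).-1.+1 by rewrite prednK // lt0n size_poly_eq0.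
  by rewrite exprS; field; rewrite f0 expf_neq0.
apply: resD; first exact: IH.
apply: resM; first exact: resC.
have -> : size p = (size p).-1.+1 by rewrite prednK // lt0n size_poly_eq0.
have -> : 0 = 0 ^+ (size p).-1.+1 :> L by rewrite exprS mul0r.
by rewrite -exprVn; apply: resX; apply: res_inv_pole.
Qed.

Lemma fev_pole p : p != 0 -> fev p f != 0 /\ v (fev p f) = v f *+ (size p).-1.
Proof.
move=> p0; have := fev_lead p0.
case/res_neq0; first by rewrite lead_coef_eq0.
move=> H0; have [e0 _] : fev p f != 0 /\ f ^+ (size p).-1 != 0.
  by split; [apply: contraNneq H0 => ->; rewrite mul0r | rewrite expf_neq0].
rewrite pvalM ?invr_eq0 ?expf_neq0 // valV ?expf_neq0 // valX // => E.
by split=> //; lia.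
Qed.

(** The derivation f d/df. The local parameter cancels, and the leading term of x gets multiplied by
    v x / v f. *)
Definition eul x : F := fD x * f / fD f.

Lemma res_logder x : x != 0 -> res (puni v * fD x / x) (v x)%:~R.
Proof. by move=> x0; rewrite /res rmorph_int; apply: pvalder. Qed.

Lemma uniD_neq0 : puni v * fD f / f != 0.
Proof.
have [] // := res_neq0 _ (res_logder f0).
by rewrite intr_eq0_char0; lia.
Qed.

Lemma fD_neq0 : fD f != 0.
Proof. by apply: contraNneq uniD_neq0 => ->; rewrite mulr0 mul0r. Qed.

Lemma res_eul x : x != 0 -> res (eul x / x) ((v x)%:~R / (v f)%:~R).
Proof.
move=> x0; have := uniD_neq0; have Df := fD_neq0.
have [->|t0 _] := eqVneq (puni v) 0; first by rewrite !mul0r eqxx.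
have -> : eul x / x = (puni v * fD x / x) / (puni v * fD f / f).
  by rewrite /eul; field; rewrite x0 t0 Df f0.
apply: resdiv; rewrite ?intr_eq0_char0; [lia|exact: res_logder..].
Qed.

Lemma fev_psi2sq (E : wcurve L) h : fev (psi2sq E) h =
  4 * h ^+ 3 + cst (wb2 E) * h ^+ 2 + 2 * cst (wb4 E) * h + cst (wb6 E).
Proof.
rewrite /psi2sq !fevD fevZ (fevM (_)%:P ('X^2)) (fevM (_)%:P 'X) !(fevXn 'X) !fevX !fevC.
by rewrite rmorph_nat rmorphM rmorph_nat.
Qed.

Variables (E : wcurve L) (S : F) (g : L).
Hypotheses (g0 : g != 0) (resS : res (S / f) 4).

Let nat0 n : (n.+1%:R : L) != 0. Proof. by rewrite char0. Qed.

Let lead_identity (A h2 s ff b2 b4 b6 gg : F) : h2 != 0 -> ff != 0 ->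
  A ^+ 2 * s = gg * (4 * h2 ^+ 3 + b2 * h2 ^+ 2 + 2 * b4 * h2 + b6) ->
  (A / h2) ^+ 2 * (s / ff) * (ff / h2) =
  gg * (4 + b2 * h2^-1 + 2 * b4 * h2^-1 ^+ 2 + b6 * h2^-1 ^+ 3).
Proof.
move=> h0 ff0 H.
have -> : (A / h2) ^+ 2 * (s / ff) * (ff / h2) = A ^+ 2 * s / h2 ^+ 3.
  by field; rewrite h0 ff0.
by rewrite H; field.
Qed.

(** After division by h^3 the right side has residue 4 g^2, and the left side is (eul h / h)^2 (S /
    f) (f / h). With r = v h / v f this forces f / h to have the nonzero residue g^2 / r^2; hence v
    h = v f, r = 1, and h / f has residue g^(-2). *)
Lemma ode_lead h : h != 0 -> v h < 0 ->
  eul h ^+ 2 * S = cst g ^+ 2 * fev (psi2sq E) h ->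
  v h = v f /\ res (h / f) (g ^- 2).
Proof.
move=> h0 vh; rewrite fev_psi2sq => /(lead_identity h0 f0) H.
have r0 : (v h)%:~R / (v f)%:~R != 0 :> L.
  by rewrite mulf_neq0 // ?invr_eq0 intr_eq0_char0 lt_eqF.
have rh := res_eul h0; set r := _%:~R / _ in rh r0.
have lhs : res ((eul h / h) ^+ 2 * (S / f)) (r ^+ 2 * 4).
  by apply: resM => //; apply: resX.
have rhs : res (cst g ^+ 2 * (4 + cst (wb2 E) * h^-1 + 2 * cst (wb4 E) * h^-1 ^+ 2 + cst (wb6 E) * h^-1 ^+ 3))
   (g ^+ 2 * (4 + wb2 E * 0 + 2 * wb4 E * 0 ^+ 2 + wb6 E * 0 ^+ 3)).
  have rv := res_pole h0 vh.
  by repeat (first [exact: rv | exact: resC | exact: res_nat | apply: resM | apply: resD | apply: resX]).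
rewrite !expr0n /= !mulr0 !addr0 in rhs; rewrite -H in rhs.
have l0 : r ^+ 2 * 4 != 0 by rewrite mulf_neq0 ?expf_neq0.
have [L0 _] := res_neq0 l0 lhs.
have := resdiv l0 rhs lhs; rewrite mulrC mulKf // => Hfh.
have g2 : g ^+ 2 * 4 / (r ^+ 2 * 4) != 0.
  by apply: mulf_neq0; rewrite ?invr_eq0 //; apply: mulf_neq0; rewrite ?expf_neq0.
have [_] := res_neq0 g2 Hfh; rewrite pvalM ?invr_eq0 // valV // => E1.
have vE : v h = v f by apply/esym/subr0_eq.
split=> //; have := resV g2 Hfh; rewrite invf_div.
suff -> : (g ^+ 2 * 4 / (r ^+ 2 * 4))^-1 = g ^- 2 by [].
by rewrite /r vE divff ?intr_eq0_char0 ?expr1n ?mul1r ?lt_eqF //; field; rewrite g0 (nat0 3).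
Qed.

Let diff_identity (A B h2 G s ff b2 b4 b6 gg ep : F) : h2 - G != 0 -> ff != 0 ->
  A ^+ 2 * s = gg * (4 * h2 ^+ 3 + b2 * h2 ^+ 2 + 2 * b4 * h2 + b6) ->
  ep = B ^+ 2 * s - gg * (4 * G ^+ 3 + b2 * G ^+ 2 + 2 * b4 * G + b6) ->
  - ep / ((h2 - G) * ff ^+ 2) =
  (A - B) / (h2 - G) * (A / ff + B / ff) * (s / ff)
  - gg * (4 * ((h2 / ff) ^+ 2 + (h2 / ff) * (G / ff) + (G / ff) ^+ 2)
     + b2 * (h2 / ff + G / ff) * ff^-1 + 2 * b4 * ff^-1 ^+ 2).
Proof.
move=> u0 ff0 H ->.
have -> : - (B ^+ 2 * s - gg * (4 * G ^+ 3 + b2 * G ^+ 2 + 2 * b4 * G + b6)) =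
 (A ^+ 2 * s - gg * (4 * h2 ^+ 3 + b2 * h2 ^+ 2 + 2 * b4 * h2 + b6)) -
 (B ^+ 2 * s - gg * (4 * G ^+ 3 + b2 * G ^+ 2 + 2 * b4 * G + b6)).
  by rewrite H; ring.
by field; rewrite u0 ff0.
Qed.

(** Here h solves the equation and G satisfies it up to the defect [ep]. With u = h - G, subtracting
    and dividing by u f^2 gives a quantity of residue 4 g^(-2) (2 v u - 3 v f) / v f. Equal leading
    terms give v u > v f, so 2 v u - 3 v f > - v f > 0: the linearized equation has no solution at a
    pole, and the order of u can be read off from that of [ep]. *)
Lemma ode_diff h G ep : h != G ->
  res (h / f) (g ^- 2) -> res (G / f) (g ^- 2) ->
  eul h ^+ 2 * S = cst g ^+ 2 * fev (psi2sq E) h ->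
  ep = eul G ^+ 2 * S - cst g ^+ 2 * fev (psi2sq E) G ->
  ep != 0 /\ v ep = v (h - G) + v f *+ 2.
Proof.
rewrite -subr_eq0 => u0 rh rG; rewrite !fev_psi2sq => H1 H2.
have H := diff_identity u0 f0 H1 H2.
have k0 : g ^- 2 != 0 by rewrite invr_eq0 expf_neq0.
have nz x : res (x / f) (g ^- 2) -> x != 0 /\ v x = v f.
  case/(res_neq0 k0) => X0; have x0 : x != 0 by apply: contraNneq X0 => ->; rewrite mul0r.
  by rewrite pvalM ?invr_eq0 // valV // => E1; split=> //; apply: subr0_eq.
have reul x : res (x / f) (g ^- 2) -> res (eul x / f) (1 * g ^- 2).
  move=> rx; have [x0 vx] := nz _ rx.
  have -> : eul x / f = eul x / x * (x / f) by rewrite -mulrA mulKf.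
  apply: resM => //; have := res_eul x0; by rewrite vx divff // intr_eq0_char0 lt_eqF.
have vu : v f < v (h - G).
  have := resB rh rG; rewrite subrr res0 -mulrBl vgeP ?mulf_neq0 ?invr_eq0 //.
  rewrite pvalM ?invr_eq0 // valV //; move: (v _) (v f); clear; lia.
have ru := res_eul u0; set r := _%:~R / _ in ru.
have eB : eul h - eul G = eul (h - G) by rewrite /eul fDB !mulrBl.
rewrite eB in H.
have rH : res (- ep / ((h - G) * f ^+ 2))
  (r * (1 * g ^- 2 + 1 * g ^- 2) * 4 - g ^+ 2 * (4 * ((g ^- 2) ^+ 2 + g ^- 2 * g ^- 2 + (g ^- 2) ^+ 2)
    + wb2 E * (g ^- 2 + g ^- 2) * 0 + 2 * wb4 E * 0 ^+ 2)).
  have rv := res_inv_pole; have Eh := reul _ rh; have EG := reul _ rG.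
  rewrite H; apply: resB.
    by apply: resM => //; apply: resM => //; apply: resD.
  apply: resM; first by apply: resX; apply: resC.
  apply: resD; last by apply: resM; [apply: resM; [apply: res_nat|apply: resC]|apply: resX].
  apply: resD.
    apply: resM; first exact: res_nat.
    by apply: resD; [apply: resD; [apply: resX | apply: resM] | apply: resX].
  by apply: resM => //; apply: resM; [apply: resC | apply: resD].
have rE : r * (1 * g ^- 2 + 1 * g ^- 2) * 4 - g ^+ 2 * (4 * ((g ^- 2) ^+ 2 + g ^- 2 * g ^- 2 + (g ^- 2) ^+ 2)
    + wb2 E * (g ^- 2 + g ^- 2) * 0 + 2 * wb4 E * 0 ^+ 2) = g ^- 2 * 4 * ((2 * (v (h - G))%:~R - 3 * (v f)%:~R) / (v f)%:~R).
  by rewrite /r; field; rewrite g0 intr_eq0_char0 lt_eqF.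
rewrite {}rE in rH.
have [|X0] := res_neq0 _ rH.
  rewrite !mulf_neq0 ?invr_eq0 ?expf_neq0 ?intr_eq0_char0 ?lt_eqF //.
  have -> : 2 * (v (h - G))%:~R - 3 * (v f)%:~R = (2 * v (h - G) - 3 * v f)%:~R :> L.
    by rewrite rmorphB !rmorphM.
  by rewrite intr_eq0_char0; move: vu vf; clear; lia.
have e0 : ep != 0 by apply: contraNneq X0 => ->; rewrite oppr0 mul0r.
have d0 : (h - G) * f ^+ 2 != 0 by rewrite mulf_neq0 ?expf_neq0.
rewrite pvalM ?oppr_eq0 ?invr_eq0 // valN valV // pvalM ?expf_neq0 // valX // => E1.
by split=> //; move: E1; clear; lia.
Qed.

End LeadingTerms.
End PlaceTheory.

(** * Places of L(x) built from valuations on polynomials *)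

Section PolyPlace.
Variables (L : fieldType) (F : diff_frac L).
Local Notation T := (toF F).
Implicit Types (a b p q w : {poly L}) (x y : F).

Let ex_numden x : exists ab : {poly L} * {poly L},
  (ab.2 != 0) && (x == T ab.1 / T ab.2).
Proof. by have [a [b [b0 E]]] := fracP x; exists (a, b); rewrite b0 E eqxx. Qed.

Variables (v0 : {poly L} -> int) (t : F).
Hypothesis v0M : forall a b, a != 0 -> b != 0 -> v0 (a * b) = v0 a + v0 b.
Hypothesis v0D : forall a b, a != 0 -> b != 0 -> a + b != 0 ->
  Num.min (v0 a) (v0 b) <= v0 (a + b).
Hypothesis v0C : forall c : L, c != 0 -> v0 c%:P = 0.
Hypothesis v0der : forall a, a != 0 -> exists c d, [/\ d != 0,
  t * T a^`() / T a - (v0 a)%:~R = T c / T d & c != 0 -> 1 <= v0 c - v0 d].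

Definition frac_val x : int :=
  v0 (xchoose (ex_numden x)).1 - v0 (xchoose (ex_numden x)).2.

Lemma frac_valE a b : a != 0 -> b != 0 -> frac_val (T a / T b) = v0 a - v0 b.
Proof.
move=> a0 b0; have := xchooseP (ex_numden (T a / T b)); rewrite /frac_val.
case: (xchoose _) => c d /= /andP[d0]; rewrite eqr_div ?toF_eq0 //.
rewrite -!rmorphM -subr_eq0 -rmorphB toF_eq0 subr_eq0 => /eqP E.
have c0 : c != 0.
  by apply: contraTneq d0 => c0; move/eqP: E; rewrite c0 ?mul0r ?mulr0 mulf_eq0 (negPf a0) /= negbK.
by have := congr1 v0 E; rewrite !v0M //; move: (v0 a) (v0 b) (v0 c) (v0 d); clear; lia.
Qed.

Let fracP0 x : x != 0 -> exists a b, [/\ a != 0, b != 0 & x = T a / T b].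
Proof.
have [a [b [b0 ->]]] := fracP x; rewrite mulf_eq0 invr_eq0 !toF_eq0 negb_or.
by case/andP=> a0 _; exists a, b.
Qed.

Let TM a b c d : T a / T b * (T c / T d) = T (a * c) / T (b * d).
Proof. by rewrite mulf_div -!rmorphM. Qed.

Let frac_valM x y : x != 0 -> y != 0 -> frac_val (x * y) = frac_val x + frac_val y.
Proof.
move=> /fracP0[a [b [a0 b0 ->]]] /fracP0[c [d [c0 d0 ->]]].
by rewrite TM !frac_valE ?mulf_neq0 // !v0M //; move: (v0 a) (v0 b) (v0 c) (v0 d); clear; lia.
Qed.

Let frac_valD x y : x != 0 -> y != 0 -> x + y != 0 ->
  Num.min (frac_val x) (frac_val y) <= frac_val (x + y).
Proof.
move=> /fracP0[a [b [a0 b0 ->]]] /fracP0[c [d [c0 d0 ->]]].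
rewrite addf_div ?toF_eq0 // -!rmorphM -rmorphD => s0.
have n0 : a * d + c * b != 0.
  by apply: contraNneq s0 => ->; rewrite rmorph0 mul0r.
rewrite !frac_valE ?mulf_neq0 // !v0M //.
have := v0D (mulf_neq0 a0 d0) (mulf_neq0 c0 b0) n0; rewrite !v0M //.
move: (v0 (_ + _)) (v0 a) (v0 b) (v0 c) (v0 d); clear; lia.
Qed.

Lemma frac_val_poly a : a != 0 -> v0 1 = 0 -> frac_val (T a) = v0 a.
Proof.
move=> a0 v1; have -> : T a = T a / T 1 by rewrite rmorph1 divr1.
by rewrite frac_valE ?oner_eq0 // v1 subr0.
Qed.

Let v01 : v0 1 = 0. Proof. by rewrite -(v0C (oner_neq0 L)). Qed.

Let frac_valC c : c != 0 -> frac_val (cst F c) = 0.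
Proof. by move=> c0; rewrite cstE frac_val_poly ?polyC_eq0 // v0C. Qed.

Let vge_frac a b : b != 0 -> (a != 0 -> 1 <= v0 a - v0 b) -> vge_of frac_val 1 (T a / T b).
Proof.
move=> b0; have [->|a0] := eqVneq a 0; first by rewrite rmorph0 mul0r /vge_of eqxx.
by move/(_ isT) => H; rewrite /vge_of frac_valE // H orbT.
Qed.

Let val1' : frac_val (-1) = 0.
Proof.
have -> : -1 = T (- 1) :> F by rewrite rmorphN rmorph1.
have n0 : (-1 : {poly L}) != 0 by rewrite oppr_eq0 oner_eq0.
rewrite frac_val_poly //; have := v0M n0 n0; rewrite mulrNN mulr1 v01.
by move: (v0 _); clear; lia.
Qed.

Let frac_valder x : x != 0 ->
  vge_of frac_val 1 (t * fD x / x - (frac_val x)%:~R).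
Proof.
move=> /fracP0[a [b [a0 b0 ->]]].
have [c [d [d0 E1 H1]]] := v0der a0; have [e [g [g0 E2 H2]]] := v0der b0.
have Ta : T a != 0 by rewrite toF_eq0.
have Tb : T b != 0 by rewrite toF_eq0.
have -> : t * fD (T a / T b) / (T a / T b) - (frac_val (T a / T b))%:~R = T c / T d - T e / T g.
  rewrite -E1 -E2 fDdiv // !fD_poly frac_valE // rmorphB /=; field.
  by rewrite Ta Tb.
have := vge_frac d0 H1; have := vge_frac g0 H2.
move: (T c / T d) (T e / T g) => z w; clear - frac_valM frac_valD val1'.
rewrite /vge_of; case: (eqVneq w 0) => [->|w0]; first by rewrite subr0.
case: (eqVneq z 0) => [->|z0] /=.
  by move=> H _; rewrite sub0r oppr_eq0 (negPf w0) /= -mulN1r frac_valM ?oppr_eq0 ?oner_eq0 // val1' add0r.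
move=> Hw Hz; case: eqVneq => //= s0.
have nw0 : - w != 0 by rewrite oppr_eq0.
have := frac_valD z0 nw0 s0; rewrite -(mulN1r w) frac_valM ?oppr_eq0 ?oner_eq0 // val1' add0r.
by rewrite !mulN1r; move: Hw Hz; move: (frac_val (z - w)) (frac_val z) (frac_val w); clear; lia.
Qed.

Definition poly_place : place F :=
  @Place L F frac_val t frac_valM frac_valD frac_valC frac_valder.

Lemma poly_placeE a : a != 0 -> poly_place (T a) = v0 a.
Proof. by move=> a0; apply: frac_val_poly. Qed.

End PolyPlace.

Section InfinitePlace.
Variables (L : fieldType) (F : diff_frac L).
Local Notation T := (toF F).
Implicit Types (a b p q w : {poly L}).

Definition ord_inf a : int := 1 - (size a)%:Z.

Let ord_infM a b : a != 0 -> b != 0 -> ord_inf (a * b) = ord_inf a + ord_inf b.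
Proof.
move=> a0 b0; rewrite /ord_inf size_mul //.
move: a0 b0; rewrite -(size_poly_gt0 a) -(size_poly_gt0 b); move: (size a) (size b); clear; lia.
Qed.

Let ord_infD a b : a != 0 -> b != 0 -> a + b != 0 ->
  Num.min (ord_inf a) (ord_inf b) <= ord_inf (a + b).
Proof. by move=> _ _ _; rewrite /ord_inf; have := size_polyD a b; move: (size _) (size _) (size _); clear; lia. Qed.

Let ord_infC (c : L) : c != 0 -> ord_inf c%:P = 0.
Proof. by move=> c0; rewrite /ord_inf size_polyC c0. Qed.

Let ord_inf_der a : a != 0 -> exists c d, [/\ d != 0,
  (- T 'X) * T a^`() / T a - (ord_inf a)%:~R = T c / T d &
  c != 0 -> 1 <= ord_inf c - ord_inf d].
Proof.
(* The numerator of - x a'/a + deg a is (deg a) a - x a', in which the leading terms cancel; the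
   drop in degree is the required gain of one order. *)
move=> a0; exists ((size a).-1%:R * a - 'X * a^`()), a; split=> //.
  have Ta : T a != 0 by rewrite toF_eq0.
  have -> : T ((size a).-1%:R * a - 'X * a^`()) = (size a).-1%:R * T a - T 'X * T a^`().
    by rewrite rmorphB !rmorphM rmorph_nat.
  have -> : (ord_inf a)%:~R = - (size a).-1%:R :> F.
    rewrite /ord_inf -[in LHS](prednK (n := size a)) ?size_poly_gt0 //.
    by rewrite intS opprD addNKr rmorphN.
  by field.
move=> c0; suff : (size ((size a).-1%:R * a - 'X * a^`())%R < size a)%N.
  by rewrite /ord_inf; move: (size _) (size _); clear; lia.
rewrite -[size a]prednK ?size_poly_gt0 // ltnS.
apply/leq_sizeP => j Hj; rewrite coefB mulr_natl coefMn coefXM.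
case: j Hj => [|j]; rewrite ?leqn0.
  by move=> /eqP Ha; rewrite Ha mulr0n subr0.
rewrite coef_deriv leq_eqVlt => /orP[/eqP->|H]; first by rewrite subrr.
by rewrite nth_default ?mul0rn ?subrr // -(prednK (n := size a)) ?size_poly_gt0.
Qed.

Definition inf_place : place F := poly_place ord_infM ord_infD ord_infC ord_inf_der.

Lemma inf_placeE a : a != 0 -> inf_place (T a) = 1 - (size a)%:Z.
Proof. exact: poly_placeE. Qed.

Lemma inf_placeX : inf_place (T 'X) = -1.
Proof. by rewrite inf_placeE ?polyX_eq0 // size_polyX. Qed.

End InfinitePlace.

Section FinitePlace.
Variables (L : fieldType) (F : diff_frac L).
Local Notation T := (toF F).
Implicit Types (a b p q w : {poly L}).
Hypothesis char0 : forall n, (n%:R == 0 :> L) = (n == 0)%N.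

Definition pmult (p a : {poly L}) : nat := \max_(k < size a | p ^+ k %| a) k.

Variable p : {poly L}.
Hypothesis p_irr : irreducible_poly p.

Let p_gt1 : (1 < size p)%N. Proof. by case: p_irr. Qed.
Let p0 : p != 0. Proof. by rewrite -size_poly_gt0 ltnW. Qed.

Lemma irreducible_coprime a : ~~ (p %| a) -> coprimep p a.
Proof.
move=> pa; case: p_irr => _ irr; rewrite /coprimep; apply/negPn/negP => H.
have := irr _ H (dvdp_gcdl p a) => E.
by case/negP: pa; rewrite -(eqp_dvdl _ E) dvdp_gcdr.
Qed.

Lemma irreducible_dvdM a b : (p %| a * b) = (p %| a) || (p %| b).
Proof.
apply/idP/idP; last by case/orP => H; [apply: dvdp_mulr | apply: dvdp_mull].
case: (boolP (p %| a)) => [//|/irreducible_coprime co] /=.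
by rewrite Gauss_dvdpr.
Qed.

Lemma pmultP a : a != 0 -> exists2 w, a = p ^+ pmult p a * w & ~~ (p %| w).
Proof.
move=> a0; have H0 : p ^+ 0 %| a by rewrite expr0 dvd1p.
have sa : (0 < size a)%N by rewrite size_poly_gt0.
have [[k Hk] /= Dk Ek] : {k : 'I_(size a) | p ^+ k %| a & pmult p a = k}.
  by apply: eq_bigmax_cond; apply/card_gt0P; exists (Ordinal sa).
have [w Ew] := dvdpP _ _ Dk; exists w; first by rewrite Ek mulrC.
apply/negP => /dvdpP[w' Ew']; have D : p ^+ k.+1 %| a.
  by rewrite Ew Ew' -mulrA -exprS dvdp_mull.
have Hs : (k.+1 < size a)%N.
  apply: leq_trans (dvdp_leq a0 D); rewrite -[X in (_ < X)%N]prednK; last first.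
    by rewrite size_poly_gt0 expf_neq0.
  by rewrite size_exp ltnS leq_pmull // -ltnS prednK // ltnW.
have := @leq_bigmax_cond _ (fun k : 'I_(size a) => p ^+ k %| a) (fun k => k : nat) (Ordinal Hs) D.
by rewrite -/(pmult p a) Ek ltnn.
Qed.

Lemma pmult_uniq a k w : a = p ^+ k * w -> ~~ (p %| w) -> pmult p a = k.
Proof.
move=> E pw; have w0 : w != 0 by apply: contraNneq pw => ->; rewrite dvdp0.
have a0 : a != 0 by rewrite E mulf_neq0 ?expf_neq0.
have [w' E' pw'] := pmultP a0; move: E'; set m := pmult p a => E'.
have aux m1 m2 w1 w2 : p ^+ m1 * w1 = p ^+ m2 * w2 -> ~~ (p %| w1) -> (m2 <= m1)%N.
  move=> EE H; rewrite leqNgt; apply/negP => lt; case/negP: H.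
  have E2 : p ^+ m1 * w1 = p ^+ m1 * (p * (p ^+ (m2 - m1.+1) * w2)).
    by rewrite EE mulrA mulrA -exprSr -exprD subnKC.
  by rewrite (mulfI (expf_neq0 _ p0) E2) dvdp_mulr.
apply/eqP; rewrite eqn_leq (aux k m w w') ?(aux m k w' w) // -?E //.
Qed.

Lemma pmult_dvd a k : a != 0 -> (p ^+ k %| a) = (k <= pmult p a)%N.
Proof.
move=> a0; have [w Ew pw] := pmultP a0; apply/idP/idP => [D|le].
  rewrite leqNgt; apply/negP => lt; case/negP: pw.
  have := dvdp_trans (dvdp_exp2l p lt) D; rewrite [X in _ %| X]Ew exprSr.
  by rewrite dvdp_mul2l ?expf_neq0.
by rewrite [X in _ %| X]Ew; apply: dvdp_mulr; apply: dvdp_exp2l.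
Qed.

Lemma pmultM a b : a != 0 -> b != 0 -> pmult p (a * b) = (pmult p a + pmult p b)%N.
Proof.
move=> /pmultP[w Ew pw] /pmultP[w' Ew' pw'].
apply: (@pmult_uniq _ _ (w * w')); last by rewrite irreducible_dvdM negb_or pw.
by rewrite {1}Ew {1}Ew' exprD; ring.
Qed.

Let ordM a b : a != 0 -> b != 0 -> (pmult p (a * b))%:Z = (pmult p a)%:Z + (pmult p b)%:Z.
Proof. by move=> a0 b0; rewrite pmultM. Qed.

Let ordD a b : a != 0 -> b != 0 -> a + b != 0 ->
  Num.min (pmult p a)%:Z (pmult p b)%:Z <= (pmult p (a + b))%:Z.
Proof.
move=> a0 b0 s0.
suff : (minn (pmult p a) (pmult p b) <= pmult p (a + b))%N by clear; lia.
by rewrite -pmult_dvd // dvdp_add // pmult_dvd // ?geq_minl ?geq_minr.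
Qed.

Lemma pmult_ndvd a : a != 0 -> ~~ (p %| a) -> pmult p a = 0%N.
Proof. by move=> a0 pa; apply: (@pmult_uniq _ _ a) => //; rewrite mul1r. Qed.

Let ordC (c : L) : c != 0 -> (pmult p c%:P)%:Z = 0.
Proof.
move=> c0; rewrite pmult_ndvd ?polyC_eq0 // gtNdvdp ?polyC_eq0 //.
by rewrite size_polyC c0.
Qed.

Lemma deriv_neq0_char0 a : (1 < size a)%N -> a^`() != 0.
Proof.
move=> Ha; apply/eqP => /(congr1 (fun q : {poly L} => q`_(size a).-2)).
rewrite coef_deriv coef0 -mulr_natr => /eqP; rewrite mulf_eq0 char0 orbF.
have -> : (size a).-2.+1 = (size a).-1 by move: Ha; clear; lia.
by rewrite -lead_coefE lead_coef_eq0 => /eqP a0; rewrite a0 size_poly0 in Ha.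
Qed.

Let p'0 : p^`() != 0. Proof. exact: deriv_neq0_char0. Qed.

Let pp' : ~~ (p %| p^`()).
Proof. by rewrite gtNdvdp // lt_size_deriv. Qed.

Let deriv_pow_mul k w :
  (p ^+ k * w)^`() * p = p ^+ k * (k%:R * p^`() * w + p * w^`()).
Proof.
rewrite derivM deriv_exp; case: k => [|k]; first by rewrite expr0 mulr0n; ring.
by rewrite exprS -mulr_natr; ring.
Qed.

Let logder_identity (K : fieldType) (a a' w w' D P k : K) :
  a != 0 -> a' != 0 -> w != 0 -> P != 0 ->
  D * a = P * (k * a' * w + a * w') -> a / a' * D / (P * w) - k = a * w' / (a' * w).
Proof.
move=> a0 a'0 w0 P0 H.
have -> : a / a' * D / (P * w) = (D * a) / (a' * (P * w)) by field; rewrite P0 a'0 w0.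
by rewrite H; field; rewrite P0 a'0 w0.
Qed.

Let ord_der a : a != 0 -> exists c d, [/\ d != 0,
  (T p / T p^`()) * T a^`() / T a - ((pmult p a)%:Z)%:~R = T c / T d &
  c != 0 -> 1 <= (pmult p c)%:Z - (pmult p d)%:Z].
Proof.
move=> a0; have [w Ew pw] := pmultP a0; set k := pmult p a in Ew *.
have w0 : w != 0 by apply: contraNneq pw => ->; rewrite dvdp0.
(* For a = p^k w the logarithmic derivative is k p'/p + w'/w. Multiplying by p/p' and removing k
   leaves p w' / (p' w), of positive order since p divides neither p' nor w. *)
exists (p * w^`()), (p^`() * w); split; first exact: mulf_neq0.
  rewrite Ew -pmulrn rmorphM [T (p * _)]rmorphM [T (p^`() * _)]rmorphM.
  apply: logder_identity; rewrite ?toF_eq0 ?expf_neq0 //.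
  by rewrite -rmorphM deriv_pow_mul !(rmorphM, rmorphD) /= rmorph_nat.
rewrite mulf_eq0 negb_or => /andP[_ w'0].
rewrite !pmultM // (pmult_ndvd w0 pw) (pmult_ndvd p'0 pp').
have -> : pmult p p = 1%N.
  by apply: (@pmult_uniq _ _ 1); rewrite ?mulr1 // gtNdvdp ?oner_eq0 // size_poly1.
by clear; lia.
Qed.

Definition fin_place : place F := poly_place ordM ordD ordC ord_der.

Lemma fin_placeE a : a != 0 -> fin_place (T a) = (pmult p a)%:Z.
Proof. exact: poly_placeE. Qed.

End FinitePlace.

(** * The addition law on x-coordinates *)

Lemma wdisc_b (K : fieldType) (E : wcurve K) :
  4 * wb8 E = wb2 E * wb6 E - wb4 E ^+ 2.
Proof. rewrite /wb8 /wb2 /wb6 /wb4; ring. Qed.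

Section ChordTangent.
Variable K : fieldType.
Implicit Types w h c b : K.

Definition cubic b2 b4 b6 h : K := 4 * h ^+ 3 + b2 * h ^+ 2 + 2 * b4 * h + b6.
Definition cubic' b2 b4 h : K := 12 * h ^+ 2 + 2 * b2 * h + 2 * b4.

(* Points are written (h, c * sqrt w), where w is the value of the cubic at the generic x. *)
Definition addx w b2 h1 c1 h2 c2 : K :=
  w * (c1 - c2) ^+ 2 / (4 * (h1 - h2) ^+ 2) - b2 / 4 - h1 - h2.
Definition addc w b2 h1 c1 h2 c2 : K :=
  - (c1 + (c1 - c2) * (addx w b2 h1 c1 h2 c2 - h1) / (h1 - h2)).
Definition dupx b2 b4 b6 h : K :=
  cubic' b2 b4 h ^+ 2 / (16 * cubic b2 b4 b6 h) - b2 / 4 - 2 * h.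

Hypothesis two0 : 2 != 0 :> K.

Let four0 : 4 != 0 :> K.
Proof. have -> : 4 = 2 ^+ 2 :> K by ring.
by rewrite expf_neq0. Qed.

Let sixteen0 : 16 != 0 :> K.
Proof. have -> : 16 = 2 ^+ 4 :> K by ring.
by rewrite expf_neq0. Qed.

Lemma solve_b6 w b2 b4 b6 h c : c ^+ 2 * w = cubic b2 b4 b6 h ->
  b6 = c ^+ 2 * w - (4 * h ^+ 3 + b2 * h ^+ 2 + 2 * b4 * h).
Proof. by move=> ->; rewrite /cubic; ring. Qed.

Lemma solve_b4 w b2 b4 b6 h1 c1 h2 c2 : h1 != h2 ->
  c1 ^+ 2 * w = cubic b2 b4 b6 h1 -> c2 ^+ 2 * w = cubic b2 b4 b6 h2 ->
  2 * b4 = (w * (c1 ^+ 2 - c2 ^+ 2) - 4 * (h1 ^+ 3 - h2 ^+ 3)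
    - b2 * (h1 ^+ 2 - h2 ^+ 2)) / (h1 - h2).
Proof.
rewrite -subr_eq0 => d0 H1 H2; apply: (mulIf d0); rewrite divfK //.
have -> : w * (c1 ^+ 2 - c2 ^+ 2) = c1 ^+ 2 * w - c2 ^+ 2 * w by ring.
by rewrite H1 H2 /cubic; ring.
Qed.

Lemma add_on_curve w b2 b4 b6 h1 c1 h2 c2 : h1 != h2 ->
  c1 ^+ 2 * w = cubic b2 b4 b6 h1 -> c2 ^+ 2 * w = cubic b2 b4 b6 h2 ->
  addc w b2 h1 c1 h2 c2 ^+ 2 * w = cubic b2 b4 b6 (addx w b2 h1 c1 h2 c2).
Proof.
move=> d H1 H2; have B4 := solve_b4 d H1 H2; have B6 := solve_b6 H1.
move: d; rewrite -subr_eq0 => d0; rewrite /cubic B6 B4 /addc /addx; field.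
by rewrite d0 four0.
Qed.

(** Additivity of the multiplier of the invariant differential. The last hypothesis is the formal
    derivative of [addx] with h_i' = g_i c_i inserted, and the two before it are the curve equations
    differentiated and divided by c_i. *)
Lemma add_diff w w' b2 b4 b6 h1 c1 c1' g1 h2 c2 c2' g2 h3' :
  h1 != h2 ->
  c1 ^+ 2 * w = cubic b2 b4 b6 h1 -> c2 ^+ 2 * w = cubic b2 b4 b6 h2 ->
  2 * c1' * w + c1 * w' = g1 * cubic' b2 b4 h1 ->
  2 * c2' * w + c2 * w' = g2 * cubic' b2 b4 h2 ->
  h3' = (w' * (c1 - c2) ^+ 2 + w * (2 * (c1 - c2) * (c1' - c2'))) / (4 * (h1 - h2) ^+ 2)
     - w * (c1 - c2) ^+ 2 * (2 * (g1 * c1 - g2 * c2)) / (4 * (h1 - h2) ^+ 3)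
     - g1 * c1 - g2 * c2 ->
  h3' = (g1 + g2) * addc w b2 h1 c1 h2 c2.
Proof.
move=> d H1 H2 D1 D2 ->; have B4 := solve_b4 d H1 H2.
move: d; rewrite -subr_eq0 => d0.
have -> : w * (2 * (c1 - c2) * (c1' - c2')) =
  (c1 - c2) * ((2 * c1' * w + c1 * w') - (2 * c2' * w + c2 * w') - (c1 - c2) * w') by ring.
by rewrite D1 D2 /addc /addx /cubic' B4; field; rewrite d0 four0.
Qed.

Let dup_identity P N b2 B4 b6 h : P != 0 ->
  B4 = N - (12 * h ^+ 2 + 2 * b2 * h) ->
  b6 = P - (4 * h ^+ 3 + b2 * h ^+ 2 + B4 * h) ->
  let H := N ^+ 2 / (16 * P) - b2 / 4 - 2 * h in
  ((2 * N * (24 * h + 2 * b2) * P - N ^+ 2 * N) / (16 * P ^+ 2) - 2) ^+ 2 * P =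
  4 * (4 * H ^+ 3 + b2 * H ^+ 2 + B4 * H + b6).
Proof. by move=> P0 E4 E6 H; rewrite /H E6 E4; field; rewrite P0 four0 sixteen0. Qed.

Lemma dup_on_curve b2 b4 b6 h : cubic b2 b4 b6 h != 0 ->
  let P := cubic b2 b4 b6 h in let N := cubic' b2 b4 h in
  ((2 * N * (24 * h + 2 * b2) * P - N ^+ 2 * N) / (16 * P ^+ 2) - 2) ^+ 2 * P =
  4 * cubic b2 b4 b6 (dupx b2 b4 b6 h).
Proof.
by move=> P0 P N; apply: dup_identity => //; rewrite /P /N /cubic /cubic'; ring.
Qed.

Lemma addx_sub w b2 h1 c1 h2 c2 : h1 != h2 ->
  (addx w b2 h1 c1 h2 (- c2) - addx w b2 h1 c1 h2 c2) * (h1 - h2) ^+ 2 = c1 * c2 * w.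
Proof. by rewrite -subr_eq0 => d0; rewrite /addx; field; rewrite four0. Qed.

(** The sum and the product of x(P + Q) and x(P - Q) are invariant under Q -> - Q, so [c1] and [c2]
    enter only through their squares, which the curve equations eliminate. What remains is
    polynomial in x(P) and x(Q) and serves the coprimality of numerators and denominators of
    multiples. *)
Lemma addx_sum w b2 b4 b6 h1 c1 h2 c2 : h1 != h2 ->
  c1 ^+ 2 * w = cubic b2 b4 b6 h1 -> c2 ^+ 2 * w = cubic b2 b4 b6 h2 ->
  2 * (addx w b2 h1 c1 h2 c2 + addx w b2 h1 c1 h2 (- c2)) * (h1 - h2) ^+ 2 =
  4 * h1 * h2 * (h1 + h2) + 2 * b2 * h1 * h2 + 2 * b4 * (h1 + h2) + 2 * b6.
Proof.
move=> d H1 H2; have B4 := solve_b4 d H1 H2; have B6 := solve_b6 H1.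
move: d; rewrite -subr_eq0 => d0; rewrite B6 B4 /addx; field.
by rewrite d0 four0.
Qed.

Lemma addx_prod w b2 b4 b6 b8 h1 c1 h2 c2 : h1 != h2 ->
  4 * b8 = b2 * b6 - b4 ^+ 2 ->
  c1 ^+ 2 * w = cubic b2 b4 b6 h1 -> c2 ^+ 2 * w = cubic b2 b4 b6 h2 ->
  addx w b2 h1 c1 h2 c2 * addx w b2 h1 c1 h2 (- c2) * (h1 - h2) ^+ 2 =
  h1 ^+ 2 * h2 ^+ 2 - b4 * h1 * h2 - b6 * (h1 + h2) - b8.
Proof.
move=> d E8 H1 H2; have := solve_b4 d H1 H2; have B6 := solve_b6 H1.
move: d; rewrite -subr_eq0 => d0 B4.
have b8E : b8 = (b2 * b6 - b4 ^+ 2) / 4.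
  by apply: (mulIf four0); rewrite divfK // -E8 mulrC.
have b4E : b4 = (w * (c1 ^+ 2 - c2 ^+ 2) - 4 * (h1 ^+ 3 - h2 ^+ 3)
    - b2 * (h1 ^+ 2 - h2 ^+ 2)) / (h1 - h2) / 2.
  by apply: (mulIf two0); rewrite -B4 divfK // mulrC.
rewrite b8E B6 b4E /addx; field.
by rewrite d0 four0 two0.
Qed.

(** The equalities x(P) = x(P + Q) and x(P) = x(P - Q) mean 2P = -Q and 2P = Q, which together say
    x(Q) = x(2P); the identity is this equivalence in polynomial form. For Q the generic point and P
    = mQ it evaluates psi_(2m+1) psi_(2m-1). *)
Lemma add_dup w b2 b4 b6 h1 c1 h2 c2 : h1 != h2 -> cubic b2 b4 b6 h1 != 0 ->
  c1 ^+ 2 * w = cubic b2 b4 b6 h1 -> c2 ^+ 2 * w = cubic b2 b4 b6 h2 ->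
  (h1 - addx w b2 h1 c1 h2 c2) * (addx w b2 h1 c1 h2 (- c2) - h1) * (h1 - h2) ^+ 2 =
  (h2 - dupx b2 b4 b6 h1) * cubic b2 b4 b6 h1.
Proof.
move=> d P0 H1 H2; have B4 := solve_b4 d H1 H2; move: P0; rewrite /dupx -H1 => P0.
move: d; rewrite -subr_eq0 => d0; rewrite /cubic' B4 /addx; field.
rewrite d0 four0 sixteen0 /=; move: P0; rewrite mulf_eq0 expf_eq0 /= negb_or.
by case/andP=> -> ->.
Qed.

End ChordTangent.

(** * Solutions of the differential equation of an isogeny, and their addition *)

Section Solutions.
Variables (L : fieldType) (F : diff_frac L).
Hypothesis char0 : forall n, (n%:R == 0 :> L) = (n == 0)%N.
Local Notation T := (toF F).
Local Notation cst := (cst F).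
Local Notation v := (inf_place F).
Local Notation x := (T 'X).
Implicit Types (h : F) (g c : L) (E : wcurve L).

Lemma T_psi2sq E : T (psi2sq E) = fev (psi2sq E) x.
Proof. by rewrite fev_id. Qed.

Lemma fev_cubic E h : fev (psi2sq E) h = cubic (cst (wb2 E)) (cst (wb4 E)) (cst (wb6 E)) h.
Proof. exact: fev_psi2sq. Qed.

Lemma psi2sq_size_lead E : size (psi2sq E) = 4%N /\ lead_coef (psi2sq E) = 4.
Proof.
have l4 : (4 : L) != 0 by rewrite char0.
suff H : size (psi2sq E) = 4%N.
  split=> //; rewrite lead_coefE H /psi2sq /= !coefD coefZ !coefCM !coefXn coefX coefC /=.
  by rewrite mulr1 !mulr0 !addr0.
rewrite /psi2sq -!addrA size_polyDl size_scale // size_polyXn //.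
rewrite ltnS; apply: leq_trans (size_polyD _ _) _; rewrite geq_max.
apply/andP; split.
  by apply: leq_trans (size_polyMleq _ _) _; rewrite size_polyXn addn3 /= size_polyC; case: (_ == _).
apply: leq_trans (size_polyD _ _) _; rewrite geq_max; apply/andP; split.
  by apply: leq_trans (size_polyMleq _ _) _; rewrite size_polyX addn2 /= size_polyC; case: (_ == _).
by rewrite size_polyC; case: (_ == _).
Qed.

Lemma psi2sq_neq0 E : psi2sq E != 0.
Proof. by rewrite -size_poly_eq0; case: (psi2sq_size_lead E) => ->. Qed.

Lemma x_neq0 : x != 0. Proof. by rewrite toF_eq0 polyX_eq0. Qed.
Lemma vx : v x < 0. Proof. by rewrite inf_placeX. Qed.

Lemma fDx : fD x = 1. Proof. by rewrite fD_poly derivX rmorph1. Qed.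

Lemma res_psi2sq E : res v (T (psi2sq E) / x ^+ 3) 4.
Proof.
have := fev_lead x_neq0 vx (psi2sq_neq0 E).
by case: (psi2sq_size_lead E) => -> ->; rewrite fev_id.
Qed.

(** The square of the statement that a map E1 -> E2 with x-coordinate h pulls the invariant
    differential of E2 back to g times that of E1. The pole at infinity says that O goes to O. *)
Definition sol E1 E2 g h : Prop :=
  [/\ h != 0, v h < 0 & fD h ^+ 2 * T (psi2sq E1) = cst g ^+ 2 * fev (psi2sq E2) h].

Let eulX h : eul x h = fD h * x. Proof. by rewrite /eul fDx divr1. Qed.

Let ode_eul E1 E2 g h : fD h ^+ 2 * T (psi2sq E1) = cst g ^+ 2 * fev (psi2sq E2) h ->
  eul x h ^+ 2 * (T (psi2sq E1) / x ^+ 2) = cst g ^+ 2 * fev (psi2sq E2) h.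
Proof. by move=> <-; rewrite eulX; field; rewrite x_neq0. Qed.

Let resS E : res v (T (psi2sq E) / x ^+ 2 / x) 4.
Proof. by rewrite -mulrA -invfM -exprSr; apply: res_psi2sq. Qed.

Lemma sol_lead E1 E2 g h : g != 0 -> sol E1 E2 g h ->
  v h = -1 /\ res v (h / x) (g ^- 2).
Proof.
move=> g0 [h0 vh /ode_eul H].
by have := ode_lead char0 x_neq0 vx g0 (resS E1) h0 vh H; rewrite inf_placeX.
Qed.

(* Two solutions with a pole at infinity have the same leading term, so their difference u has
   order k < 1; the linearized equation then forces 8 k = 12. *)
Lemma sol_uniq E1 E2 g h h' : g != 0 -> sol E1 E2 g h -> sol E1 E2 g h' -> h = h'.
Proof.
move=> g0 S1 S2; have [_ r1] := sol_lead g0 S1; have [_ r2] := sol_lead g0 S2.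
case: S1 S2 => _ _ /ode_eul H1 [_ _ /ode_eul H2].
apply/eqP/negPn/negP => ne.
have E0 : 0 = eul x h' ^+ 2 * (T (psi2sq E1) / x ^+ 2) - cst g ^+ 2 * fev (psi2sq E2) h'.
  by rewrite H2 subrr.
by have [] := ode_diff char0 x_neq0 vx g0 (resS E1) ne r1 r2 H1 E0; rewrite eqxx.
Qed.

Lemma sol_fD_res E1 E2 g h : g != 0 -> sol E1 E2 g h -> res v (fD h) (g ^- 2).
Proof.
move=> g0 S1; have [vh r1] := sol_lead g0 S1; case: S1 => h0 _ _.
have := res_eul char0 x_neq0 vx h0; rewrite eulX vh inf_placeX divff ?intr_eq0_char0 //.
move=> H; have -> : fD h = (fD h * x / h) * (h / x) by field; rewrite h0 x_neq0.
by rewrite -[g ^- 2]mul1r; apply: resM.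
Qed.

Lemma sol_id E : sol E E 1 x.
Proof. by split; rewrite ?x_neq0 ?vx // fDx -T_psi2sq rmorph1 !expr1n. Qed.

Lemma sol_opp E1 E2 g h : sol E1 E2 g h -> sol E1 E2 (- g) h.
Proof. by case=> h0 vh H; split=> //; rewrite rmorphN sqrrN. Qed.

Section OneCurve.
Variable E : wcurve L.
Local Notation b2 := (cst (wb2 E)).
Local Notation b4 := (cst (wb4 E)).
Local Notation b6 := (cst (wb6 E)).
Local Notation w := (T (psi2sq E)).

Let natF n : (n%:R == 0 :> F) = (n == 0)%N.
Proof. by rewrite -(rmorph_nat cst) cst_eq0. Qed.

Let cstF g : g != 0 -> cst g != 0. Proof. by rewrite cst_eq0. Qed.

Lemma w_neq0 : w != 0. Proof. by rewrite toF_eq0 psi2sq_neq0. Qed.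

(** The ratio of 2y + a1 x + a3 at the image point to its value at the generic point: it equals h'/g
    because dh / Y_image = g dx / Y. *)
Definition solc g h : F := fD h / cst g.

Lemma sol_on_curve g h : g != 0 -> sol E E g h ->
  solc g h ^+ 2 * w = cubic b2 b4 b6 h.
Proof.
move=> g0 [_ _ H]; rewrite -fev_cubic; have C0 := cstF g0.
by apply: (mulfI (expf_neq0 2 C0)); rewrite -H /solc; field; rewrite C0.
Qed.

Let fDn n : fD (n%:R : F) = 0.
Proof. by rewrite -(rmorph_nat cst) fDC. Qed.

Let fDnV n : fD (n%:R^-1 : F) = 0.
Proof. by rewrite -(rmorph_nat cst) -fmorphV fDC. Qed.

Let fD_cubic h : fD (cubic b2 b4 b6 h) = cubic' b2 b4 h * fD h.
Proof.
rewrite /cubic /cubic' !fDD fDC (fDM 4) (fDM b2) (fDM (_ * b4)) (fDM _ b4) !fDX !fDn !fDC.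
by ring.
Qed.

Let fD_solc g h : g != 0 -> sol E E g h ->
  2 * fD (solc g h) * w + solc g h * fD w = cst g * cubic' b2 b4 h.
Proof.
move=> g0 S; have H := sol_on_curve g0 S; case: (S) => h0 vh _.
have [/eqP D0|D0] := eqVneq (fD h) 0.
  have [g'0 _] := res_neq0 (invr_neq0 (expf_neq0 2 g0)) (sol_fD_res g0 S).
  by rewrite (eqP D0) eqxx in g'0.
have c0 : solc g h != 0 by rewrite mulf_neq0 ?invr_eq0 ?cstF.
have := congr1 (@fD _ F) H; rewrite fD_cubic fDM fDX expr1 => H'.
apply: (mulfI c0); have Dh : fD h = cst g * solc g h by rewrite /solc mulrC divfK ?cstF.
have -> : solc g h * (cst g * cubic' b2 b4 h) = cubic' b2 b4 h * fD h by rewrite Dh; ring.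
by rewrite -H'; ring.
Qed.

Definition soladd g1 h1 g2 h2 := addx w b2 h1 (solc g1 h1) h2 (solc g2 h2).

Lemma sol_neq g1 h1 g2 h2 : g1 != 0 -> g2 != 0 -> g1 ^+ 2 != g2 ^+ 2 ->
  sol E E g1 h1 -> sol E E g2 h2 -> h1 != h2.
Proof.
move=> g10 g20 ne S1 S2; apply: contraNneq ne => e.
have [_ r1] := sol_lead g10 S1; have [_ r2] := sol_lead g20 S2.
by rewrite e in r1; have /invr_inj -> := res_uniq r1 r2.
Qed.

(** The chord formula supplies the curve equation and, by [add_diff], the derivative; together they
    are the differential equation with multiplier g1 + g2. Only the pole at infinity needs a
    computation. The condition on squares separates the leading coefficients g_i^(-2), so the chord
    is defined, and also gives g1 + g2 != 0. *)
Lemma sol_add g1 h1 g2 h2 : g1 != 0 -> g2 != 0 -> g1 ^+ 2 != g2 ^+ 2 ->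
  sol E E g1 h1 -> sol E E g2 h2 -> sol E E (g1 + g2) (soladd g1 h1 g2 h2).
Proof.
move=> g10 g20 ne S1 S2; have d := sol_neq g10 g20 ne S1 S2.
have two0 : 2 != 0 :> F by rewrite natF.
have four0 : 4 != 0 :> F by rewrite natF.
have H1 := sol_on_curve g10 S1; have H2 := sol_on_curve g20 S2.
have D1 := fD_solc g10 S1; have D2 := fD_solc g20 S2.
have [_ r1] := sol_lead g10 S1; have [_ r2] := sol_lead g20 S2.
have q1 : res v (solc g1 h1) (g1 ^- 2 / g1).
  by apply: resdiv => //; [apply: sol_fD_res S1 | apply: resC].
have q2 : res v (solc g2 h2) (g2 ^- 2 / g2).
  by apply: resdiv => //; [apply: sol_fD_res S2 | apply: resC].
have Dh1 : fD h1 = cst g1 * solc g1 h1 by rewrite /solc mulrC divfK ?cstF.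
have Dh2 : fD h2 = cst g2 * solc g2 h2 by rewrite /solc mulrC divfK ?cstF.
have Hc := add_on_curve two0 d H1 H2; have d0 := d; rewrite -subr_eq0 in d0.
have Hd : fD (soladd g1 h1 g2 h2) = (cst g1 + cst g2) * addc w b2 h1 (solc g1 h1) h2 (solc g2 h2).
  apply: (add_diff two0 d H1 H2 D1 D2).
  rewrite /soladd /addx !fDB (fDdiv (w * _)) ?mulf_neq0 ?expf_neq0 // (fDM w) (fDM 4) (fDM b2).
  rewrite !fDX !fDB fDC !fDn fDnV Dh1 Dh2.
  by field; rewrite d0 four0.
have e0 : g1 + g2 != 0.
  by apply: contraNneq ne => /eqP; rewrite addr_eq0 => /eqP ->; rewrite sqrrN.
have rs : res v (soladd g1 h1 g2 h2 / x) ((g1 + g2) ^- 2).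
  have -> : soladd g1 h1 g2 h2 / x =
    w / x ^+ 3 * (solc g1 h1 - solc g2 h2) ^+ 2 / (4 * (h1 / x - h2 / x) ^+ 2) -
    b2 / 4 * x^-1 - h1 / x - h2 / x.
    rewrite /soladd /addx; field.
    by rewrite x_neq0 d0 four0.
  have dd0 : g1 ^- 2 - g2 ^- 2 != 0 by rewrite subr_eq0 (inj_eq invr_inj).
  have l4 : (4 : L) != 0 by rewrite char0.
  (* At infinity h_i / x has residue g_i^(-2) and [solc] has residue g_i^(-3). The chord formula
     applied to these values yields (g1 + g2)^(-2); the [wb2] term drops out because 1/x has residue
     0. *)
  have -> : (g1 + g2) ^- 2 = 4 * (g1 ^- 2 / g1 - g2 ^- 2 / g2) ^+ 2 / (4 * (g1 ^- 2 - g2 ^- 2) ^+ 2)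
      - wb2 E / 4 * 0 - g1 ^- 2 - g2 ^- 2.
    by field; rewrite g10 g20 l4 e0 /= mulN1r subr_eq0 eq_sym ne.
  apply: resB => //; apply: resB => //; apply: resB.
    apply: resdiv; rewrite ?mulf_neq0 ?expf_neq0 //.
      by apply: resM; [apply: res_psi2sq | apply: resX; apply: resB].
    by apply: resM; [apply: res_nat | apply: resX; apply: resB].
  apply: resM; last by apply: res_pole x_neq0 vx.
  by apply: resdiv => //; [apply: resC | apply: res_nat].
have [s0 vs] := res_neq0 (invr_neq0 (expf_neq0 2 e0)) rs.
have sn0 : soladd g1 h1 g2 h2 != 0 by apply: contraNneq s0 => ->; rewrite mul0r.
split=> //.
  move: vs; rewrite pvalM ?invr_eq0 ?x_neq0 // valV ?x_neq0 // inf_placeX.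
  by move: (v _); clear; lia.
by rewrite Hd fev_cubic -Hc rmorphD /soladd; ring.
Qed.

Definition soldup h := dupx b2 b4 b6 h.

Lemma fD_soldup h : cubic b2 b4 b6 h != 0 ->
  fD (soldup h) = ((2 * cubic' b2 b4 h * (24 * h + 2 * b2) * cubic b2 b4 b6 h - cubic' b2 b4 h ^+ 2 * cubic' b2 b4 h) / (16 * cubic b2 b4 b6 h ^+ 2) - 2) * fD h.
Proof.
have two0 : 2 != 0 :> F by rewrite natF.
have four0 : 4 != 0 :> F by rewrite natF.
have s0 : 16 != 0 :> F by rewrite natF.
move=> P0.
have fDP' : fD (cubic' b2 b4 h) = (24 * h + 2 * b2) * fD h.
  rewrite /cubic' !fDD (fDM 12) (fDM (_ * b2)) (fDM _ b2) (fDM _ b4) fDX !fDn !fDC.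
  by ring.
rewrite /soldup /dupx !fDB (fDdiv (_ ^+ 2)) ?mulf_neq0 // (fDM 16) (fDM b2) (fDM 2).
rewrite fDX fDP' fDC !fDn fDnV fD_cubic.
by field; rewrite P0 four0 s0.
Qed.

Lemma sol_dup g h : g != 0 -> sol E E g h -> sol E E (2 * g) (soldup h).
Proof.
move=> g0 S; have [_ r] := sol_lead g0 S; case: (S) => h0 vh H.
have two0 : 2 != 0 :> F by rewrite natF.
have four0 : 4 != 0 :> F by rewrite natF.
have s0 : 16 != 0 :> F by rewrite natF.
have l4 : (4 : L) != 0 by rewrite char0.
have l16 : (16 : L) != 0 by rewrite char0.
have [P0 _] := fev_pole h0 vh (psi2sq_neq0 E); rewrite fev_cubic in P0 H.
have Hd := fD_soldup P0.
have rs : res v (soldup h / x) ((2 * g) ^- 2).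
  pose y := x^-1; have ry : res v y 0 by apply: res_pole x_neq0 vx.
  have -> : soldup h / x =
    (12 * (h / x) ^+ 2 + 2 * b2 * (h / x) * y + 2 * b4 * y ^+ 2) ^+ 2 /
    (16 * (4 * (h / x) ^+ 3 + b2 * (h / x) ^+ 2 * y + 2 * b4 * (h / x) * y ^+ 2 + b6 * y ^+ 3))
    - b2 / 4 * y - 2 * (h / x).
    rewrite /soldup /dupx.
    have -> : cubic b2 b4 b6 h = x ^+ 3 * (4 * (h / x) ^+ 3 + b2 * (h / x) ^+ 2 * y + 2 * b4 * (h / x) * y ^+ 2 + b6 * y ^+ 3).
      by rewrite /cubic /y; field; rewrite x_neq0.
    have -> : cubic' b2 b4 h = x ^+ 2 * (12 * (h / x) ^+ 2 + 2 * b2 * (h / x) * y + 2 * b4 * y ^+ 2).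
      by rewrite /cubic' /y; field; rewrite x_neq0.
    move: (12 * _ ^+ 2 + _ * _ + _) => N.
    (* If P = 0, both sides still agree because the inverse of 0 is 0. *)
    set P := _ + b6 * y ^+ 3; have [->|P'0] := eqVneq P 0.
      by rewrite !mulr0 invr0 !mulr0 /y; field; rewrite x_neq0 four0.
    by rewrite /y; field; rewrite P'0 x_neq0 four0 s0.
  have -> : (2 * g) ^- 2 =
    (12 * (g ^- 2) ^+ 2 + 2 * wb2 E * (g ^- 2) * 0 + 2 * wb4 E * 0 ^+ 2) ^+ 2 /
    (16 * (4 * (g ^- 2) ^+ 3 + wb2 E * (g ^- 2) ^+ 2 * 0 + 2 * wb4 E * (g ^- 2) * 0 ^+ 2 + wb6 E * 0 ^+ 3))
    - wb2 E / 4 * 0 - 2 * (g ^- 2).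
    by rewrite !expr0n /= !mulr0 !addr0; field; rewrite g0 ?l4 ?l16 ?char0.
  have P0' : 16 * (4 * (g ^- 2) ^+ 3 + wb2 E * (g ^- 2) ^+ 2 * 0 + 2 * wb4 E * (g ^- 2) * 0 ^+ 2 + wb6 E * 0 ^+ 3) != 0.
    rewrite !expr0n /= !mulr0 !addr0; apply: mulf_neq0 => //; apply: mulf_neq0 => //.
    by rewrite expf_neq0 // invr_eq0 expf_neq0.
  have rn n := res_nat v n; have rc c := resC v c.
  have r2 := resX 2 r; have r3 := resX 3 r; have ry2 := resX 2 ry; have ry3 := resX 3 ry.
  have rN := resX 2 (resD (resD (resM (rn 12) r2) (resM (resM (resM (rn 2) (rc (wb2 E))) r) ry))
    (resM (resM (rn 2) (rc (wb4 E))) ry2)).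
  have rP := resM (rn 16) (resD (resD (resD (resM (rn 4) r3) (resM (resM (rc (wb2 E)) r2) ry))
    (resM (resM (resM (rn 2) (rc (wb4 E))) r) ry2)) (resM (rc (wb6 E)) ry3)).
  exact: (resB (resB (resdiv P0' rN rP) (resM (resdiv l4 (rc (wb2 E)) (rn 4)) ry)) (resM (rn 2) r)).
have e0 : 2 * g != 0 by rewrite mulf_neq0 // char0.
have [s1 vs] := res_neq0 (invr_neq0 (expf_neq0 2 e0)) rs.
have sn0 : soldup h != 0 by apply: contraNneq s1 => ->; rewrite mul0r.
split=> //.
  move: vs; rewrite pvalM ?invr_eq0 ?x_neq0 // valV ?x_neq0 // inf_placeX.
  by move: (v _); clear; lia.
rewrite Hd fev_cubic; have := dup_on_curve two0 P0; rewrite -/(soldup h) /=.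
set A := (X in X ^+ 2 * _ = _) => HA.
have -> : (A * fD h) ^+ 2 * w = A ^+ 2 * (fD h ^+ 2 * w) by ring.
have -> : A ^+ 2 * (fD h ^+ 2 * w) = cst g ^+ 2 * (A ^+ 2 * cubic b2 b4 b6 h).
  by rewrite H; ring.
by rewrite HA rmorphM rmorph_nat; ring.
Qed.

End OneCurve.
End Solutions.

(** * Division polynomials over rings *)

(* The definitions of Defs over a commutative ring, so that identities can be
   specialized; over a field they are convertible to the originals. *)
Section RingDivisionPolynomials.
Variables (R : comNzRingType) (b2 b4 b6 b8 : R).

Definition rpsi2sq : {poly R} :=
  4 *: 'X^3 + b2%:P * 'X^2 + (2 * b4)%:P * 'X + b6%:P.

Definition rdivf3 : {poly R} :=
  3 *: 'X^4 + b2%:P * 'X^3 + (3 * b4)%:P * 'X^2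
  + (3 * b6)%:P * 'X + b8%:P.

Definition rdivf4 : {poly R} :=
  2 *: 'X^6 + b2%:P * 'X^5 + (5 * b4)%:P * 'X^4
  + (10 * b6)%:P * 'X^3 + (10 * b8)%:P * 'X^2
  + (b2 * b8 - b4 * b6)%:P * 'X + (b4 * b8 - b6 ^+ 2)%:P.

Definition rdivf_next (s : seq {poly R}) (n : nat) : {poly R} :=
  let f := fun i => nth 0 s i in
  if (n == 1)%N then 1 else if (n == 2)%N then 1 else
  if (n == 3)%N then rdivf3 else if (n == 4)%N then rdivf4 else
  let m := n./2 in
  if odd n then
    (if odd m then f m.+2 * f m ^+ 3 - rpsi2sq ^+ 2 * f m.-1 * f m.+1 ^+ 3
     else rpsi2sq ^+ 2 * f m.+2 * f m ^+ 3 - f m.-1 * f m.+1 ^+ 3)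
  else f m * (f m.-1 ^+ 2 * f m.+2 - f m.-2 * f m.+1 ^+ 2).

Fixpoint rdivf_seq (n : nat) : seq {poly R} :=
  match n with
  | 0 => [:: 0]
  | n'.+1 => let s := rdivf_seq n' in rcons s (rdivf_next s n)
  end.

Definition rdivf (n : nat) : {poly R} := nth 0 (rdivf_seq n) n.

Definition rpsi_sq (m : nat) : {poly R} :=
  if odd m then rdivf m ^+ 2 else rpsi2sq * rdivf m ^+ 2.

Definition rtheta (m : nat) : {poly R} :=
  'X * rpsi_sq m
  - (if odd m then rpsi2sq * (rdivf m.+1 * rdivf m.-1) else rdivf m.+1 * rdivf m.-1).

Lemma size_rdivf_seq n : size (rdivf_seq n) = n.+1.
Proof. by elim: n => //= n IH; rewrite size_rcons IH. Qed.

Lemma nth_rdivf_seq n i : (i <= n)%N -> nth 0 (rdivf_seq n) i = rdivf i.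
Proof.
elim: n => [|n IH]; first by case: i.
rewrite leq_eqVlt => /orP[/eqP->//|Hi].
by rewrite /= nth_rcons size_rdivf_seq Hi IH.
Qed.

Lemma rdivfS n : rdivf n.+1 = rdivf_next (rdivf_seq n) n.+1.
Proof. by rewrite /rdivf /= nth_rcons size_rdivf_seq ltnn eqxx. Qed.

Lemma rdivf0 : rdivf 0 = 0. Proof. by []. Qed.
Lemma rdivf1 : rdivf 1 = 1. Proof. by []. Qed.
Lemma rdivf2 : rdivf 2 = 1. Proof. by []. Qed.
Lemma rdivf3E : rdivf 3 = rdivf3. Proof. by []. Qed.
Lemma rdivf4E : rdivf 4 = rdivf4. Proof. by []. Qed.

(** The factor in psi_m^2 = s_m f_m^2; with it the odd and the even cases share one formula. *)
Definition rs m : {poly R} := if odd m then 1 else rpsi2sq.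

Lemma rsM m : rs m * rs m.+1 = rpsi2sq.
Proof. by rewrite /rs /=; case: (odd m); rewrite ?mul1r ?mulr1. Qed.

Lemma rsSS m : rs m.+2 = rs m.
Proof. by rewrite /rs /= negbK. Qed.

Lemma rpsi_sqE m : rpsi_sq m = rs m * rdivf m ^+ 2.
Proof. by rewrite /rpsi_sq /rs; case: odd; rewrite ?mul1r. Qed.

Lemma rthetaE m : rtheta m.+1 = 'X * rpsi_sq m.+1 - rs m * (rdivf m.+2 * rdivf m).
Proof. by rewrite /rtheta /rs /=; case: odd; rewrite /= ?mul1r. Qed.

Let next_odd s m : (1 < m)%N ->
  rdivf_next s m.*2.+1 = rs m ^+ 2 * s`_m.+2 * s`_m ^+ 3
    - rs m.+1 ^+ 2 * s`_m.-1 * s`_m.+1 ^+ 3.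
Proof.
case: m => [|[|m]] // _; rewrite /rdivf_next [odd _]/= odd_double [_./2]/= uphalf_double.
by rewrite !doubleS /rs /= negbK; case: (odd m); rewrite ?expr1n !mul1r.
Qed.

Let next_even s m : (2 < m)%N ->
  rdivf_next s m.*2 = s`_m * (s`_m.-1 ^+ 2 * s`_m.+2 - s`_m.-2 * s`_m.+1 ^+ 2).
Proof.
case: m => [|[|[|m]]] // _; rewrite /rdivf_next odd_double half_double.
by rewrite !doubleS.
Qed.

Lemma rdivf_odd m : (1 < m)%N ->
  rdivf m.*2.+1 = rs m ^+ 2 * rdivf m.+2 * rdivf m ^+ 3
    - rs m.+1 ^+ 2 * rdivf m.-1 * rdivf m.+1 ^+ 3.
Proof. by move=> Hm; rewrite rdivfS next_odd // !nth_rdivf_seq // -addnn; lia. Qed.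

Lemma rdivf_even m : (1 < m)%N ->
  rdivf m.*2 = rdivf m * (rdivf m.-1 ^+ 2 * rdivf m.+2 - rdivf m.-2 * rdivf m.+1 ^+ 2).
Proof.
case: m => [|[|[|m]]] // _.
  (* For m = 2 the formula only says f_4 = f_4, since f_0 = 0 and f_1 = f_2 = 1; the value of f_4 is
     an initial datum. *)
  by rewrite /= rdivf0 mul0r subr0 rdivf1 rdivf2 expr1n !mul1r.
have E : m.+3.*2 = m.+2.*2.+1.+1 by rewrite doubleS.
by rewrite [in LHS]E rdivfS -E next_even // !nth_rdivf_seq // -addnn; lia.
Qed.

End RingDivisionPolynomials.

Lemma divfE (K : fieldType) (E : wcurve K) n :
  divf E n = rdivf (wb2 E) (wb4 E) (wb6 E) (wb8 E) n.
Proof. by []. Qed.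

Definition ws (K : fieldType) (E : wcurve K) n := rs (wb2 E) (wb4 E) (wb6 E) n.

Lemma wsE (K : fieldType) (E : wcurve K) n : ws E n = if odd n then 1 else psi2sq E.
Proof. by []. Qed.

Lemma psi_sqE (K : fieldType) (E : wcurve K) n : psi_sq E n = ws E n * divf E n ^+ 2.
Proof. by rewrite /psi_sq wsE; case: odd; rewrite ?mul1r. Qed.

Lemma thetaE (K : fieldType) (E : wcurve K) n :
  theta E n.+1 = 'X * psi_sq E n.+1 - ws E n * (divf E n.+2 * divf E n).
Proof. by rewrite /theta wsE [odd n.+1]/=; case: (odd n); rewrite /= ?mul1r. Qed.

Lemma wsSS (K : fieldType) (E : wcurve K) n : ws E n.+2 = ws E n.
Proof. exact: rsSS. Qed.

Lemma divf_odd (K : fieldType) (E : wcurve K) m : (1 < m)%N ->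
  divf E m.*2.+1 = ws E m ^+ 2 * divf E m.+2 * divf E m ^+ 3
    - ws E m.+1 ^+ 2 * divf E m.-1 * divf E m.+1 ^+ 3.
Proof. by rewrite !divfE; apply: rdivf_odd. Qed.

Lemma divf_even (K : fieldType) (E : wcurve K) m : (1 < m)%N ->
  divf E m.*2 = divf E m * (divf E m.-1 ^+ 2 * divf E m.+2 - divf E m.-2 * divf E m.+1 ^+ 2).
Proof. by rewrite !divfE; apply: rdivf_even. Qed.

Section SmallIndices.
Variables (K : fieldType) (E : wcurve K).
Lemma divf1 : divf E 1 = 1. Proof. by []. Qed.
Lemma divf2 : divf E 2 = 1. Proof. by []. Qed.
Lemma divf3E : divf E 3 = divf3 E. Proof. by []. Qed.
Lemma divf4E : divf E 4 = divf4 E. Proof. by []. Qed.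

Lemma psi_sq1 : psi_sq E 1 = 1.
Proof. by rewrite psi_sqE divf1 wsE /= expr1n mulr1. Qed.

Lemma psi_sq2 : psi_sq E 2 = psi2sq E.
Proof. by rewrite psi_sqE divf2 wsE /= expr1n mulr1. Qed.

Lemma theta2 : theta E 2 = 'X * psi2sq E - divf3 E.
Proof. by rewrite thetaE psi_sq2 divf1 divf3E wsE /= mul1r mulr1. Qed.
End SmallIndices.

(** * Multiples of the generic point *)

Section EllipticDivisibility.
Variables (L : fieldType) (F : diff_frac L).
Hypothesis char0 : forall n, (n%:R == 0 :> L) = (n == 0)%N.
Variable E : wcurve L.
Local Notation T := (toF F).
Local Notation cst := (cst F).
Local Notation v := (inf_place F).
Local Notation x := (T 'X).
Local Notation b2 := (cst (wb2 E)).
Local Notation b4 := (cst (wb4 E)).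
Local Notation b6 := (cst (wb6 E)).
Local Notation w := (T (psi2sq E)).

Let natL n : (n.+1%:R : L) != 0. Proof. by rewrite char0. Qed.
Let natF n : (n%:R == 0 :> F) = (n == 0)%N.
Proof. by rewrite -(rmorph_nat cst) cst_eq0. Qed.
Let two0 : 2 != 0 :> F. Proof. by rewrite natF. Qed.

(* mulx n is the x-coordinate of n times the generic point, whose y-coordinate
   is mulc n times that of the generic point. *)
Fixpoint mulx (n : nat) : F :=
  match n with
  | 0 => 0
  | n'.+1 => if n' is 0 then x else
             if n' == 1%N then soldup E x else soladd E n'%:R (mulx n') 1 x
  end.

Definition mulc n : F := solc n%:R (mulx n).

Let sqr_nat_neq a b : a != b -> a.+1%:R ^+ 2 != b.+1%:R ^+ 2 :> L.
Proof.
move=> ne; wlog lt : a b ne / (a < b)%N.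
  by move=> H; case: (ltngtP a b) ne => // lt _; [|rewrite eq_sym]; apply: H; rewrite ?ltn_eqF.
rewrite eq_sym -!natrX -subr_eq0 -natrB ?leq_exp2r 1?ltnW // char0 subn_eq0 -ltnNge.
by rewrite ltn_exp2r.
Qed.

Lemma mulx_sol n : sol E E n.+1%:R (mulx n.+1).
Proof.
have S1 := sol_id F E; elim: n => [|[|n] IH]; first exact: S1.
  by have := sol_dup char0 (oner_neq0 L) S1; rewrite mulr1.
have := sol_add char0 (natL n.+1) (oner_neq0 L) (@sqr_nat_neq n.+1 0 isT) IH S1.
by rewrite natr1.
Qed.

Lemma mulx_neq a b : a != b -> mulx a.+1 != mulx b.+1.
Proof.
by move=> ne; apply: (sol_neq char0 _ _ (sqr_nat_neq ne) (mulx_sol a) (mulx_sol b)).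
Qed.

Lemma mulx_curve n : mulc n.+1 ^+ 2 * w = cubic b2 b4 b6 (mulx n.+1).
Proof. exact: sol_on_curve (natL n) (mulx_sol n). Qed.

Lemma mulx_cubic_neq0 n : cubic b2 b4 b6 (mulx n.+1) != 0.
Proof.
case: (mulx_sol n) => h0 vh _.
by have [] := fev_pole h0 vh (psi2sq_neq0 char0 E); rewrite fev_cubic.
Qed.

Lemma mulx_add a b : a != b ->
  mulx (a.+1 + b.+1) = addx w b2 (mulx a.+1) (mulc a.+1) (mulx b.+1) (mulc b.+1).
Proof.
move=> ne; have S := sol_add char0 (natL a) (natL b) (sqr_nat_neq ne) (mulx_sol a) (mulx_sol b).
rewrite -natrD addnS in S; rewrite addnS.
exact: (sol_uniq char0 (natL _) (mulx_sol _) S).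
Qed.

Lemma mulx_sub a b : (b < a)%N ->
  mulx (a.+1 - b.+1) = addx w b2 (mulx a.+1) (mulc a.+1) (mulx b.+1) (- mulc b.+1).
Proof.
move=> lt; have ne : a.+1%:R ^+ 2 != (- b.+1%:R) ^+ 2 :> L.
  by rewrite sqrrN sqr_nat_neq // gtn_eqF.
have nb : - b.+1%:R != 0 :> L by rewrite oppr_eq0.
have S := sol_add char0 (natL a) nb ne (mulx_sol a) (sol_opp (mulx_sol b)).
have le : (b.+1 <= a.+1)%N by rewrite ltnS ltnW.
rewrite -natrB // in S; rewrite /soladd /solc in S.
rewrite /mulc /solc; rewrite rmorphN invrN mulrN in S.
rewrite subSS; rewrite subSS in S; move: S; case E1 : (a - b)%N => [|k] S.
  by move/eqP: E1; rewrite subn_eq0 leqNgt lt.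
exact: (sol_uniq char0 (natL _) (mulx_sol _) S).
Qed.

Lemma mulx_dup n : mulx (n.+1.*2) = dupx b2 b4 b6 (mulx n.+1).
Proof.
have S := sol_dup char0 (natL n) (mulx_sol n).
rewrite -natrM mul2n doubleS in S; rewrite doubleS.
exact: (sol_uniq char0 (natL _) (mulx_sol _) S).
Qed.

Lemma mulx1 : mulx 1 = x. Proof. by []. Qed.
Lemma mulc1 : mulc 1 = 1.
Proof. by rewrite /mulc /solc mulx1 fDx rmorph1 divr1. Qed.

Lemma mulx_step n : (1 < n)%N ->
  (mulx n.-1 - mulx n.+1) * (mulx n - x) ^+ 2 = mulc n * w.
Proof.
case: n => [|[|n]] // _.
have := @addx_sub F two0 w b2 (mulx n.+2) (mulc n.+2) (mulx 1) (mulc 1) (@mulx_neq n.+1 0 isT).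
by rewrite -mulx_add // -mulx_sub // mulc1 mulx1 mulr1 addn1 subn1.
Qed.

Local Notation Fn n := (T (divf E n)).
Local Notation s n := (T (ws E n)).
Local Notation g n := (T (psi_sq E n)).

Let sE n : s n * s n.+1 = w.
Proof. by rewrite -rmorphM /ws rsM. Qed.

Let gE n : g n = s n * Fn n ^+ 2.
Proof. by rewrite psi_sqE rmorphM rmorphXn. Qed.

Let s0 n : s n != 0.
Proof.
have := w_neq0 F char0 E; rewrite -(sE n) mulf_eq0 negb_or; by case/andP.
Qed.

(** The classical psi_(n+1) psi_(n-1) = (x - x_n) psi_n^2. The factor s_(n+1) restores psi_2^2 when
    both neighbours of n are even. *)
Definition eds_rel n := Fn n.+1 * Fn n.-1 * s n.+1 = (x - mulx n) * g n.

(** The recursion for psi_(2m+1) has two terms, each containing a product psi_(k+1) psi_(k-1) with k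
    = m or m + 1. Replacing these by [eds_rel] cancels x and leaves x_m - x_(m+1). *)
Let eds_odd m : (1 < m)%N -> eds_rel m -> eds_rel m.+1 ->
  Fn m.*2.+1 = (mulx m - mulx m.+1) * w * Fn m ^+ 2 * Fn m.+1 ^+ 2.
Proof.
move=> m1; rewrite /eds_rel !gE wsSS /= => C0 C1.
rewrite divf_odd // !(rmorphXn, rmorphM, rmorphB) -(sE m).
have -> : s m ^+ 2 * Fn m.+2 * Fn m ^+ 3 = s m * (Fn m.+2 * Fn m * s m) * Fn m ^+ 2 by ring.
have -> : s m.+1 ^+ 2 * Fn m.-1 * Fn m.+1 ^+ 3 = s m.+1 * (Fn m.+1 * Fn m.-1 * s m.+1) * Fn m.+1 ^+ 2 by ring.
by rewrite C0 C1; ring.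
Qed.

(** This is psi_2m / psi_2 = c_m psi_m^4, the y-coordinate of the m-th multiple. Substituting
    [eds_rel] at m - 1 and m + 1 leaves x_(m-1) - x_(m+1), the difference of the two chord values in
    [mulx_step]. Multiplying by s_n s_(n+1) beforehand makes the products match [eds_rel]. *)
Let eds_even m : (1 < m)%N -> eds_rel m.-1 -> eds_rel m -> eds_rel m.+1 ->
  Fn m.*2 = mulc m * g m ^+ 2.
Proof.
move=> m1 Cp C0 C1; have M := mulx_step m1; move: Cp C0 C1 M.
case: m m1 => [|[|n]] // _; set m := n.+2.
rewrite /eds_rel !gE /= !wsSS -/m => Cp C0 C1 M.
have -> : Fn m.*2 = Fn m * (Fn m.-1 ^+ 2 * Fn m.+2 - Fn m.-2 * Fn m.+1 ^+ 2).
  by rewrite divf_even // !(rmorphXn, rmorphM, rmorphB).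
have e1 : s n * (Fn m * (Fn m.-1 ^+ 2 * Fn m.+2 - Fn m.-2 * Fn m.+1 ^+ 2)) =
   s n.+1 * Fn m.-1 ^+ 2 * Fn m.+1 ^+ 2 * (mulx m.-1 - mulx m.+1).
  have -> : s n * (Fn m * (Fn m.-1 ^+ 2 * Fn m.+2 - Fn m.-2 * Fn m.+1 ^+ 2)) =
     Fn m.-1 ^+ 2 * (Fn m.+2 * Fn m * s n) - (Fn n.+2 * Fn n * s n) * Fn m.+1 ^+ 2.
    by rewrite /m /=; ring.
  by rewrite C1 Cp /m /=; ring.
apply: (mulfI (s0 n)); apply: (mulfI (s0 n.+1)); rewrite e1.
have -> : s n.+1 * (s n.+1 * Fn m.-1 ^+ 2 * Fn m.+1 ^+ 2 * (mulx m.-1 - mulx m.+1)) =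
  (Fn m.+1 * Fn m.-1 * s n.+1) ^+ 2 * (mulx m.-1 - mulx m.+1) by ring.
rewrite C0.
have -> : ((x - mulx m) * (s n * Fn m ^+ 2)) ^+ 2 * (mulx m.-1 - mulx m.+1) =
  ((mulx m.-1 - mulx m.+1) * (mulx m - x) ^+ 2) * (s n * Fn m ^+ 2) ^+ 2 by ring.
by rewrite M -(sE n); ring.
Qed.

(** Passage to the even index 2m, whose neighbours are odd. The product f_(2m+1) f_(2m-1) contains
    (x_m - x_(m+1)) (x_(m-1) - x_m), which [add_dup] turns into x - x_2m. *)
Let odd_step m : (1 < m)%N ->
  Fn m.*2.+1 = (mulx m - mulx m.+1) * w * Fn m ^+ 2 * Fn m.+1 ^+ 2 ->
  Fn m.-1.*2.+1 = (mulx m.-1 - mulx m) * w * Fn m.-1 ^+ 2 * Fn m ^+ 2 ->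
  Fn m.*2 = mulc m * g m ^+ 2 -> eds_rel m -> eds_rel m.*2.
Proof.
move=> m1 T1 T0 S1; rewrite /eds_rel !gE => C0.
have Es : s m.*2 = w by rewrite wsE odd_double.
have Et : s m.*2.+1 = 1 by rewrite wsE /= odd_double rmorph1.
have -> : m.*2.-1 = m.-1.*2.+1 by case: m m1 {T1 T0 S1 C0 Es Et}.
rewrite T1 T0 S1 Es Et gE.
have A : (mulx m - mulx m.+1) * (mulx m.-1 - mulx m) * (mulx m - x) ^+ 2 =
    (x - mulx m.*2) * (mulc m ^+ 2 * w).
  case: m m1 {T1 T0 S1 C0 Es Et} => [|[|n]] // _.
  have := @add_dup F two0 w b2 b4 b6 (mulx n.+2) (mulc n.+2) (mulx 1) (mulc 1)
    (@mulx_neq n.+1 0 isT) (mulx_cubic_neq0 _) (mulx_curve _) (mulx_curve _).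
  by rewrite -mulx_add // -mulx_sub // mulx1 addn1 subn1 -mulx_dup mulx_curve.
have -> : (mulx m - mulx m.+1) * w * Fn m ^+ 2 * Fn m.+1 ^+ 2 *
  ((mulx m.-1 - mulx m) * w * Fn m.-1 ^+ 2 * Fn m ^+ 2) * 1 =
  (mulx m - mulx m.+1) * (mulx m.-1 - mulx m) * s m ^+ 2 * Fn m ^+ 4 * (Fn m.+1 * Fn m.-1 * s m.+1) ^+ 2.
  by rewrite -(sE m); ring.
rewrite C0.
have -> : (mulx m - mulx m.+1) * (mulx m.-1 - mulx m) * s m ^+ 2 * Fn m ^+ 4 *
  ((x - mulx m) * (s m * Fn m ^+ 2)) ^+ 2 =
  (mulx m - mulx m.+1) * (mulx m.-1 - mulx m) * (mulx m - x) ^+ 2 * (s m * Fn m ^+ 2) ^+ 4 by ring.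
by rewrite A; ring.
Qed.

(** Passage to the odd index 2m + 1, whose neighbours are even. The product f_(2m+2) f_2m contains
    c_(m+1) c_m, and [addx_sub] for the multiples m + 1 and m, whose difference is the generic
    point, turns it into x - x_(2m+1). *)
Let even_step m : (0 < m)%N ->
  Fn m.*2.+1 = (mulx m - mulx m.+1) * w * Fn m ^+ 2 * Fn m.+1 ^+ 2 ->
  Fn m.*2 = mulc m * g m ^+ 2 -> Fn m.+1.*2 = mulc m.+1 * g m.+1 ^+ 2 ->
  eds_rel m.*2.+1.
Proof.
move=> m0 T1 S0 S1; rewrite /eds_rel !gE -doubleS [m.*2.+1.-1]/= T1 S0 S1 !gE.
have Es : s m.*2.+1 = 1 by rewrite wsE /= odd_double rmorph1.
have Et : s m.+1.*2 = w by rewrite wsE odd_double.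
have A : (x - mulx m.*2.+1) * (mulx m.+1 - mulx m) ^+ 2 = mulc m.+1 * mulc m * w.
  case: m m0 {T1 S0 S1 Es Et} => [|n] // _.
  have ne : n.+1 != n by rewrite gtn_eqF.
  have := @addx_sub F two0 w b2 (mulx n.+2) (mulc n.+2) (mulx n.+1) (mulc n.+1) (mulx_neq ne).
  rewrite -mulx_add // -mulx_sub // subSnn mulx1.
  by have -> : (n.+2 + n.+1)%N = n.+1.*2.+1 by rewrite -addnn addSn.
rewrite Es Et.
have -> : mulc m.+1 * (s m.+1 * Fn m.+1 ^+ 2) ^+ 2 * (mulc m * (s m * Fn m ^+ 2) ^+ 2) * w =
  (mulc m.+1 * mulc m * w) * (s m * s m.+1) ^+ 2 * Fn m ^+ 4 * Fn m.+1 ^+ 4 by ring.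
by rewrite -A sE; ring.
Qed.

Local Notation b8 := (cst (wb8 E)).

Let TD p q : T (p + q) = T p + T q. Proof. exact: rmorphD. Qed.
Let TZ c p : T (c *: p) = cst c * T p.
Proof. by rewrite -mul_polyC rmorphM. Qed.
Let TC c p : T (c%:P * p) = cst c * T p.
Proof. by rewrite rmorphM. Qed.
Let TX n : T 'X^n = x ^+ n. Proof. by rewrite rmorphXn. Qed.

Let b8E : 4 * b8 = b2 * b6 - b4 ^+ 2.
Proof. by rewrite -(rmorph_nat cst) -!rmorphM wdisc_b rmorphB rmorphM rmorphXn. Qed.

Let T_divf3 : T (divf3 E) = 3 * x ^+ 4 + b2 * x ^+ 3 + 3 * b4 * x ^+ 2 + 3 * b6 * x + b8.
Proof.
rewrite /divf3 !TD !TZ !TC !TX (rmorphM cst 3 (wb4 E)) (rmorphM cst 3 (wb6 E)).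
by rewrite !(rmorph_nat cst).
Qed.

Let T_divf4 : T (divf4 E) = 2 * x ^+ 6 + b2 * x ^+ 5 + 5 * b4 * x ^+ 4
  + 10 * b6 * x ^+ 3 + 10 * b8 * x ^+ 2 + (b2 * b8 - b4 * b6) * x + (b4 * b8 - b6 ^+ 2).
Proof.
rewrite /divf4 !TD !TZ !TC !TX -!cstE (rmorphM cst 5 (wb4 E)) (rmorphM cst 10 (wb6 E)).
rewrite (rmorphM cst 10 (wb8 E)) (rmorphB cst (_ * wb8 E)) (rmorphM cst (wb2 E)).
rewrite (rmorphM cst (wb4 E) (wb6 E)) (rmorphB cst (_ * wb8 E)) (rmorphM cst (wb4 E)).
by rewrite (rmorphXn cst 2 (wb6 E)) !(rmorph_nat cst).
Qed.

Let wE : w = cubic b2 b4 b6 x. Proof. by rewrite T_psi2sq fev_cubic. Qed.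

Let divf3_identity (K : fieldType) (B2 B4 B6 B8 X : K) : 4 * B8 = B2 * B6 - B4 ^+ 2 ->
  2 != 0 :> K -> cubic B2 B4 B6 X != 0 ->
  3 * X ^+ 4 + B2 * X ^+ 3 + 3 * B4 * X ^+ 2 + 3 * B6 * X + B8 =
  (X - dupx B2 B4 B6 X) * cubic B2 B4 B6 X.
Proof.
move=> E8 k2 P0; have k4 : 4 != 0 :> K.
  have -> : 4 = 2 ^+ 2 :> K by ring.
  by rewrite expf_neq0.
have k16 : 16 != 0 :> K.
  have -> : 16 = 4 ^+ 2 :> K by ring.
  by rewrite expf_neq0.
have -> : B8 = (B2 * B6 - B4 ^+ 2) / 4 by apply: (mulIf k4); rewrite divfK // -E8 mulrC.
have -> : (X - dupx B2 B4 B6 X) * cubic B2 B4 B6 X =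
  (3 * X + B2 / 4) * cubic B2 B4 B6 X - cubic' B2 B4 X ^+ 2 / 16.
  by rewrite /dupx; field; rewrite P0 k4 k16.
by rewrite /cubic /cubic'; field; rewrite k4 k16.
Qed.

(** The right side is P^2 times half the derivative of [dupx]. At the generic point this is c_2
    psi_2^4, the case m = 2 of the formula for psi_2m / psi_2, which the recursion cannot supply. *)
Let divf4_identity (K : fieldType) (B2 B4 B6 B8 X : K) : 4 * B8 = B2 * B6 - B4 ^+ 2 ->
  2 != 0 :> K ->
  let P := cubic B2 B4 B6 X in let N := cubic' B2 B4 X in
  2 * X ^+ 6 + B2 * X ^+ 5 + 5 * B4 * X ^+ 4
  + 10 * B6 * X ^+ 3 + 10 * B8 * X ^+ 2 + (B2 * B8 - B4 * B6) * X + (B4 * B8 - B6 ^+ 2) =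
  (2 * N * (24 * X + 2 * B2) * P - N ^+ 2 * N) / 32 - P ^+ 2.
Proof.
move=> E8 k2 P N; have k4 : 4 != 0 :> K.
  have -> : 4 = 2 ^+ 2 :> K by ring.
  by rewrite expf_neq0.
have k32 : 32 != 0 :> K.
  have -> : 32 = 2 ^+ 5 :> K by ring.
  by rewrite expf_neq0.
have -> : B8 = (B2 * B6 - B4 ^+ 2) / 4 by apply: (mulIf k4); rewrite divfK // -E8 mulrC.
by rewrite /P /N /cubic /cubic'; field; rewrite k4 k32.
Qed.

Let cub0 : cubic b2 b4 b6 x != 0. Proof. exact: (mulx_cubic_neq0 0). Qed.

Let Fn3 : Fn 3 = (x - mulx 2) * w.
Proof. by rewrite [divf E 3]/= T_divf3 wE; apply: divf3_identity. Qed.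

Let Fn4 : Fn 4 = mulc 2 * w ^+ 2.
Proof.
have k32 : 32 != 0 :> F by rewrite natF.
have k16 : 16 != 0 :> F by rewrite natF.
rewrite [divf E 4]/= T_divf4 wE divf4_identity //.
rewrite /mulc /solc [mulx 2]/= fD_soldup // fDx mulr1 rmorph_nat.
by move: cub0 => P0; field; rewrite P0 k16 k32 two0.
Qed.

Lemma eds n : eds_rel n.+1.
Proof.
have C1 : eds_rel 1 by rewrite /eds_rel mulx1 subrr mul0r rmorph0 mulr0 mul0r.
have C2 : eds_rel 2.
  rewrite /eds_rel gE; suff : Fn 3 * T 1 * T 1 = (x - mulx 2) * (w * T 1 ^+ 2) by [].
  by rewrite rmorph1 Fn3 expr1n !mulr1.
have T1 : Fn 1.*2.+1 = (mulx 1 - mulx 2) * w * Fn 1 ^+ 2 * Fn 2 ^+ 2.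
  suff : Fn 3 = (x - mulx 2) * w * T 1 ^+ 2 * T 1 ^+ 2 by [].
  by rewrite rmorph1 Fn3 !expr1n !mulr1.
have S1 : Fn 1.*2 = mulc 1 * g 1 ^+ 2.
  rewrite gE mulc1; suff : T 1 = 1 * (T 1 * T 1 ^+ 2) ^+ 2 by [].
  by rewrite rmorph1; ring.
have S2 : Fn 2.*2 = mulc 2 * g 2 ^+ 2.
  rewrite gE; suff : Fn 4 = mulc 2 * (w * T 1 ^+ 2) ^+ 2 by [].
  by rewrite rmorph1 expr1n mulr1 Fn4.
have C3 : eds_rel 3 := even_step (isT : (0 < 1)%N) T1 S1 S2.
elim/ltn_ind: n => n IH; have IH' k : (0 < k)%N -> (k < n.+1)%N -> eds_rel k.
  by case: k => // k _ lt; apply: IH.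
have [le|gt] := leqP n 2; first by case: n le {IH IH'} => [|[|[|]]].
have odd_m m : (1 < m)%N -> (m.+1 < n.+1)%N ->
    Fn m.*2.+1 = (mulx m - mulx m.+1) * w * Fn m ^+ 2 * Fn m.+1 ^+ 2.
  by move=> m1 mn; apply: eds_odd => //; apply: IH' => //; lia.
have even_m m : (1 < m)%N -> (m.+1 < n.+1)%N -> Fn m.*2 = mulc m * g m ^+ 2.
  by move=> m1 mn; apply: eds_even => //; apply: IH' => //; lia.
case: (boolP (odd n.+1)) => par.
  have E1 : n.+1 = n./2.*2.+1 by rewrite -[in LHS](odd_double_half n); move: par => /= /negPf ->.
  rewrite E1; apply: even_step; [lia | | |].
  - by apply: odd_m; lia.
  - by apply: even_m; lia.
  - by apply: even_m; lia.
have E1 : n.+1 = n.+1./2.*2 by rewrite -[in LHS](odd_double_half n.+1) (negPf par).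
set m := n.+1./2 in E1; rewrite E1; have m1 : (1 < m)%N by lia.
apply: odd_step => //.
- by apply: odd_m; lia.
(* For m = 2 the lower factor is f_3, an initial value rather than an instance of the recursion. *)
- case: (eqVneq m 2) => [->|ne]; first exact: T1.
  have -> : mulx m = mulx m.-1.+1 by rewrite prednK //; lia.
  have -> : Fn m = Fn m.-1.+1 by rewrite prednK //; lia.
  by apply: odd_m; lia.
- by apply: even_m; lia.
- by apply: IH'; lia.
Qed.

Lemma divf_double n : Fn n.+1.*2 = mulc n.+1 * g n.+1 ^+ 2.
Proof.
case: n => [|n]; last by apply: eds_even => //; apply: eds.
rewrite gE mulc1; suff : T 1 = 1 * (T 1 * T 1 ^+ 2) ^+ 2 by [].
by rewrite rmorph1; ring.
Qed.

Lemma theta_mulx n : T (theta E n.+1) = mulx n.+1 * g n.+1.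
Proof.
rewrite thetaE; have := eds n; rewrite /eds_rel wsSS [n.+1.-1]/= => H.
rewrite rmorphB !(rmorphM (toF F)).
have -> : s n * (Fn n.+2 * Fn n) = Fn n.+2 * Fn n * s n by ring.
by rewrite H; ring.
Qed.

End EllipticDivisibility.

(** * Division polynomials in characteristic zero *)

Lemma ex_irreducible_factor (K : fieldType) (p : {poly K}) : (1 < size p)%N ->
  exists2 q, irreducible_poly q & q %| p.
Proof.
have [n] := ubnP (size p); elim: n p => // n IH p; rewrite ltnS => le p1.
have [irr|red] := classic (irreducible_poly p); first by exists p.
have [q /not_or_and[q1 /not_or_and[qp nqp]]] : exists q : {poly K}, ~ (size q == 1%N \/ ~ q %| p \/ q %= p).
  apply: NNPP => H; apply: red; split=> // q q1 qp; apply: NNPP => nqp.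
  by apply: H; exists q; case=> [|[]] //; apply/negP.
have {}qp : q %| p by apply: NNPP.
have p0 : p != 0 by rewrite -size_poly_gt0 ltnW.
have q0 : q != 0 by apply: contraNneq p0 => q0; move: qp; rewrite q0 dvd0p.
have sq : (1 < size q)%N by move/negP: q1; move: q0; rewrite -size_poly_gt0; case: (size q) => [|[]].
have lt : (size q < size p)%N.
  rewrite ltn_neqAle dvdp_leq // andbT; apply/negP => E; apply: nqp.
  by rewrite -dvdp_size_eqp.
have [|r irr rq] := IH q _ sq; first exact: leq_trans lt le.
by exists r => //; apply: dvdp_trans rq qp.
Qed.

Lemma not_coprime_factor (K : fieldType) (p q : {poly K}) : q != 0 -> ~~ coprimep p q ->
  exists r, [/\ irreducible_poly r, r %| p & r %| q].
Proof.
move=> q0; rewrite /coprimep => H; have g0 : gcdp p q != 0 by rewrite gcdp_eq0 negb_and q0 orbT.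
have [|r irr rd] := @ex_irreducible_factor K (gcdp p q).
  by move: H g0; rewrite -size_poly_gt0; case: (size _) => [|[]].
by exists r; split=> //; apply: dvdp_trans rd _; rewrite ?dvdp_gcdl ?dvdp_gcdr.
Qed.

Opaque theta psi_sq divf psi2sq wb2 wb4 wb6 wb8 ws.

Section DivisionPolynomialsChar0.
Variable L : fieldType.
Hypothesis char0 : forall n, (n%:R == 0 :> L) = (n == 0)%N.
Variable E : wcurve L.
Variable F : diff_frac L.
Local Notation v := (inf_place F).
Local Notation T := (toF F).
Local Notation x := (T 'X).
Local Notation b2 := (cst F (wb2 E)).
Local Notation b4 := (cst F (wb4 E)).
Local Notation b6 := (cst F (wb6 E)).
Local Notation b8 := (cst F (wb8 E)).
Local Notation w := (T (psi2sq E)).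
Local Notation g n := (psi_sq E n).
Local Notation th n := (theta E n).

Let natF n : (n%:R == 0 :> F) = (n == 0)%N.
Proof. by rewrite -(rmorph_nat (cst F)) cst_eq0. Qed.

Let T_inj (p q : {poly L}) : T p = T q -> p = q.
Proof. by move=> H; apply/eqP; rewrite -subr_eq0 -(toF_eq0 F) rmorphB H subrr. Qed.

Lemma divf_neq0 n : divf E n.+1 != 0.
Proof.
elim: n => [|[|n] IH]; rewrite ?divf1 ?divf2 ?oner_neq0 //.
have := eds F char0 E n.+1; rewrite /eds_rel => H.
have : (x - mulx F E n.+2) * T (g n.+2) != 0.
  rewrite mulf_neq0 ?toF_eq0 //; first by rewrite subr_eq0 -(mulx1 F E) mulx_neq.
  by rewrite psi_sqE wsE; case: odd; rewrite mulf_neq0 ?expf_neq0 ?oner_eq0 ?psi2sq_neq0.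
by rewrite -H !mulf_eq0 !negb_or toF_eq0 => /andP[/andP[]].
Qed.

Lemma psi_sq_neq0 n : g n.+1 != 0.
Proof. by rewrite psi_sqE wsE; case: odd; rewrite mulf_neq0 ?expf_neq0 ?oner_eq0 ?psi2sq_neq0 ?divf_neq0. Qed.

Lemma psi_sq_mul n : g n.+2 * g n = (th n.+1 - 'X * g n.+1) ^+ 2.
Proof.
by rewrite thetaE !psi_sqE wsSS; ring.
Qed.

Lemma mulxE n : mulx F E n.+1 = T (th n.+1) / T (g n.+1).
Proof. by rewrite theta_mulx // mulfK // toF_eq0 psi_sq_neq0. Qed.

Let deriv_transfer (t u f : {poly L}) (k : F) : T u != 0 -> k != 0 ->
  T f = fD (T t / T u) / k * T u ^+ 2 -> k * T f = T (t^`() * u - t * u^`()).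
Proof.
move=> u0 k0 ->; rewrite fDdiv // !fD_poly.
rewrite !(rmorphM (toF F), rmorphB (toF F)).
by field; rewrite u0 k0.
Qed.

(** The quotient rule for x_n = theta_n / psi_n^2, together with x_n' = n c_n and f_2n = c_n
    psi_n^4. The explicit factor n is what vanishes after specialization to characteristic n. *)
Lemma theta_deriv n :
  (th n.+1)^`() * g n.+1 - th n.+1 * (g n.+1)^`() = n.+1%:R * divf E n.+1.*2.
Proof.
apply: T_inj; have g0 : T (g n.+1) != 0 by rewrite toF_eq0 psi_sq_neq0.
rewrite rmorphM rmorph_nat; apply/esym/deriv_transfer; rewrite ?natF //.
by rewrite divf_double // /mulc /solc rmorph_nat mulxE.
Qed.

Let curve_transfer (t u f W : {poly L}) (c2 c4 c6 : L) (X c : F) :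
  T u != 0 -> X = T t / T u -> T f = c * T u ^+ 2 ->
  c ^+ 2 * T W = cubic (cst F c2) (cst F c4) (cst F c6) X ->
  f ^+ 2 * W = u * (4 * t ^+ 3 + c2%:P * t ^+ 2 * u
    + 2 * c4%:P * t * u ^+ 2 + c6%:P * u ^+ 3).
Proof.
move=> u0 -> Ef H; apply: T_inj.
rewrite !(rmorph_nat (toF F), rmorphXn (toF F), rmorphM (toF F), rmorphD (toF F)) -!cstE Ef.
have -> : (c * T u ^+ 2) ^+ 2 * T W = c ^+ 2 * T W * T u ^+ 4 by ring.
by rewrite H /cubic; field; rewrite u0.
Qed.

Lemma theta_curve n : divf E n.+1.*2 ^+ 2 * psi2sq E =
  g n.+1 * (4 * th n.+1 ^+ 3 + (wb2 E)%:P * th n.+1 ^+ 2 * g n.+1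
    + 2 * (wb4 E)%:P * th n.+1 * g n.+1 ^+ 2 + (wb6 E)%:P * g n.+1 ^+ 3).
Proof.
have g0 : T (g n.+1) != 0 by rewrite toF_eq0 psi_sq_neq0.
exact: (curve_transfer g0 (mulxE n) (divf_double F char0 E n) (mulx_curve F char0 E n)).
Qed.

Let res_lead (p : {poly L}) k c : c != 0 -> res v (T p / x ^+ k) c ->
  size p = k.+1 /\ lead_coef p = c.
Proof.
move=> c0 r; have x0 := x_neq0 F; have [n0 vn] := res_neq0 c0 r.
have p0 : p != 0 by apply: contraNneq n0 => ->; rewrite rmorph0 mul0r.
have S : size p = k.+1.
  move: vn; rewrite pvalM ?invr_eq0 ?toF_eq0 ?expf_neq0 // valV ?expf_neq0 // valX //.
  rewrite inf_placeX inf_placeE //; move: p0; rewrite -size_poly_gt0.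
  by move: (size p); clear; case=> // m _; lia.
split=> //; have := fev_lead x0 (vx F) p0; rewrite fev_id S => r'.
exact: res_uniq r' r.
Qed.

Let res_mulx n : res v (mulx F E n.+1 / x) (n.+1%:R ^- 2).
Proof. by have [] := sol_lead char0 _ (mulx_sol F char0 E n); rewrite ?char0. Qed.

(** Degree n^2 - 1 and leading coefficient n^2, by an induction of step two: the relation
    psi_(n+1)^2 psi_(n-1)^2 = (theta_n - x psi_n^2)^2 determines psi_(n+1)^2, and x_n / x has
    residue n^(-2). *)
Let res_psi_sq n : res v (T (g n.+1) / x ^+ (n.+1 ^ 2 - 1)) (n.+1%:R ^+ 2).
Proof.
elim/ltn_ind: n => -[|[|n]] IH.
- by rewrite psi_sq1 rmorph1 subnn expr0 divr1 expr1n; apply: res1.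
- rewrite psi_sq2; have -> : 2 ^+ 2 = 4 :> L by ring.
  exact: (res_psi2sq F char0 E).
have x0 := x_neq0 F; have g0 : T (g n.+1) != 0 by rewrite toF_eq0 psi_sq_neq0.
have n1 : n.+1%:R != 0 :> L by rewrite char0.
have n2 : n.+2%:R != 0 :> L by rewrite char0.
have E1 : T (g n.+3) = (mulx F E n.+2 - x) ^+ 2 * T (g n.+2) ^+ 2 / T (g n.+1).
  apply: (mulIf g0); rewrite divfK // -rmorphM psi_sq_mul rmorphXn rmorphB rmorphM theta_mulx //.
  by ring.
have Ek : ((n.+3 ^ 2 - 1) + (n.+1 ^ 2 - 1) = 2 + ((n.+2 ^ 2 - 1) + (n.+2 ^ 2 - 1)))%N by lia.
have -> : T (g n.+3) / x ^+ (n.+3 ^ 2 - 1) = (mulx F E n.+2 / x - 1) ^+ 2 *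
   (T (g n.+2) / x ^+ (n.+2 ^ 2 - 1)) ^+ 2 / (T (g n.+1) / x ^+ (n.+1 ^ 2 - 1)).
  have -> : x ^- (n.+3 ^ 2 - 1) = x ^+ (n.+1 ^ 2 - 1) / (x ^+ 2 * (x ^+ (n.+2 ^ 2 - 1) * x ^+ (n.+2 ^ 2 - 1))).
    by rewrite -!exprD -Ek exprD; field; rewrite !expf_neq0.
  by rewrite E1; field; rewrite g0 x0 !expf_neq0.
(* With N the middle index this is (N^(-2) - 1)^2 N^4 / (N - 1)^2 = (N + 1)^2. *)
have -> : n.+3%:R ^+ 2 = (n.+2%:R ^- 2 - 1) ^+ 2 * (n.+2%:R ^+ 2) ^+ 2 / n.+1%:R ^+ 2 :> L.
  have e3 : n.+3%:R = n.+1%:R + 2 :> L by rewrite -natrD addn2.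
  have e2 : n.+2%:R = n.+1%:R + 1 :> L by rewrite natr1.
  rewrite e3 e2; rewrite e2 in n2; move: n1 n2; move: (n.+1%:R : L) => k n1 n2.
  by field; rewrite n2 n1.
apply: resdiv; [by rewrite expf_neq0| |exact: (IH n)].
apply: resM; apply: resX; last exact: (IH n.+1).
by apply: resB; [apply: res_mulx | apply: res1].
Qed.

Lemma psi_sq_size n : size (g n.+1) = (n.+1 ^ 2)%N.
Proof.
have c0 : n.+1%:R ^+ 2 != 0 :> L by rewrite expf_neq0 ?char0.
by have [-> _] := res_lead c0 (res_psi_sq n); rewrite subn1 prednK // expn_gt0.
Qed.

Lemma theta_size_monic n : size (th n.+1) = (n.+1 ^ 2).+1 /\ th n.+1 \is monic.
Proof.
have n0 : n.+1%:R != 0 :> L by rewrite char0.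
suff r : res v (T (th n.+1) / x ^+ (n.+1 ^ 2)) 1.
  by have [-> l1] := res_lead (oner_neq0 L) r; rewrite monicE l1.
have -> : T (th n.+1) / x ^+ (n.+1 ^ 2) = mulx F E n.+1 / x * (T (g n.+1) / x ^+ (n.+1 ^ 2 - 1)).
  have -> : x ^+ (n.+1 ^ 2) = x * x ^+ (n.+1 ^ 2 - 1).
    by rewrite -exprS subn1 prednK // expn_gt0.
  by rewrite theta_mulx //; field; rewrite x_neq0 expf_neq0 ?x_neq0.
have -> : 1 = n.+1%:R ^- 2 * n.+1%:R ^+ 2 :> L by rewrite mulVf // expf_neq0.
by apply: resM; [apply: res_mulx | apply: res_psi_sq].
Qed.

Let A2 := (wb2 E)%:P.
Let A4 := (wb4 E)%:P.
Let A6 := (wb6 E)%:P.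
Let A8 := (wb8 E)%:P.

Transparent psi2sq.
Let psi2sqE : psi2sq E = 4 * 'X^3 + A2 * 'X^2 + 2 * A4 * 'X + A6.
Proof. by rewrite /psi2sq -mul_polyC !rmorphM /= !rmorph_nat. Qed.

Let theta2E : th 2 = 'X^4 - A4 * 'X^2 - 2 * A6 * 'X - A8.
Proof.
rewrite theta2 psi2sqE /divf3 -mul_polyC (rmorphM polyC 3 (wb4 E)) (rmorphM polyC 3 (wb6 E)).
by rewrite !(rmorph_nat polyC) -/A2 -/A4 -/A6 -/A8; ring.
Qed.

Lemma deriv_psi2sqE :
  (psi2sq E)^`() = 12 * 'X^2 + 2 * (wb2 E)%:P * 'X + 2 * (wb4 E)%:P.
Proof.
rewrite /psi2sq !derivD derivZ (derivM _ 'X^2) (derivM _ 'X) !derivXn derivX !derivC.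
by rewrite -mul_polyC (rmorphM polyC 2) !(rmorph_nat polyC) /= -/A2 -/A4; ring.
Qed.

Opaque psi2sq.
Let A8E : 4 * A8 = A2 * A6 - A4 ^+ 2.
Proof. by rewrite -(rmorph_nat polyC) -!rmorphM wdisc_b rmorphB rmorphM rmorphXn. Qed.

Hypothesis ellE : elliptic E.

Lemma disc_polyC (c2 c4 c6 : L) :
  (- 144 * (- c2 ^+ 2 * (c2 * c6 - c4 ^+ 2)
    - 32 * c4 ^+ 3 - 108 * c6 ^+ 2 + 36 * c2 * c4 * c6))%:P =
  - 144 * (- c2%:P ^+ 2 * (c2%:P * c6%:P - c4%:P ^+ 2)
    - 32 * c4%:P ^+ 3 - 108 * c6%:P ^+ 2 + 36 * c2%:P * c4%:P * c6%:P).
Proof.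
by rewrite !(rmorph_nat polyC, rmorphN polyC, rmorphXn polyC, rmorphM polyC, rmorphD polyC, rmorphB polyC).
Qed.

Lemma disc_psi2sq : - 576 * wdisc E =
  - 144 * (- wb2 E ^+ 2 * (wb2 E * wb6 E - wb4 E ^+ 2)
    - 32 * wb4 E ^+ 3 - 108 * wb6 E ^+ 2 + 36 * wb2 E * wb4 E * wb6 E).
Proof. by rewrite -wdisc_b /wdisc; ring. Qed.

Let disc_bezout : exists a b, a * psi2sq E + b * (psi2sq E)^`() = (- 576 * wdisc E)%:P.
Proof.
(* Euclid's algorithm for g = psi_2^2 and g': r = 36 g - (12 x + b2) g' is the linear remainder p x
   + q. Substituting x = (r - q)/p in p^2 g' gives k r plus a constant, and that constant is -576
   times the discriminant. *)
pose p := 48 * A4 - 2 * A2 ^+ 2; pose q := 36 * A6 - 2 * A2 * A4.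
pose r := p * 'X + q; pose k := 12 * (r - 2 * q) + 2 * A2 * p.
exists (- (36 * k)), (p ^+ 2 + (12 * 'X + A2) * k).
rewrite disc_psi2sq disc_polyC deriv_psi2sqE psi2sqE /k /r /p /q -/A2 -/A4 -/A6.
by ring.
Qed.

Lemma psi2sq_separable : coprimep (psi2sq E) (psi2sq E)^`().
Proof.
have [a [b H]] := disc_bezout; apply/Bezout_coprimepP; exists (a, b); rewrite /= H.
by rewrite polyC_eqp1 mulf_neq0 // oppr_eq0 char0.
Qed.

(** By the duplication formula g'^2 = 16 theta_2 + (4 b2 + 32 x) g with g = psi_2^2, so a common
    factor of g and theta_2 would divide g'^2, while g is separable. *)
Lemma coprime_psi2sq_theta2 : coprimep (psi2sq E) (th 2).
Proof.
have c16 : (16 : {poly L}) = 16%:P by rewrite rmorph_nat.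
have nz : (16 : L) != 0 by rewrite char0.
have H : (psi2sq E)^`() ^+ 2 = 16 * th 2 + (4 * A2 + 32 * 'X) * psi2sq E.
  have -> : 16 * th 2 = 16 * ('X^4 - A4 * 'X^2 - 2 * A6 * 'X) - 4 * (4 * A8).
    by rewrite theta2E; ring.
  by rewrite A8E deriv_psi2sqE psi2sqE; ring.
have := coprimep_expr 2 psi2sq_separable; rewrite H addrC coprimep_addl_mul.
by rewrite c16 mul_polyC coprimepZr.
Qed.

Let mulx_pm n : [/\ mulx F E n.+2 != x,
  mulx F E n.+3 = addx w b2 (mulx F E n.+2) (mulc F E n.+2) x 1,
  mulx F E n.+1 = addx w b2 (mulx F E n.+2) (mulc F E n.+2) x (- 1),
  mulc F E n.+2 ^+ 2 * w = cubic b2 b4 b6 (mulx F E n.+2) & 1 ^+ 2 * w = cubic b2 b4 b6 x].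
Proof.
have ne : n.+1 != 0%N by [].
split; [exact: (mulx_neq F char0 E ne) | | | exact: mulx_curve |].
- by have := mulx_add F char0 E ne; rewrite mulc1 mulx1 addn1.
- by have := @mulx_sub L F char0 E n.+1 0 isT; rewrite mulc1 mulx1 subn1.
- by have := mulx_curve F char0 E 0; rewrite mulc1 mulx1.
Qed.

(** The common denominator of x_(n+1) and x_(n-1) is gp gm, which equals (X - x)^2 u^2; hence the
    identity for rational functions clears to one for polynomials without a spurious factor. *)
Let sum_transfer (tp tm t gp gm u : {poly L}) (c2 c4 c6 : L) (Xp Xm X : F) :
  T tp = Xp * T gp -> T tm = Xm * T gm -> T t = X * T u ->
  gp * gm = (t - 'X * u) ^+ 2 ->
  2 * (Xp + Xm) * (X - x) ^+ 2 = 4 * X * x * (X + x) + 2 * cst F c2 * X * x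
    + 2 * cst F c4 * (X + x) + 2 * cst F c6 ->
  2 * (tp * gm + tm * gp) =
  4 * t * 'X * (t + 'X * u) + 2 * c2%:P * t * 'X * u
  + 2 * c4%:P * (t + 'X * u) * u + 2 * c6%:P * u ^+ 2.
Proof.
move=> Ep Em Et Eg H; apply: T_inj; have /(congr1 T) := Eg.
rewrite !(rmorph_nat (toF F), rmorphXn (toF F), rmorphM (toF F), rmorphN (toF F), rmorphD (toF F)) -!cstE Ep Em Et.
move=> Hg.
have -> : 2 * (Xp * T gp * T gm + Xm * T gm * T gp) = 2 * (Xp + Xm) * (T gp * T gm) by ring.
have -> : 2 * (Xp + Xm) * (T gp * T gm) = 2 * (Xp + Xm) * (X - x) ^+ 2 * T u ^+ 2.
  by rewrite Hg; ring.
by rewrite H; ring.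
Qed.

Let prod_transfer (tp tm t gp gm u : {poly L}) (c4 c6 c8 : L) (Xp Xm X : F) :
  T tp = Xp * T gp -> T tm = Xm * T gm -> T t = X * T u ->
  gp * gm = (t - 'X * u) ^+ 2 ->
  Xp * Xm * (X - x) ^+ 2 = X ^+ 2 * x ^+ 2 - cst F c4 * X * x - cst F c6 * (X + x) - cst F c8 ->
  tp * tm = t ^+ 2 * 'X^2 - c4%:P * t * 'X * u - c6%:P * (t + 'X * u) * u - c8%:P * u ^+ 2.
Proof.
move=> Ep Em Et Eg H; apply: T_inj; have /(congr1 T) := Eg.
rewrite !(rmorphXn (toF F), rmorphM (toF F), rmorphN (toF F), rmorphD (toF F)) -!cstE Ep Em Et.
move=> Hg.
have -> : Xp * T gp * (Xm * T gm) = Xp * Xm * (T gp * T gm) by ring.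
have -> : Xp * Xm * (T gp * T gm) = Xp * Xm * (X - x) ^+ 2 * T u ^+ 2 by rewrite Hg; ring.
by rewrite H; ring.
Qed.

Let theta_sum n : 2 * (th n.+3 * g n.+1 + th n.+1 * g n.+3) =
  4 * th n.+2 * 'X * (th n.+2 + 'X * g n.+2) + 2 * A2 * th n.+2 * 'X * g n.+2
  + 2 * A4 * (th n.+2 + 'X * g n.+2) * g n.+2 + 2 * A6 * g n.+2 ^+ 2.
Proof.
have [ne Ep Em c1 c2] := mulx_pm n.
have two0 : 2 != 0 :> F by rewrite natF.
have := addx_sum two0 ne c1 c2; rewrite -Ep -Em.
by apply: sum_transfer; rewrite ?theta_mulx // psi_sq_mul.
Qed.

Let theta_prod n : th n.+3 * th n.+1 = th n.+2 ^+ 2 * 'X^2 - A4 * th n.+2 * 'X * g n.+2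
  - A6 * (th n.+2 + 'X * g n.+2) * g n.+2 - A8 * g n.+2 ^+ 2.
Proof.
have [ne Ep Em c1 c2] := mulx_pm n.
have two0 : 2 != 0 :> F by rewrite natF.
have e8 : 4 * b8 = b2 * b6 - b4 ^+ 2.
  by rewrite -(rmorph_nat (cst F)) -!rmorphM wdisc_b rmorphB rmorphM rmorphXn.
have := addx_prod two0 ne e8 c1 c2; rewrite -Ep -Em.
by apply: prod_transfer; rewrite ?theta_mulx // psi_sq_mul.
Qed.

(* An irreducible common factor of theta_(n+1) and psi_(n+1)^2 makes theta_n = x psi_n^2, and then
   the sum and product of x([n+1]) and x([n-1]) show that it divides psi_n^2. *)
Lemma coprime_theta_psi_sq n : coprimep (th n.+1) (g n.+1).
Proof.
elim: n => [|[|n] IH].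
- by rewrite psi_sq1 coprimep1.
- by rewrite psi_sq2 coprimep_sym coprime_psi2sq_theta2.
apply/negPn/negP => /(not_coprime_factor (psi_sq_neq0 _))[r [irr rt rg]].
have dM := irreducible_dvdM irr.
have two0 : (2 : L) != 0 by rewrite char0.
have rs1 : ~~ (r %| 1) by rewrite dvdp1; case: irr => /ltn_eqF; rewrite eq_sym => ->.
have d1 : r %| th n.+2 - 'X * g n.+2.
  have : r %| (th n.+2 - 'X * g n.+2) ^+ 2 by rewrite -psi_sq_mul dvdp_mulr.
  by rewrite expr2 dM orbb.
have dg : r %| g n.+2 ^+ 2 * psi2sq E.
  have : r %| 2 * (th n.+3 * g n.+1 + th n.+1 * g n.+3).
    by apply: dvdp_mull; apply: dvdp_add; [apply: dvdp_mulr | apply: dvdp_mull].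
  rewrite theta_sum.
  set u := th n.+2 - 'X * g n.+2 in d1; have -> : th n.+2 = u + 'X * g n.+2 by rewrite /u; ring.
  have -> : 4 * (u + 'X * g n.+2) * 'X * (u + 'X * g n.+2 + 'X * g n.+2) +
   2 * A2 * (u + 'X * g n.+2) * 'X * g n.+2 + 2 * A4 * (u + 'X * g n.+2 + 'X * g n.+2) * g n.+2 +
   2 * A6 * g n.+2 ^+ 2 = 2 * (g n.+2 ^+ 2 * psi2sq E) +
     u * (4 * 'X * (u + 'X * g n.+2 + 'X * g n.+2) + 4 * 'X^2 * g n.+2 + 2 * A2 * 'X * g n.+2 + 2 * A4 * g n.+2).
    by rewrite psi2sqE; ring.
  have -> : 2 = 2%:P :> {poly L} by rewrite rmorph_nat.
  by rewrite (dvdp_addl _ (dvdp_mulr _ d1)) mul_polyC dvdpZr.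
have dt : r %| g n.+2 ^+ 2 * th 2.
  have : r %| th n.+3 * th n.+1 by apply: dvdp_mulr.
  rewrite theta_prod.
  set u := th n.+2 - 'X * g n.+2 in d1; have -> : th n.+2 = u + 'X * g n.+2 by rewrite /u; ring.
  have -> : (u + 'X * g n.+2) ^+ 2 * 'X^2 - A4 * (u + 'X * g n.+2) * 'X * g n.+2 -
   A6 * (u + 'X * g n.+2 + 'X * g n.+2) * g n.+2 - A8 * g n.+2 ^+ 2 = g n.+2 ^+ 2 * th 2 +
     u * (u * 'X^2 + 2 * 'X^3 * g n.+2 - A4 * 'X * g n.+2 - A6 * g n.+2).
    by rewrite theta2E; ring.
  by rewrite (dvdp_addl _ (dvdp_mulr _ d1)).
have dg1 : r %| g n.+2.
  move: dg dt; rewrite !dM; case: (r %| g n.+2) => //= d2 d3.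
  have := coprime_psi2sq_theta2; rewrite -gcdp_eqp1 => e.
  case/negP: rs1; rewrite -(eqp_dvdr _ e).
  by rewrite dvdp_gcd d2 d3.
have dth : r %| th n.+2.
  have -> : th n.+2 = (th n.+2 - 'X * g n.+2) + 'X * g n.+2 by ring.
  by rewrite dvdp_add // dvdp_mull.
case/negP: rs1; move: IH; rewrite -gcdp_eqp1 => e.
by rewrite -(eqp_dvdr _ e) dvdp_gcd dth dg1.
Qed.

End DivisionPolynomialsChar0.

(** * Base change *)

Section BaseChange.
Variables (R S : comNzRingType) (f : {rmorphism R -> S}).
Variables (b2 b4 b6 b8 : R).
Local Notation "p ^f" := (map_poly f p).
Local Notation rd n := (rdivf b2 b4 b6 b8 n).
Local Notation sd n := (rdivf (f b2) (f b4) (f b6) (f b8) n).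

Let mapZ c p : (c *: p)^f = f c *: p^f. Proof. exact: map_polyZ. Qed.
Let mapCM c p : (c%:P * p)^f = (f c)%:P * p^f.
Proof. by rewrite rmorphM /= map_polyC. Qed.

Lemma map_rpsi2sq : (rpsi2sq b2 b4 b6)^f = rpsi2sq (f b2) (f b4) (f b6).
Proof.
rewrite /rpsi2sq !(rmorphD (map_poly f)) /= mapZ !mapCM !map_polyXn map_polyX map_polyC /=.
by rewrite (rmorphM f) !(rmorph_nat f).
Qed.

Let map_rdivf3 : (rdivf3 b2 b4 b6 b8)^f = rdivf3 (f b2) (f b4) (f b6) (f b8).
Proof.
rewrite /rdivf3 !(rmorphD (map_poly f)) /= mapZ !mapCM !map_polyXn map_polyX map_polyC /=.
by rewrite !(rmorphM f) !(rmorph_nat f).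
Qed.

Let map_rdivf4 : (rdivf4 b2 b4 b6 b8)^f = rdivf4 (f b2) (f b4) (f b6) (f b8).
Proof.
rewrite /rdivf4 !(rmorphD (map_poly f)) /= mapZ !mapCM !map_polyXn map_polyX map_polyC /=.
by rewrite !(rmorphXn f, rmorphM f, rmorphB f) !(rmorph_nat f).
Qed.

Lemma map_rs n : (rs b2 b4 b6 n)^f = rs (f b2) (f b4) (f b6) n.
Proof. by rewrite /rs; case: odd; rewrite ?rmorph1 ?map_rpsi2sq. Qed.

Lemma map_rdivf n : (rd n)^f = sd n.
Proof.
elim/ltn_ind: n => -[|[|[|[|[|n]]]]] IH; rewrite ?rdivf3E ?rdivf4E ?map_rdivf3 ?map_rdivf4 //.
- by rewrite rdivf0 rmorph0.
- by rewrite rdivf1 rmorph1.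
- by rewrite rdivf2 rmorph1.
have := odd_double_half n.+4.+1; set m := n.+4.+1./2; case: odd => /= E.
  rewrite -E add1n !rdivf_odd; try by lia.
  rewrite !(rmorphB (map_poly f), rmorphM (map_poly f), rmorphXn (map_poly f)) /= !map_rs.
  by rewrite !IH //; lia.
rewrite -E add0n !rdivf_even; try by lia.
rewrite !(rmorphXn (map_poly f), rmorphM (map_poly f), rmorphB (map_poly f)) /=.
by rewrite !IH //; lia.
Qed.

Lemma map_rpsi_sq n : (rpsi_sq b2 b4 b6 b8 n)^f = rpsi_sq (f b2) (f b4) (f b6) (f b8) n.
Proof. by rewrite !rpsi_sqE rmorphM rmorphXn /= map_rs map_rdivf. Qed.

Lemma map_rtheta n : (rtheta b2 b4 b6 b8 n.+1)^f = rtheta (f b2) (f b4) (f b6) (f b8) n.+1.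
Proof.
by rewrite !rthetaE rmorphB !(rmorphM (map_poly f)) /= map_polyX map_rs !map_rdivf map_rpsi_sq.
Qed.

End BaseChange.

Transparent theta psi_sq divf psi2sq wb2 wb4 wb6 wb8 ws.

Section CurveBaseChange.
Variables (K L : fieldType) (f : {rmorphism K -> L}) (E : wcurve K).
Local Notation Ef := (wcurve_map f E).

Lemma wb2_map : wb2 Ef = f (wb2 E).
Proof. by rewrite /wb2 /= rmorphD rmorphXn rmorphM rmorph_nat. Qed.
Lemma wb4_map : wb4 Ef = f (wb4 E).
Proof. by rewrite /wb4 /= rmorphD !rmorphM rmorph_nat. Qed.
Lemma wb6_map : wb6 Ef = f (wb6 E).
Proof. by rewrite /wb6 /= rmorphD rmorphXn rmorphM rmorph_nat. Qed.
Lemma wb8_map : wb8 Ef = f (wb8 E).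
Proof.
by rewrite /wb8 /= !(rmorph_nat f, rmorphXn f, rmorphM f, rmorphN f, rmorphD f).
Qed.

Lemma elliptic_map : elliptic Ef = elliptic E.
Proof.
rewrite /elliptic -(fmorph_eq0 f (wdisc E)) /wdisc wb2_map wb4_map wb6_map wb8_map.
move: (wb2 E) (wb4 E) (wb6 E) (wb8 E) => c2 c4 c6 c8.
by rewrite !(rmorph_nat f, rmorphXn f, rmorphM f, rmorphN f, rmorphD f).
Qed.

Lemma divf_map n : map_poly f (divf E n) = divf Ef n.
Proof. by rewrite !divfE map_rdivf wb2_map wb4_map wb6_map wb8_map. Qed.

Lemma psi2sq_map : map_poly f (psi2sq E) = psi2sq Ef.
Proof.
by have := map_rpsi2sq f (wb2 E) (wb4 E) (wb6 E); rewrite -wb2_map -wb4_map -wb6_map.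
Qed.

Lemma psi_sq_map n : map_poly f (psi_sq E n) = psi_sq Ef n.
Proof.
by rewrite !psi_sqE rmorphM rmorphXn /= divf_map !wsE; case: odd; rewrite ?rmorph1 ?psi2sq_map.
Qed.

Lemma theta_map n : map_poly f (theta E n.+1) = theta Ef n.+1.
Proof.
rewrite !thetaE rmorphB !(rmorphM (map_poly f)) /= map_polyX psi_sq_map !divf_map !wsE.
by case: odd; rewrite ?rmorph1 ?psi2sq_map.
Qed.

Lemma delta_map P n : map_poly f (delta E P n.+1) = delta Ef (point_map f P) n.+1.
Proof.
case: P => [|a b]; first exact: psi_sq_map.
by rewrite /delta /= rmorphB rmorphM /= theta_map psi_sq_map map_polyC.
Qed.

Lemma on_curve_map P : on_curve E P -> on_curve Ef (point_map f P).
Proof.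
case: P => [//|a b] /= /eqP H; apply/eqP.
by rewrite -!rmorphM -!rmorphXn -!rmorphM -!rmorphD H.
Qed.

End CurveBaseChange.

Lemma horner_psi2sq (K : fieldType) (E : wcurve K) a :
  (psi2sq E).[a] = cubic (wb2 E) (wb4 E) (wb6 E) a.
Proof.
rewrite /psi2sq !hornerD hornerZ (hornerM _%:P 'X^2) (hornerM _%:P 'X).
by rewrite !hornerXn hornerX !hornerC.
Qed.

Lemma on_curve_psi2sq (K : fieldType) (E : wcurve K) a b : on_curve E (PAff a b) ->
  (2 * b + wa1 E * a + wa3 E) ^+ 2 = (psi2sq E).[a].
Proof.
rewrite /= => /eqP H; rewrite horner_psi2sq /cubic /wb2 /wb4 /wb6.
have -> : (2 * b + wa1 E * a + wa3 E) ^+ 2 =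
  4 * (b ^+ 2 + wa1 E * a * b + wa3 E * b) + (wa1 E * a + wa3 E) ^+ 2 by ring.
by rewrite H; ring.
Qed.

Lemma psi2sq_on_curve (K : fieldType) (E : wcurve K) a b : 2 != 0 :> K ->
  (2 * b + wa1 E * a + wa3 E) ^+ 2 = (psi2sq E).[a] -> on_curve E (PAff a b).
Proof.
move=> two0; rewrite /= horner_psi2sq /cubic /wb2 /wb4 /wb6 => H.
have four0 : 4 != 0 :> K.
  have -> : 4 = 2 ^+ 2 :> K by ring.
  by rewrite expf_neq0.
apply/eqP; apply: (mulfI four0).
have -> : 4 * (b ^+ 2 + wa1 E * a * b + wa3 E * b) =
  (2 * b + wa1 E * a + wa3 E) ^+ 2 - (wa1 E * a + wa3 E) ^+ 2 by ring.
by rewrite H; ring.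
Qed.

(** * Weierstrass equations pulled back along an isogeny *)

Section Pullback.
Variable K : fieldType.
Variables (a1 a2 a3 a4 a6 c1 c2 c3 c4 c6 x X U V : K).

Let src : {poly K} :=
  'X^2 + (c1 * x + c3)%:P * 'X - (x ^+ 3 + c2 * x ^+ 2 + c4 * x + c6)%:P.
Let pullback : {poly K} :=
  (U%:P * 'X + V%:P) ^+ 2 + (a1 * X + a3)%:P * (U%:P * 'X + V%:P)
  - (X ^+ 3 + a2 * X ^+ 2 + a4 * X + a6)%:P.

(** Division by the monic quadratic [src] leaves the remainder k1 Y + k0 of degree at most 1; the
    two equations say k1 = 0 and k0 = 0. *)
Lemma pullback_dvdp : (src %| pullback) <->
  2 * U * V + (a1 * X + a3) * U = U ^+ 2 * (c1 * x + c3) /\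
  V ^+ 2 + (a1 * X + a3) * V - (X ^+ 3 + a2 * X ^+ 2 + a4 * X + a6)
    = - U ^+ 2 * (x ^+ 3 + c2 * x ^+ 2 + c4 * x + c6).
Proof.
rewrite /src /pullback; move: (c1 * x + c3) (x ^+ 3 + _ + _ + _) (a1 * X + a3) (X ^+ 3 + _ + _ + _).
move=> l m l' m'; pose k1 := 2 * U * V + l' * U - U ^+ 2 * l.
pose k0 := V ^+ 2 + l' * V - m' + U ^+ 2 * m.
set S := 'X^2 + _ - _.
have E1 : (U%:P * 'X + V%:P) ^+ 2 + l'%:P * (U%:P * 'X + V%:P) - m'%:P =
   U%:P ^+ 2 * S + (k1%:P * 'X + k0%:P).
  rewrite /S /k1 /k0 !(rmorph_nat polyC, rmorphXn polyC, rmorphM polyC, rmorphN polyC, rmorphD polyC).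
  by ring.
have sS : size S = 3%N.
  rewrite /S -addrA size_polyDl size_polyXn // ltnS.
  apply: leq_trans (size_polyD _ _) _; rewrite geq_max size_polyN size_polyC.
  apply/andP; split; last by case: (_ == _).
  by apply: leq_trans (size_polyMleq _ _) _; rewrite size_polyX addn2 /= size_polyC; case: (_ == _).
rewrite E1 dvdp_addr ?dvdp_mull //; split.
  move=> D; have : k1%:P * 'X + k0%:P = 0.
    apply/eqP; apply: contraTT D => n0; rewrite gtNdvdp // sS size_MXaddC.
    by case: ifP => // _; rewrite size_polyC; case: (_ == _).
  move=> /polyP H; have := H 1%N; have := H 0%N.
  rewrite !coefD !coefMX !coefC /= add0r addr0 => H0 H1; split.
    by apply/eqP; rewrite -subr_eq0 -/k1 H1.
  by apply/eqP; rewrite mulNr -subr_eq0 opprK -/k0 H0.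
case=> H1 H0; have -> : k1 = 0 by rewrite /k1 H1 subrr.
have -> : k0 = 0 by rewrite /k0 H0; ring.
by rewrite mul0r add0r dvdp0.
Qed.

End Pullback.

Section IsogenyEquations.
Variables (L : fieldType) (E' E : wcurve L) (phi : isog_data L).
Local Notation F := (frac_diff L).
Local Notation T := (toF F).
Let Xf : F := T (iso_p1 phi) / T (iso_q1 phi).
Let U : F := T (iso_p2 phi) / T (iso_q2 phi).
Let V : F := T (iso_p3 phi) / T (iso_q3 phi).
Let x : F := T 'X.

Lemma weq_dvdpE : (weq_src E' %| weq_pullback E phi) <->
  2 * U * V + (cst F (wa1 E) * Xf + cst F (wa3 E)) * U
    = U ^+ 2 * (cst F (wa1 E') * x + cst F (wa3 E')) /\
  V ^+ 2 + (cst F (wa1 E) * Xf + cst F (wa3 E)) * V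
    - (Xf ^+ 3 + cst F (wa2 E) * Xf ^+ 2 + cst F (wa4 E) * Xf + cst F (wa6 E))
    = - U ^+ 2 * (x ^+ 3 + cst F (wa2 E') * x ^+ 2 + cst F (wa4 E') * x + cst F (wa6 E')).
Proof. exact: pullback_dvdp. Qed.

End IsogenyEquations.

Section IsogenyCubic.
Variables (K : fieldType) (a1 a2 a3 a4 a6 c1 c2 c3 c4 c6 x X U V : K).
Hypothesis two0 : 2 != 0 :> K.

Let b2 := a1 ^+ 2 + 4 * a2.
Let b4 := 2 * a4 + a1 * a3.
Let b6 := a3 ^+ 2 + 4 * a6.
Let d2 := c1 ^+ 2 + 4 * c2.
Let d4 := 2 * c4 + c1 * c3.
Let d6 := c3 ^+ 2 + 4 * c6.

(** The second alternative is U = 0, where y o phi would be a function of x alone. The shape of the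
    data permits this; it is excluded later by counting degrees, a substitute for the fact that a
    curve of genus 1 is not rational. *)
Lemma isogeny_cubic :
  2 * U * V + (a1 * X + a3) * U = U ^+ 2 * (c1 * x + c3) ->
  V ^+ 2 + (a1 * X + a3) * V - (X ^+ 3 + a2 * X ^+ 2 + a4 * X + a6)
    = - U ^+ 2 * (x ^+ 3 + c2 * x ^+ 2 + c4 * x + c6) ->
  (U != 0 /\ U ^+ 2 * cubic d2 d4 d6 x = cubic b2 b4 b6 X) \/
  (2 * V + a1 * X + a3) ^+ 2 = cubic b2 b4 b6 X.
Proof.
move=> H1 H0; have H2 : (2 * V + a1 * X + a3) ^+ 2 =
    cubic b2 b4 b6 X - 4 * (U ^+ 2 * (x ^+ 3 + c2 * x ^+ 2 + c4 * x + c6)).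
  have -> : (2 * V + a1 * X + a3) ^+ 2 = 4 * (V ^+ 2 + (a1 * X + a3) * V - (X ^+ 3 + a2 * X ^+ 2 + a4 * X + a6))
    + cubic b2 b4 b6 X by rewrite /cubic /b2 /b4 /b6; ring.
  by rewrite H0; ring.
have [U0|U0] := eqVneq U 0; [right|left].
  by rewrite H2 U0 expr0n /= mul0r mulr0 subr0.
split=> //; have E1 : 2 * V + a1 * X + a3 = U * (c1 * x + c3).
  by apply: (mulfI U0); rewrite mulrA -expr2 -H1; ring.
apply/eqP; rewrite -subr_eq0; apply/eqP; move/eqP: H2; rewrite E1 -subr_eq0 => /eqP <-.
by rewrite /cubic /d2 /d4 /d6; ring.
Qed.

Lemma isogeny_from_cubic :
  2 * V + a1 * X + a3 = U * (c1 * x + c3) ->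
  U ^+ 2 * cubic d2 d4 d6 x = cubic b2 b4 b6 X ->
  2 * U * V + (a1 * X + a3) * U = U ^+ 2 * (c1 * x + c3) /\
  V ^+ 2 + (a1 * X + a3) * V - (X ^+ 3 + a2 * X ^+ 2 + a4 * X + a6)
    = - U ^+ 2 * (x ^+ 3 + c2 * x ^+ 2 + c4 * x + c6).
Proof.
move=> E1 E2; have four0 : 4 != 0 :> K.
  have -> : 4 = 2 ^+ 2 :> K by ring.
  by rewrite expf_neq0.
split.
  have -> : U ^+ 2 * (c1 * x + c3) = U * (U * (c1 * x + c3)) by ring.
  by rewrite -E1; ring.
apply: (mulfI four0).
have -> : 4 * (V ^+ 2 + (a1 * X + a3) * V - (X ^+ 3 + a2 * X ^+ 2 + a4 * X + a6)) =
  (2 * V + a1 * X + a3) ^+ 2 - cubic b2 b4 b6 X by rewrite /cubic /b2 /b4 /b6; ring.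
by rewrite E1 -E2 /cubic /d2 /d4 /d6; ring.
Qed.

End IsogenyCubic.

(** * Reducible implies magnified in characteristic zero *)

Section CurveConstants.
Variables (L : fieldType) (E : wcurve L) (F : diff_frac L).
Local Notation cst := (cst F).

Lemma cst_wb2 : cst (wb2 E) = cst (wa1 E) ^+ 2 + 4 * cst (wa2 E).
Proof. by rewrite /wb2 rmorphD rmorphXn rmorphM rmorph_nat. Qed.
Lemma cst_wb4 : cst (wb4 E) = 2 * cst (wa4 E) + cst (wa1 E) * cst (wa3 E).
Proof. by rewrite /wb4 rmorphD !rmorphM rmorph_nat. Qed.
Lemma cst_wb6 : cst (wb6 E) = cst (wa3 E) ^+ 2 + 4 * cst (wa6 E).
Proof. by rewrite /wb6 rmorphD rmorphXn rmorphM rmorph_nat. Qed.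

End CurveConstants.

Opaque theta psi_sq divf psi2sq wb2 wb4 wb6 wb8 ws.

Lemma frac_reduce (K : fieldType) (a b : {poly K}) : b != 0 ->
  exists p q, [/\ q != 0, coprimep p q, q %| b & a * q = p * b].
Proof.
move=> b0; set d := gcdp a b; have d0 : d != 0 by rewrite gcdp_eq0 negb_and b0 orbT.
have Ea : a = a %/ d * d by rewrite divpK // dvdp_gcdl.
have Eb : b = b %/ d * d by rewrite divpK // dvdp_gcdr.
exists (a %/ d), (b %/ d); split.
- by apply: contraNneq b0 => E; rewrite Eb E mul0r.
- by apply: coprimep_div_gcd; rewrite b0 orbT.
- by rewrite [X in _ %| X]Eb dvdp_mulr.
- by rewrite [in LHS]Ea [X in _ = _ * X]Eb; ring.
Qed.

Lemma frac_reduce_horner (K : fieldType) (a b p q : {poly K}) x0 :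
  q %| b -> a * q = p * b -> b.[x0] != 0 ->
  q.[x0] != 0 /\ p.[x0] / q.[x0] = a.[x0] / b.[x0].
Proof.
move=> /dvdpP[r Er] E b0; have q0 : q.[x0] != 0.
  by move: b0; rewrite Er hornerM mulf_eq0 negb_or => /andP[].
split=> //; apply/eqP; rewrite eqr_div // -!hornerM -E; apply/eqP.
by [].
Qed.

Lemma toF_frac_eq (L : fieldType) (F : diff_frac L) (p q a b : {poly L}) :
  q != 0 -> b != 0 -> a * q = p * b -> toF F p / toF F q = toF F a / toF F b.
Proof.
move=> q0 b0 Eab; apply/eqP; rewrite eqr_div ?toF_eq0 // -!rmorphM -Eab.
by rewrite eqxx.
Qed.

Section MultiplicationIsogeny.
Variables (L : fieldType) (E : wcurve L).
Hypothesis char0 : forall n, (n%:R == 0 :> L) = (n == 0)%N.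
Hypothesis ellE : elliptic E.

Section Abstract.
Variable F : diff_frac L.
Local Notation cst := (cst F).
Local Notation T := (toF F).

Variable n : nat.
Local Notation th := (theta E n.+1).
Local Notation g := (psi_sq E n.+1).
Local Notation f := (divf E n.+1.*2).

(** The part V of y o [n] = U y + V, multiplied by 2 psi_n^4. It is solved from 2 V + a1 X + a3 = U
    (a1 x + a3) with X = theta_n / psi_n^2 and U = f_2n / psi_n^4. *)
Definition mul_yconst : {poly L} :=
  f * ((wa1 E)%:P * 'X + (wa3 E)%:P) - ((wa1 E)%:P * th * g + (wa3 E)%:P * g ^+ 2).

Let yconst_eval (t u k : {poly L}) (a b : L) (U V : F) : 2 != 0 :> F -> T u != 0 ->
  U = T k / T (u ^+ 2) ->
  V = T (k * (a%:P * 'X + b%:P) - (a%:P * t * u + b%:P * u ^+ 2)) / T (2%:P * u ^+ 2) ->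
  2 * V + cst a * (T t / T u) + cst b = U * (cst a * T 'X + cst b).
Proof.
move=> two0 u0 -> ->.
have -> : T (2%:P * u ^+ 2) = 2 * T u ^+ 2.
  by rewrite rmorphM rmorphXn (rmorph_nat polyC) rmorph_nat.
rewrite !(rmorphXn T, rmorphM T, rmorphN T, rmorphD T) -!cstE.
by field; rewrite two0 u0.
Qed.

Lemma mul_isogeny_equations (U V : F) :
  U = T f / T (g ^+ 2) -> V = T mul_yconst / T (2%:P * g ^+ 2) ->
  let X := T th / T g in let x := T 'X in
  2 * U * V + (cst (wa1 E) * X + cst (wa3 E)) * U
    = U ^+ 2 * (cst (wa1 E) * x + cst (wa3 E)) /\
  V ^+ 2 + (cst (wa1 E) * X + cst (wa3 E)) * V
    - (X ^+ 3 + cst (wa2 E) * X ^+ 2 + cst (wa4 E) * X + cst (wa6 E))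
    = - U ^+ 2 * (x ^+ 3 + cst (wa2 E) * x ^+ 2 + cst (wa4 E) * x + cst (wa6 E)).
Proof.
move=> EU EV X x; have two0 : 2 != 0 :> F.
  by rewrite -(rmorph_nat cst) cst_eq0 char0.
have g0 : T g != 0 by rewrite toF_eq0 (psi_sq_neq0 char0 E F).
apply: isogeny_from_cubic => //; first exact: yconst_eval EU EV.
rewrite -cst_wb2 -cst_wb4 -cst_wb6 /X -(mulxE char0) -mulx_curve // EU (divf_double F char0).
rewrite T_psi2sq fev_cubic // rmorphXn mulfK ?expf_neq0 //.
Qed.

End Abstract.

Let horner_yconst (t u k : {poly L}) (a b x0 : L) :
  (k * (a%:P * 'X + b%:P) - (a%:P * t * u + b%:P * u ^+ 2)).[x0] =
  k.[x0] * (a * x0 + b) - (a * t.[x0] * u.[x0] + b * u.[x0] ^+ 2).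
Proof. by rewrite !(horner_exp, hornerD, hornerN, hornerM, hornerC, hornerX). Qed.

Lemma mul_isogeny n : exists phi : isog_data L,
  [/\ is_isogeny E E phi, isog_deg phi = (n.+1 ^ 2)%N &
    forall x0 y0 xP yP, (psi_sq E n.+1).[x0] != 0 ->
      (theta E n.+1).[x0] = xP * (psi_sq E n.+1).[x0] ->
      (divf E n.+1.*2).[x0] * (2 * y0 + wa1 E * x0 + wa3 E) =
        (psi_sq E n.+1).[x0] ^+ 2 * (2 * yP + wa1 E * xP + wa3 E) ->
      isog_maps E phi (PAff x0 y0) (PAff xP yP)].
Proof.
have two0 : 2 != 0 :> L by rewrite char0.
have g0 : psi_sq E n.+1 != 0 by apply: (psi_sq_neq0 char0 E (frac_diff L)).
have bU0 : psi_sq E n.+1 ^+ 2 != 0 by rewrite expf_neq0.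
have bV0 : 2%:P * psi_sq E n.+1 ^+ 2 != 0 by rewrite mulf_neq0 // polyC_eq0.
(* The data of an isogeny must be in lowest terms. The reduced denominators divide powers of psi^2
   up to a constant, so they do not vanish where psi^2 does not. *)
have [p2 [q2 [q20 co2 d2 E2]]] := frac_reduce (divf E n.+1.*2) bU0.
have [p3 [q3 [q30 co3 d3 E3]]] := frac_reduce (mul_yconst n) bV0.
exists (IsogData (theta E n.+1) (psi_sq E n.+1) p2 q2 p3 q3).
have [sth _] := theta_size_monic char0 E (frac_diff L) n.
have sg := psi_sq_size char0 E (frac_diff L) n.
split; last 1 first.
- move=> x0 y0 xP yP gx Hx Hy; rewrite /isog_maps /= (negPf gx).
  have xPE : xP = (theta E n.+1).[x0] / (psi_sq E n.+1).[x0] by rewrite Hx mulfK.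
  split=> //; right.
  have bUx : (psi_sq E n.+1 ^+ 2).[x0] != 0 by rewrite horner_exp expf_neq0.
  have bVx : (2%:P * psi_sq E n.+1 ^+ 2).[x0] != 0.
    by rewrite hornerM hornerC mulf_neq0.
  have [q2x ->] := frac_reduce_horner d2 E2 bUx.
  have [q3x ->] := frac_reduce_horner d3 E3 bVx; split=> //.
  rewrite (horner_exp (psi_sq _ _)) hornerM hornerC (horner_exp (psi_sq _ _)) horner_yconst Hx.
  set gx0 := (psi_sq E n.+1).[x0] in gx Hy *; set fx := (divf E _).[x0] in Hy *.
  have -> : yP = (gx0 ^+ 2 * (2 * yP + wa1 E * xP + wa3 E)) / (2 * gx0 ^+ 2) - (wa1 E * xP + wa3 E) / 2.
    by field; rewrite two0 gx.
  by rewrite -Hy; field; rewrite two0 gx.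
- have fracE p q a b : q != 0 -> b != 0 -> a * q = p * b ->
      toF (frac_diff L) p / toF (frac_diff L) q = toF (frac_diff L) a / toF (frac_diff L) b.
    by move=> q0 b0 Eab; apply: toF_frac_eq.
  split.
  + by apply/and3P; split; [exact: g0 | exact: q20 | exact: q30].
  + split; first exact: (coprime_theta_psi_sq char0 (frac_diff L) ellE).
    by split; [exact: co2 | exact: co3].
  + by change (size (psi_sq E n.+1) < size (theta E n.+1))%N; rewrite sth sg.
  apply: (proj2 (weq_dvdpE _ _ _)).
  exact: (mul_isogeny_equations (fracE _ _ _ _ q20 bU0 E2) (fracE _ _ _ _ q30 bV0 E3)).
- by change ((size (theta E n.+1)).-1 = n.+1 ^ 2)%N; rewrite sth.
Qed.

End MultiplicationIsogeny.

Lemma char0_ext (K : fieldType) (L : fieldExtType K) :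
  (forall n, (n%:R == 0 :> K) = (n == 0)%N) -> forall n, (n%:R == 0 :> L) = (n == 0)%N.
Proof. by move=> char0 n; rewrite -(rmorph_nat (in_alg L)) fmorph_eq0 char0. Qed.

Lemma horner_curve (K : fieldType) (f t u W : {poly K}) (c2 c4 c6 x0 : K) :
  f ^+ 2 * W = u * (4 * t ^+ 3 + c2%:P * t ^+ 2 * u
    + 2 * c4%:P * t * u ^+ 2 + c6%:P * u ^+ 3) ->
  f.[x0] ^+ 2 * W.[x0] = u.[x0] * (4 * t.[x0] ^+ 3 + c2 * t.[x0] ^+ 2 * u.[x0]
    + 2 * c4 * t.[x0] * u.[x0] ^+ 2 + c6 * u.[x0] ^+ 3).
Proof.
have nC n : n%:R = (n%:R : K)%:P by rewrite (rmorph_nat polyC).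
move/(congr1 (horner^~ x0)); rewrite !nC.
by rewrite !(horner_exp, hornerD, hornerM, hornerC).
Qed.

Section MagnifiedOfRoot.
Variables (K : fieldType) (E : wcurve K) (xP yP : K).
Hypothesis char0 : forall n, (n%:R == 0 :> K) = (n == 0)%N.
Hypothesis ellE : elliptic E.
Hypothesis onP : on_curve E (PAff xP yP).
Local Notation YP := (2 * yP + wa1 E * xP + wa3 E).

Lemma delta_size n : size (delta E (PAff xP yP) n.+1) = (n.+1 ^ 2).+1.
Proof.
have [sth _] := theta_size_monic char0 E (frac_diff K) n.
rewrite /delta size_polyDl sth // size_polyN ltnS.
rewrite -(psi_sq_size char0 E (frac_diff K) n) mul_polyC.
exact: size_scale_leq.
Qed.

(** A root z is the x-coordinate of a preimage Q, and coprimality keeps psi^2 from vanishing at z.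
    The y-coordinate follows from f_2n(z) Y_Q = psi_n(z)^4 Y_P, with Y = 2y + a1 x + a3. This
    determines Y_Q over L if f_2n(z) != 0, which Y_P != 0 guarantees; if Y_P = 0, the choice z =
    x(P), Y_Q = 0 is made instead. *)
Lemma magnified_of_root (L : fieldExtType K) (z : L) n :
  root (map_poly (in_alg L) (delta E (PAff xP yP) n.+1)) z ->
  (\dim {: L} < n.+1 ^ 2)%N -> YP != 0 \/ z = xP%:A ->
  magnified E (PAff xP yP).
Proof.
move=> rz dimL HY; pose f : {rmorphism K -> L} := in_alg L; have char0L := char0_ext L char0.
pose EL := wcurve_map f E; have ellEL : elliptic EL by rewrite elliptic_map.
pose F := frac_diff L.
have two0 : 2 != 0 :> L by rewrite char0L.
have [phi [iso deg maps]] := mul_isogeny char0L ellEL n.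
have Hth : (theta EL n.+1).[z] = f xP * (psi_sq EL n.+1).[z].
  have := rz; rewrite -/f (delta_map f) /root /delta hornerD hornerN hornerM hornerC.
  by rewrite subr_eq0 => /eqP.
have gz : (psi_sq EL n.+1).[z] != 0.
  apply/negP => /eqP g0; have co := coprime_theta_psi_sq char0L F ellEL n.
  have := coprimep_root co; move=> /(_ z); rewrite /root Hth g0 mulr0 eqxx.
  by move=> /(_ isT) /eqP.
have onPL : (f YP) ^+ 2 = cubic (wb2 EL) (wb4 EL) (wb6 EL) (f xP).
  have := on_curve_psi2sq (on_curve_map f onP); rewrite horner_psi2sq => <-.
  by rewrite !rmorphD !rmorphM rmorph_nat.
have HC : (divf EL n.+1.*2).[z] ^+ 2 * (psi2sq EL).[z] = (psi_sq EL n.+1).[z] ^+ 4 * (f YP) ^+ 2.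
  have := horner_curve z (theta_curve char0L EL F n); rewrite Hth => ->.
  by rewrite onPL /cubic; ring.
have [Y0 [onY HY0]] : exists Y0, Y0 ^+ 2 = (psi2sq EL).[z] /\
    (divf EL n.+1.*2).[z] * Y0 = (psi_sq EL n.+1).[z] ^+ 2 * f YP.
  have [Y0|Y0] := eqVneq YP 0.
    have zE : z = xP%:A by case: HY => //; rewrite Y0 eqxx.
    exists 0; rewrite Y0 rmorph0 !mulr0; split=> //.
    by rewrite zE -[xP%:A]/(f xP) horner_psi2sq -onPL Y0 rmorph0.
  have fY0 : f YP != 0 by rewrite fmorph_eq0.
  have D0 : (divf EL n.+1.*2).[z] != 0.
    apply/eqP => D0; have /eqP := HC; rewrite D0 expr0n mul0r eq_sym mulf_eq0.
    by rewrite !expf_eq0 /= (negPf gz) (negPf fY0).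
  exists ((psi_sq EL n.+1).[z] ^+ 2 * f YP / (divf EL n.+1.*2).[z]); split.
    apply: (mulfI (expf_neq0 2 D0)); rewrite HC; field; exact: D0.
  by field; exact: D0.
pose y0 := (Y0 - wa1 EL * z - wa3 EL) / 2.
have y0E : 2 * y0 + wa1 EL * z + wa3 EL = Y0 by rewrite /y0; field; rewrite two0.
exists L, EL, phi, (PAff z y0); split=> //.
- by apply: psi2sq_on_curve; rewrite // y0E.
- apply: maps; rewrite ?y0E ?Hth ?HY0 //.
  by congr (_ * _); rewrite !rmorphD !rmorphM rmorph_nat.
- by rewrite deg.
Qed.

End MagnifiedOfRoot.

Section ReducibleMagnified.
Variables (K : fieldType) (E : wcurve K).
Hypothesis char0 : forall n, (n%:R == 0 :> K) = (n == 0)%N.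
Hypothesis ellE : elliptic E.

Lemma magnified_infinity : magnified E PInf.
Proof.
(* Adjoining a root of X gives an extension of degree 1, over which [2], of degree 4, sends O to
   O. *)
have [L dimL _] := irredp_FAdjoin (irredp_XsubC (0 : K)).
have char0L := char0_ext L char0; pose f : {rmorphism K -> L} := in_alg L.
have ellEL : elliptic (wcurve_map f E) by rewrite elliptic_map.
have [phi [iso deg _]] := mul_isogeny char0L ellEL 1.
exists L, (wcurve_map f E), phi, PInf; split=> //.
by rewrite deg dimL size_XsubC.
Qed.

Lemma magnified_of_reducible P m : on_curve E P -> (1 < m)%N ->
  reducible_poly (delta E P m) -> magnified E P.
Proof.
case: P => [|xP yP] onP; first by move=> *; apply: magnified_infinity.
case: m => [|n] // n1 [sd red].
have [Y0|Y0] := eqVneq (2 * yP + wa1 E * xP + wa3 E) 0; last first.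
  have [r irr rd] := ex_irreducible_factor sd.
  have [L dimL [z rz _]] := irredp_FAdjoin irr.
  apply: (magnified_of_root char0 ellE onP (z := z) (n := n)); last by left.
    by have [s ->] := dvdpP _ _ rd; rewrite rmorphM rootM rz orbT.
  rewrite dimL -ltnS -(delta_size E xP yP char0) prednK; last by case: irr => /ltnW.
  have d0 : delta E (PAff xP yP) n.+1 != 0 by rewrite -size_poly_gt0 ltnW.
  rewrite ltn_neqAle dvdp_leq // andbT; apply/negP => E1; apply: red; split=> // q q1 qd.
  have e : r %= delta E (PAff xP yP) n.+1 by rewrite -dvdp_size_eqp.
  rewrite -(eqp_rtrans e); case: irr => _; apply=> //.
  by rewrite (eqp_dvdr _ e).
(* For P of order 2 the given m is abandoned: [3]P = P, so P has a preimage over an extension of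
   degree 1 < 9. *)
have [L dimL [z rz _]] := irredp_FAdjoin (irredp_XsubC xP).
have zE : z = xP%:A.
  by move: rz; rewrite rmorphB /= map_polyX map_polyC /= root_XsubC => /eqP.
apply: (magnified_of_root char0 ellE onP (z := z) (n := 2)); last by right.
  (* In theta_3 the correction to x psi_3^2 has the factor psi_2^2, whose value at x(P) is Y_P^2 =
     0. *)
  have d3 : root (delta E (PAff xP yP) 3) xP.
    rewrite /root /delta thetaE wsE [odd 2]/= !(hornerD, hornerN).
    rewrite (hornerM 'X) (hornerM xP%:P) (hornerM (psi2sq E)) hornerX hornerC.
    by rewrite -(on_curve_psi2sq onP) Y0 expr0n mul0r subr0 subrr.
  by rewrite zE -[xP%:A]/(in_alg L xP) /root horner_map; move: d3 => /eqP ->; rewrite rmorph0.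
by rewrite dimL size_XsubC.
Qed.

End ReducibleMagnified.

(** * Homogenized composition *)

Section Homogenization.
Variables (L : fieldType) (F : diff_frac L).
Implicit Types (p q A B : {poly L}) (y : F).

(** The polynomial B^d p(A/B), for d at least the degree of p; d is kept apart from that degree so
    that p and q can be treated with a common weight. *)
Definition phom d p A B : {poly L} := \sum_(i < d.+1) p`_i *: (A ^+ i * B ^+ (d - i)).

Lemma phom_rmorph (K : fieldType) (phi : {rmorphism {poly L} -> K}) d p A B :
  (size p <= d.+1)%N -> phi B != 0 ->
  (map_poly (phi \o polyC) p).[phi A / phi B] * phi B ^+ d = phi (phom d p A B).
Proof.
move=> sp B0; rewrite (horner_coef_wide _ (n := d.+1)); last first.
  by apply: leq_trans sp; apply: size_poly.
rewrite rmorph_sum mulr_suml; apply: eq_bigr => i _.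
rewrite coef_map /= -mul_polyC !rmorphM (rmorphXn phi _ A) (rmorphXn phi _ B) -!mulrA; congr (_ * _).
have -> : phi B ^+ d = phi B ^+ i * phi B ^+ (d - i).
  by rewrite -exprD subnKC // -ltnS ltn_ord.
by rewrite expr_div_n mulrA divfK // expf_neq0.
Qed.

Definition fevm y : {rmorphism {poly L} -> F} := horner_eval y \o map_poly (cst F).

Lemma fevmE y p : fevm y p = fev p y. Proof. by []. Qed.

Lemma phom_fev d p A B y : (size p <= d.+1)%N -> fev B y != 0 ->
  fev p (fev A y / fev B y) * fev B y ^+ d = fev (phom d p A B) y.
Proof.
move=> sp B0; rewrite -[RHS]fevmE -phom_rmorph //; congr (_.[_] * _).
by apply: eq_map_poly => c; rewrite /= /horner_eval map_polyC hornerC.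
Qed.

Lemma phom_toF d p A B : (size p <= d.+1)%N -> B != 0 ->
  fev p (toF F A / toF F B) * toF F B ^+ d = toF F (phom d p A B).
Proof.
by move=> sp B0; have := @phom_fev d p A B (toF F 'X) sp; rewrite !fev_id toF_eq0; apply.
Qed.

Lemma toF_inj : injective (toF F).
Proof. by move=> p q H; apply/eqP; rewrite -subr_eq0 -(toF_eq0 F) rmorphB H subrr. Qed.

Lemma phomM d e p q A B : (size p <= d.+1)%N -> (size q <= e.+1)%N -> B != 0 ->
  phom (d + e) (p * q) A B = phom d p A B * phom e q A B.
Proof.
move=> sp sq B0; apply: toF_inj.
rewrite rmorphM -!phom_toF // ?fevM ?exprD; first by ring.
by apply: leq_trans (size_polyMleq _ _) _; lia.
Qed.

Lemma phomD d p q A B : phom d (p + q) A B = phom d p A B + phom d q A B.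
Proof. by rewrite /phom -big_split; apply: eq_bigr => i _; rewrite coefD scalerDl. Qed.

Lemma phomZ d c p A B : phom d (c *: p) A B = c *: phom d p A B.
Proof. by rewrite /phom scaler_sumr; apply: eq_bigr => i _; rewrite coefZ scalerA. Qed.

Lemma phom1 d A B : phom d 1 A B = B ^+ d.
Proof.
rewrite /phom big_ord_recl coefC /= scale1r expr0 mul1r subn0 big1 ?addr0 // => i _.
by rewrite coefC /= scale0r.
Qed.

Lemma phom_XsubC c A B : phom 1 ('X - c%:P) A B = A - c *: B.
Proof.
rewrite /phom !big_ord_recl big_ord0 addr0 !coefB !coefX !coefC /= !expr0 !expr1.
by rewrite sub0r subr0 scale1r mulr1 mul1r scaleNr addrC.
Qed.

(* Modulo B only the leading term of the homogenization survives. *)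
Lemma phom_lead d p A B : exists r, phom d p A B = p`_d *: A ^+ d + B * r.
Proof.
exists (\sum_(i < d) p`_i *: (A ^+ i * B ^+ (d - i).-1)).
rewrite /phom big_ord_recr /= subnn expr0 mulr1 addrC; congr (_ + _).
rewrite mulr_sumr; apply: eq_bigr => i _; rewrite -scalerAr; congr (_ *: _).
by rewrite -{1}(prednK (n := d - i)) ?subn_gt0 // exprS; ring.
Qed.

(** Homogenizing u p + v q = 1 gives a power of B, so a common prime factor s divides B. Modulo B
    only p_d A^d survives, so s also divides A, against the coprimality of A and B. *)
Lemma phom_coprime d p q A B : (size p <= d.+1)%N -> (size q <= d.+1)%N -> p`_d != 0 ->
  B != 0 -> phom d p A B != 0 -> coprimep p q -> coprimep A B -> coprimep (phom d p A B) (phom d q A B).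
Proof.
move=> sp sq pd B0 P0 co coAB; have [[u v] /= uv] := Bezout_eq1_coprimepP _ _ co.
have [r Er] := phom_lead d p A B; set P := phom d p A B in Er *.
set Q := phom d q A B; pose e := maxn (size u) (size v).
have su : (size u <= e.+1)%N by rewrite leqW // leq_maxl.
have sv : (size v <= e.+1)%N by rewrite leqW // leq_maxr.
have HB : phom e u A B * P + phom e v A B * Q = B ^+ (e + d).
  by rewrite -!phomM // -phomD uv phom1.
apply/negPn/negP => nco.
rewrite coprimep_sym in nco; have [s [irr sQ sP]] := not_coprime_factor P0 nco.
have sB : s %| B.
  have : s %| B ^+ (e + d) by rewrite -HB dvdp_add // dvdp_mull.
  elim: (e + d)%N => [|k IH]; last by rewrite exprS irreducible_dvdM // => /orP[].
  by rewrite expr0 dvdp1; case: irr => /ltn_eqF; rewrite eq_sym => ->.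
have sA : s %| A.
  have : s %| A ^+ d.
    rewrite -(dvdpZr _ _ pd) -(dvdp_addl _ (dvdp_mulr r sB)) -Er; exact: sP.
  elim: (d)%N => [|k IH]; last by rewrite exprS irreducible_dvdM // => /orP[].
  by rewrite expr0 dvdp1; case: irr => /ltn_eqF; rewrite eq_sym => ->.
have : s %| gcdp A B by rewrite dvdp_gcd sA.
rewrite (eqp_dvdr _ (_ : gcdp A B %= 1)) ?gcdp_eqp1 //.
by rewrite dvdp1; case: irr => /ltn_eqF; rewrite eq_sym => ->.
Qed.

End Homogenization.

Lemma dvdp_pmult (K : fieldType) (a b : {poly K}) : a != 0 -> b != 0 ->
  (forall s, irreducible_poly s -> (pmult s a <= pmult s b)%N) -> a %| b.
Proof.
have [n] := ubnP (size a); elim: n a b => // n IH a b; rewrite ltnS => le a0 b0 H.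
have [sa|sa] := leqP (size a) 1.
  by rewrite (eqp_dvdl _ (_ : a %= 1)) ?dvd1p // -size_poly_eq1 eqn_leq sa size_poly_gt0.
have [s irr /dvdpP[a' Ea]] := ex_irreducible_factor sa.
have s0 : s != 0 by exact: irredp_neq0.
have a'0 : a' != 0 by apply: contraNneq a0 => E; rewrite Ea E mul0r.
have pss : pmult s s = 1%N.
  apply: (@pmult_uniq _ _ irr _ _ 1); rewrite ?mulr1 // dvdp1.
  by case: irr => /ltn_eqF; rewrite eq_sym => ->.
have : s ^+ 1 %| b.
  rewrite pmult_dvd //; apply: leq_trans (H s irr).
  by rewrite Ea pmultM // pss addn1.
rewrite expr1 => /dvdpP[b' Eb]; have b'0 : b' != 0 by apply: contraNneq b0 => E; rewrite Eb E mul0r.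
rewrite Ea Eb dvdp_mul2r //; apply: IH => //.
  apply: leq_trans le; rewrite Ea size_mul //; case: irr => s1 _.
  by move: a'0 s1; rewrite -size_poly_gt0; move: (size a') (size s); clear; lia.
move=> r irr_r; have := H r irr_r; rewrite Ea Eb !pmultM // leq_add2r.
exact.
Qed.

Lemma dvdp_deriv_pow (K : fieldType) (s a : {poly K}) k : s ^+ k.+1 %| a -> s ^+ k %| a^`().
Proof.
case/dvdpP=> r ->; rewrite derivM (exprSr s k).
have -> : (s ^+ k * s)^`() = s ^+ k * (s^`() *+ k.+1).
  by rewrite -exprSr deriv_exp /= mulrnAr mulrC.
by apply: dvdp_add; [rewrite mulrA mulrAC; apply: dvdp_mull | rewrite mulrCA; apply: dvdp_mulr].
Qed.

(** * The differential equation of an isogeny *)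

Section IsogenyODE.
Variables (L : fieldType) (F : diff_frac L).
Hypothesis char0 : forall n, (n%:R == 0 :> L) = (n == 0)%N.
Local Notation T := (toF F).
Local Notation cst := (cst F).
Local Notation v := (inf_place F).
Variable E : wcurve L.
Hypothesis ellE : elliptic E.
Implicit Types p q : {poly L}.

(** With g = psi_2^2 of E, this is q^3 g(p/q), and [hcub_p] is q^2 g'(p/q). *)
Definition hcub p q : {poly L} := 4 * p ^+ 3 + (wb2 E)%:P * p ^+ 2 * q
    + 2 * (wb4 E)%:P * p * q ^+ 2 + (wb6 E)%:P * q ^+ 3.
Definition hcub_p p q : {poly L} := 12 * p ^+ 2 + 2 * (wb2 E)%:P * p * q
    + 2 * (wb4 E)%:P * q ^+ 2.
Definition wronskian p q : {poly L} := p^`() * q - p * q^`().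

Let rmorph_hcub (phi : {rmorphism {poly L} -> F}) (c2 c4 c6 : L) p q :
  (forall c, phi c%:P = cst c) -> phi q != 0 ->
  phi (4 * p ^+ 3 + c2%:P * p ^+ 2 * q + 2 * c4%:P * p * q ^+ 2 + c6%:P * q ^+ 3) =
  cubic (cst c2) (cst c4) (cst c6) (phi p / phi q) * phi q ^+ 3.
Proof.
move=> phiC q0; rewrite !(rmorph_nat phi, rmorphXn phi, rmorphM phi, rmorphD phi) !phiC /cubic.
by field.
Qed.

Lemma T_hcub p q : q != 0 -> T (hcub p q) = fev (psi2sq E) (T p / T q) * T q ^+ 3.
Proof. by move=> q0; rewrite fev_cubic; apply: rmorph_hcub; rewrite ?toF_eq0. Qed.

Lemma fev_hcub p q (y : F) : fev q y != 0 ->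
  fev (hcub p q) y = fev (psi2sq E) (fev p y / fev q y) * fev q y ^+ 3.
Proof.
move=> q0; rewrite fev_cubic -!fevmE; apply: rmorph_hcub => // c.
exact: fevC.
Qed.

Lemma wronskian_fD p q : q != 0 -> fD (T p / T q) = T (wronskian p q) / T q ^+ 2.
Proof.
move=> q0; rewrite fDdiv ?toF_eq0 // !fD_poly /wronskian.
by rewrite rmorphB !rmorphM.
Qed.

Lemma hcub_deriv p q : q * (hcub p q)^`() = hcub_p p q * wronskian p q + 3 * hcub p q * q^`().
Proof.
have dn n : (n%:R : {poly L})^`() = 0 by rewrite -(rmorph_nat polyC) derivC.
rewrite /hcub /hcub_p /wronskian; move: (wb2 E) (wb4 E) (wb6 E) => c2 c4 c6.
rewrite !derivD (derivM 4) (derivM _ q) (derivM _ (p ^+ 2)) (derivM _ (q ^+ 2)) (derivM _ (q ^+ 3)).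
rewrite (derivM _ p) (derivM 2) !deriv_exp !dn !derivC /=.
by ring.
Qed.

(** The Bezout identity between g and g' with constant -576 times the discriminant, homogenized to
    weight 4 in p and q. *)
Let disc_hcub p q : exists a b,
  a * hcub p q + b * hcub_p p q = (- 576 * wdisc E)%:P * q ^+ 4.
Proof.
rewrite /hcub /hcub_p; set A2 := (wb2 E)%:P; set A4 := (wb4 E)%:P; set A6 := (wb6 E)%:P.
pose P := 48 * A4 - 2 * A2 ^+ 2; pose Q := 36 * A6 - 2 * A2 * A4.
pose r := P * p + Q * q; pose k := 12 * (r - 2 * Q * q) + 2 * A2 * P * q.
exists (- (36 * k)), (P ^+ 2 * q ^+ 2 + (12 * p + A2 * q) * k).
rewrite disc_psi2sq disc_polyC -/A2 -/A4 -/A6 /k /r /P /Q.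
by ring.
Qed.

Variables p q : {poly L}.
Hypotheses (q0 : q != 0) (co : coprimep p q).
Local Notation H := (hcub p q).

Lemma coprime_q_hcub : coprimep q H.
Proof.
have -> : H = ((wb2 E)%:P * p ^+ 2 + 2 * (wb4 E)%:P * p * q + (wb6 E)%:P * q ^+ 2) * q + 4 * p ^+ 3.
  by rewrite /hcub; ring.
rewrite coprimep_addl_mul; have -> : 4 = (4)%:P :> {poly L} by rewrite rmorph_nat.
by rewrite mul_polyC coprimepZr ?char0 // coprimep_expr // coprimep_sym.
Qed.

Let irr_ndvd1 (s : {poly L}) : irreducible_poly s -> ~~ (s %| 1).
Proof. by case=> /ltn_eqF s1 _; rewrite dvdp1 eq_sym s1. Qed.

Let irr_coprime_ndvd (s a b : {poly L}) : irreducible_poly s -> coprimep a b -> s %| a -> ~~ (s %| b).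
Proof.
move=> irr; rewrite -gcdp_eqp1 => e sa; apply/negP => sb.
by have := irr_ndvd1 irr; rewrite -(eqp_dvdr _ e) dvdp_gcd sa sb.
Qed.

Lemma coprime_hcub_p (s : {poly L}) : irreducible_poly s -> s %| H -> ~~ (s %| hcub_p p q).
Proof.
move=> irr sH; apply/negP => sHp; have [a [b Eab]] := disc_hcub p q.
have sq : ~~ (s %| q).
  by apply/negP => sq; case/negP: (irr_coprime_ndvd irr coprime_q_hcub sq).
have : s %| (- 576 * wdisc E)%:P * q ^+ 4 by rewrite -Eab dvdp_add // dvdp_mull.
have c0 : - 576 * wdisc E != 0 by rewrite mulf_neq0 // oppr_eq0 char0.
rewrite mul_polyC dvdpZr // => sq4; case/negP: sq; move: sq4.
elim: (4%N) => [|k IH]; first by rewrite expr0 (negPf (irr_ndvd1 irr)).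
by rewrite exprS irreducible_dvdM // => /orP[].
Qed.

Variables (t : F) (D : {poly L}).
Hypotheses (D0 : D != 0) (sepD : coprimep D D^`()).
Hypothesis tD : t ^+ 2 * T D = fev (psi2sq E) (T p / T q).

(* The poles of t cannot come from D, which is squarefree. *)
Lemma isogeny_numerator : exists tau : {poly L}, T tau = t * T q ^+ 2 /\ tau ^+ 2 * D = q * H.
Proof.
have Tq0 : T q != 0 by rewrite toF_eq0.
have [a' [b' [b'0 Et]]] := fracP (t * T q ^+ 2).
have [a [b [b0 cab _ Eab]]] := frac_reduce a' b'0.
have {Et a' b' b'0 Eab}Et : t * T q ^+ 2 = T a / T b.
  by rewrite Et; apply: toF_frac_eq => //; rewrite Eab.
have Tb0 : T b != 0 by rewrite toF_eq0.
have HT : (t * T q ^+ 2) ^+ 2 * T D = T q * T H.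
  by rewrite T_hcub // -tD; ring.
have E1 : a ^+ 2 * D = b ^+ 2 * (q * H).
  apply: (@toF_inj L F); rewrite rmorphM rmorphXn rmorphM rmorphXn rmorphM -HT Et.
  by field.
have sb : (size b <= 1)%N.
  rewrite leqNgt; apply/negP => sb; have [s irr sdb] := ex_irreducible_factor sb.
  have sa : ~~ (s %| a) by apply: (irr_coprime_ndvd irr _ sdb); rewrite coprimep_sym.
  have s2 : s ^+ 2 %| D.
    have : s ^+ 2 %| a ^+ 2 * D by rewrite E1 dvdp_mulr // dvdp_exp2r.
    by rewrite Gauss_dvdpr // coprimep_expl // coprimep_expr // irreducible_coprime.
  have sD : s %| D by apply: dvdp_trans s2; rewrite expr2 dvdp_mulr.
  by case/negP: (irr_coprime_ndvd irr sepD sD); have := @dvdp_deriv_pow _ s D 1 s2; rewrite expr1.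
have [c c0 Eb] : exists2 c, c != 0 & b = c%:P.
  exists b`_0; last by rewrite -size1_polyC.
  by move: b0; rewrite {1}(size1_polyC sb) polyC_eq0.
have Tc : T (c^-1 *: a) = t * T q ^+ 2.
  by rewrite Et -mul_polyC rmorphM Eb -!cstE fmorphV mulrC.
exists (c^-1 *: a); split=> //.
by apply: (@toF_inj L F); rewrite rmorphM rmorphXn Tc HT rmorphM.
Qed.

Let double_pred k : (0 < k)%N -> (k <= (k + k).-1)%N /\ (k + k = (k + k).-1.+1)%N.
Proof. by clear; lia. Qed.

(** The quotient of the Wronskian by tau is f'/t, the pulled-back invariant differential divided by
    that of the source, and it must be regular. If s^k divides tau, then s^2k divides q H, hence q
    or H alone. A derivative costs one power and 2k - 1 >= k. For q this is enough; for H,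
    [hcub_deriv] gives s^k | [hcub_p] W, and s does not divide [hcub_p] because g is separable. *)
Lemma isogeny_numerator_dvd tau : tau != 0 -> wronskian p q != 0 -> H != 0 ->
  tau ^+ 2 * D = q * H -> tau %| wronskian p q.
Proof.
move=> tau0 W0 H0 E1; apply: dvdp_pmult => // s irr; set k := pmult s tau.
have [->|k0] := posnP k; first by [].
have stau : s ^+ k %| tau by rewrite pmult_dvd.
have sqH : s ^+ (k + k) %| q * H.
  by rewrite -E1 exprD expr2 dvdp_mulr // dvdp_mul.
rewrite -pmult_dvd //; have [le1 kk] := double_pred k0.
have dle j u : (k <= j)%N -> s ^+ j %| u -> s ^+ k %| u by move=> le; apply/dvdp_trans/dvdp_exp2l.
have [sq|sq] := boolP (s %| q).
  have sH : ~~ (s %| H) by apply: irr_coprime_ndvd irr coprime_q_hcub sq.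
  have d1 : s ^+ (k + k) %| q.
    by move: sqH; rewrite Gauss_dvdpl // coprimep_expl // irreducible_coprime.
  have d2 : s ^+ k %| q^`() by apply: dle le1 _; apply: dvdp_deriv_pow; rewrite -kk.
  by rewrite dvdp_sub // dvdp_mull //; apply: dle d1; apply: leq_addr.
have d1 : s ^+ (k + k) %| H.
  by move: sqH; rewrite Gauss_dvdpr // coprimep_expl // irreducible_coprime.
have d2 : s ^+ k %| H^`() by apply: dle le1 _; apply: dvdp_deriv_pow; rewrite -kk.
have d3 : s ^+ k %| H by apply: dle d1; apply: leq_addr.
have sH : s %| H by apply: dvdp_trans d3; rewrite -(prednK k0) exprS dvdp_mulr.
have : s ^+ k %| hcub_p p q * wronskian p q.
  have := dvdp_mull q d2; rewrite hcub_deriv dvdp_addl //.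
  by rewrite dvdp_mulr // dvdp_mull.
by rewrite Gauss_dvdpr // coprimep_expl // irreducible_coprime // coprime_hcub_p.
Qed.

Hypothesis spq : (size q < size p)%N.

Let p0 : p != 0. Proof. by rewrite -size_poly_gt0; apply: leq_ltn_trans spq. Qed.

Lemma frac_pole : T p / T q != 0 /\ v (T p / T q) = (size q)%:Z - (size p)%:Z.
Proof.
have n0 : T p / T q != 0 by rewrite mulf_neq0 ?invr_eq0 ?toF_eq0.
split=> //; rewrite pvalM ?invr_eq0 ?toF_eq0 // valV ?toF_eq0 // !inf_placeE //.
by move: (size p) (size q); clear; lia.
Qed.

Let vf : v (T p / T q) < 0.
Proof. by case: frac_pole => _ ->; move: spq; move: (size p) (size q); clear; lia. Qed.

(** A regular differential is a constant multiple of the invariant one, by degrees: 2 deg tau + deg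
    D = deg q + 3 deg p, while deg tau <= deg W <= deg p + deg q - 1. Hence deg p - deg q <= deg D -
    2. Since deg p > deg q and deg D <= 3, equality holds everywhere, W is a constant times tau, and
    D = 1 is impossible. *)
Lemma isogeny_ode : (1 < size D <= 4)%N \/ D = 1 ->
  [/\ size D = 4%N, size p = (size q).+1 & exists2 c, c != 0 & fD (T p / T q) = cst c * t].
Proof.
move=> sD; have [tau [Ttau E1]] := isogeny_numerator.
have Tq0 : T q != 0 by rewrite toF_eq0.
have [f0 _] := frac_pole.
have [P0 vP] := fev_pole f0 vf (psi2sq_neq0 char0 E).
have TH0 : T H != 0 by rewrite T_hcub // mulf_neq0 // expf_neq0.
have H0 : H != 0 by rewrite -(toF_eq0 F).
have W0 : wronskian p q != 0.
  have := fD_neq0 char0 f0 vf; rewrite wronskian_fD //.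
  by apply: contraNneq => ->; rewrite rmorph0 mul0r.
have tau0 : tau != 0.
  have : tau ^+ 2 * D != 0 by rewrite E1 mulf_neq0.
  by apply: contraNneq => ->; rewrite expr0n mul0r.
have dW := isogeny_numerator_dvd tau0 W0 H0 E1.
have sW : (size (wronskian p q) + 2 <= size p + size q)%N.
  have aux (a b : {poly L}) : a != 0 -> b != 0 -> (size (a^`() * b)%R + 2 <= size a + size b)%N.
    move=> a0 b0; have := @size_polyMleq _ (a^`())%R b; have := lt_size_deriv a0.
    by move: b0; rewrite -size_poly_gt0; move: (size _) (size _) (size _) (size _); clear; lia.
  have H1 := aux _ _ p0 q0; have := aux _ _ q0 p0; rewrite mulrC => H2.
  have := size_polyD (p^`() * q) (- (p * q^`())); rewrite size_polyN -/(wronskian p q).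
  by move: H1 H2; move: (size (p^`() * q)%R) (size (p * q^`())%R) (size (wronskian p q)) (size p) (size q); clear; lia.
have sE : ((size tau).-1 + (size tau).-1 + (size D).-1 = (size q).-1 + 3 * (size p).-1)%N.
  have sH : (size H).-1 = (3 * (size p).-1)%N.
    have := T_hcub p q0 => /(congr1 v); rewrite inf_placeE // pvalM ?expf_neq0 // vP.
    rewrite valX // inf_placeE //; case: frac_pole => _ ->.
    have [-> _] := psi2sq_size_lead char0 E; move: H0 p0 q0; rewrite -!size_poly_gt0.
    by move: (size H) (size p) (size q); clear; lia.
  have := congr1 (fun u : {poly L} => (size u).-1) E1.
  rewrite expr2 !size_mul ?mulf_neq0 // -sH; move: tau0 D0 q0 H0; rewrite -!size_poly_gt0.
  by move: (size tau) (size D) (size q) (size H); clear; lia.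
have st := dvdp_leq W0 dW.
have pos : [/\ (0 < size tau)%N, (0 < size q)%N & (0 < size D)%N] by rewrite !size_poly_gt0.
have [sD4 spq1 stW] : [/\ size D = 4%N, size p = (size q).+1 & size tau = size (wronskian p q)].
  move: pos => [s1 s2 s3]; move: s1 s2 s3 sE st sW spq; case: sD => [sD|->].
    move: sD; move: (size tau) (size (wronskian p q)) (size p) (size q) (size D); clear.
    by move=> *; split; lia.
  rewrite size_poly1; move: (size tau) (size (wronskian p q)) (size p) (size q).
  by clear; lia.
split=> //; have : tau %= wronskian p q by rewrite -dvdp_size_eqp // stW.
rewrite eqp_sym => /eqpf_eq[c c0 EW]; exists c => //.
by rewrite wronskian_fD // EW -mul_polyC rmorphM -cstE Ttau; field.
Qed.

End IsogenyODE.

Section Composition.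
Variables (L : fieldType) (F : diff_frac L).
Hypothesis char0 : forall n, (n%:R == 0 :> L) = (n == 0)%N.
Local Notation T := (toF F).
Local Notation cst := (cst F).
Local Notation v := (inf_place F).
Implicit Types (p q : {poly L}) (h : F).

Lemma frac_fev_pole (w : place F) p q h : h != 0 -> w h < 0 -> p != 0 -> q != 0 ->
  fev p h / fev q h != 0 /\
  w (fev p h / fev q h) = w h *+ (size p).-1 - w h *+ (size q).-1.
Proof.
move=> h0 wh p0 q0; have [P0 vP] := fev_pole h0 wh p0; have [Q0 vQ] := fev_pole h0 wh q0.
by split; rewrite ?mulf_neq0 ?invr_eq0 // pvalM ?invr_eq0 // valV // vP vQ.
Qed.

Lemma sol_comp E1 E2 E3 c g p q h : (size q < size p)%N -> q != 0 ->
  sol E2 E3 c (T p / T q) -> sol E1 E2 g h ->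
  sol E1 E3 (c * g) (fev p h / fev q h).
Proof.
move=> spq q0 [f0 vf Hf] [h0 vh Hh].
have p0 : p != 0 by rewrite -size_poly_gt0; apply: leq_ltn_trans spq.
have [n0 vn] := frac_fev_pole h0 vh p0 q0.
have [Q0 _] := fev_pole h0 vh q0.
split=> //.
  have q1 : (0 < size q)%N by rewrite size_poly_gt0.
  have -> : (v (fev p h / fev q h) < 0) = (v h *+ (size p - size q) < 0).
    rewrite vn; congr (_ < _); have -> : (size p).-1 = ((size p - size q) + (size q).-1)%N.
      by move: spq q1; move: (size p) (size q); clear; lia.
    by rewrite mulrnDr addrK.
  by rewrite pmulrn_llt0 // subn_gt0.
have Tq0 : T q != 0 by rewrite toF_eq0.
(* Cleared of denominators, the equation of p/q is an identity in L[x] and can be evaluated at h;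
   the chain rule then multiplies c and g. *)
have EW : wronskian p q ^+ 2 * psi2sq E2 = c%:P ^+ 2 * q * hcub E3 p q.
  apply: (@toF_inj L F); rewrite rmorphM rmorphXn rmorphM rmorphM rmorphXn T_hcub // -cstE.
  have -> : cst c ^+ 2 * T q * (fev (psi2sq E3) (T p / T q) * T q ^+ 3) =
    cst c ^+ 2 * fev (psi2sq E3) (T p / T q) * T q ^+ 4 by ring.
  by rewrite -Hf wronskian_fD //; field.
have := congr1 (fun u => fev u h) EW; rewrite !(fevXn, fevM) fevC fev_hcub // => EH.
have -> : fD (fev p h / fev q h) = fev (wronskian p q) h * fD h / fev q h ^+ 2.
  rewrite fDdiv // !fD_fev /wronskian fevB !fevM.
  by congr (_ / _); ring.
have -> : (fev (wronskian p q) h * fD h / fev q h ^+ 2) ^+ 2 * T (psi2sq E1) =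
   fev (wronskian p q) h ^+ 2 * (fD h ^+ 2 * T (psi2sq E1)) / fev q h ^+ 4 by field.
rewrite Hh.
have -> : fev (wronskian p q) h ^+ 2 * (cst g ^+ 2 * fev (psi2sq E2) h) =
  cst g ^+ 2 * (fev (wronskian p q) h ^+ 2 * fev (psi2sq E2) h) by ring.
by rewrite EH rmorphM; field.
Qed.

Lemma isogeny_sol (E' E : wcurve L) p q (U V : F) : elliptic E' -> elliptic E ->
  q != 0 -> coprimep p q -> (size q < size p)%N ->
  let X := T p / T q in let x := T 'X in
  2 * U * V + (cst (wa1 E) * X + cst (wa3 E)) * U
    = U ^+ 2 * (cst (wa1 E') * x + cst (wa3 E')) ->
  V ^+ 2 + (cst (wa1 E) * X + cst (wa3 E)) * V
    - (X ^+ 3 + cst (wa2 E) * X ^+ 2 + cst (wa4 E) * X + cst (wa6 E))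
    = - U ^+ 2 * (x ^+ 3 + cst (wa2 E') * x ^+ 2 + cst (wa4 E') * x + cst (wa6 E')) ->
  size p = (size q).+1 /\ exists2 c, c != 0 & sol E' E c (T p / T q).
Proof.
move=> ell' ell q0 co spq X x H1 H2.
have := isogeny_cubic H1 H2; rewrite -!cst_wb2 -!cst_wb4 -!cst_wb6 -!fev_cubic => HC.
have [D [t [sD D0 sepD tD]]] : exists (D : {poly L}) (t : F), [/\ (1 < size D <= 4)%N /\ D = psi2sq E' \/ D = 1,
    D != 0, coprimep D D^`() & t ^+ 2 * T D = fev (psi2sq E) (T p / T q)].
  case: HC => [[U0 HU]|HV].
    exists (psi2sq E'), U; rewrite psi2sq_neq0 // T_psi2sq; split=> //.
      by left; case: (psi2sq_size_lead char0 E') => ->.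
    exact: psi2sq_separable.
  exists 1, (2 * V + cst (wa1 E) * X + cst (wa3 E)); rewrite oner_neq0 rmorph1 mulr1.
  by split=> //; [right | rewrite coprime1p].
have sD' : (1 < size D <= 4)%N \/ D = 1 by case: sD => [[]|]; [left|right].
have [s4 spq1 [c c0 Hc]] := isogeny_ode char0 ell q0 co D0 sepD tD spq sD'.
have [f0 vf] := frac_pole F q0 spq.
split=> //; exists c => //; split=> //.
  by rewrite vf; move: spq; move: (size p) (size q); clear; lia.
rewrite Hc; case: sD => [[_ <-]|D1]; first by rewrite -tD; ring.
by move: s4; rewrite D1 size_poly1.
Qed.

Lemma mulx_comp E n k : mulx F E (n.+1 * k.+1) =
  fev (theta E n.+1) (mulx F E k.+1) / fev (psi_sq E n.+1) (mulx F E k.+1).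
Proof.
have g0 := psi_sq_neq0 char0 E F n.
have s1 := mulx_sol F char0 E n; rewrite (mulxE char0) in s1.
have st : (size (psi_sq E n.+1) < size (theta E n.+1))%N.
  by have [-> _] := theta_size_monic char0 E F n; rewrite (psi_sq_size char0 E F).
have s2 := sol_comp st g0 s1 (mulx_sol F char0 E k).
rewrite -natrM in s2; rewrite mulSn addSn in s2 *.
have c0 : ((k + n * k.+1).+1%:R : L) != 0 by rewrite char0.
exact: (sol_uniq char0 c0 (mulx_sol F char0 E _) s2).
Qed.

Lemma mulx_isogeny E' E p q c n : c != 0 -> q != 0 -> (size q < size p)%N ->
  sol E' E c (T p / T q) ->
  fev p (mulx F E' n.+1) / fev q (mulx F E' n.+1) =
  fev (theta E n.+1) (T p / T q) / fev (psi_sq E n.+1) (T p / T q).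
Proof.
move=> c0 q0 spq S.
have g0 := psi_sq_neq0 char0 E F n.
have s1 := mulx_sol F char0 E n; rewrite (mulxE char0) in s1.
have st : (size (psi_sq E n.+1) < size (theta E n.+1))%N.
  by have [-> _] := theta_size_monic char0 E F n; rewrite (psi_sq_size char0 E F).
have s2 := sol_comp st g0 s1 S.
have s3 := sol_comp spq q0 S (mulx_sol F char0 E' n); rewrite mulrC in s3.
have cn0 : n.+1%:R * c != 0 by rewrite mulf_neq0 ?char0.
exact: (sol_uniq char0 cn0 s3 s2).
Qed.

End Composition.

(** * Kernel points are torsion *)

Lemma fev_deriv_psi2sq (L : fieldType) (F : diff_frac L) (E : wcurve L) (h : F) :
  fev (psi2sq E)^`() h = cubic' (cst F (wb2 E)) (cst F (wb4 E)) h.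
Proof.
rewrite deriv_psi2sqE /cubic' -fevmE; move: (wb2 E) (wb4 E) => c2 c4.
rewrite !(rmorph_nat (fevm h), rmorphXn (fevm h), rmorphM (fevm h), rmorphD (fevm h)).
by rewrite !fevmE fevX !fevC.
Qed.

Opaque theta psi_sq divf psi2sq wb2 wb4 wb6 wb8 ws phom mulx.

Section KernelTorsion.
Variables (L : fieldType) (F : diff_frac L).
Hypothesis char0 : forall n, (n%:R == 0 :> L) = (n == 0)%N.
Local Notation T := (toF F).
Local Notation cst := (cst F).
Variables (E' E : wcurve L).
Hypothesis ellE' : elliptic E'.

Section OnePlace.
Variable w : place F.
Local Notation X n := (mulx F E' n).

Let intC c : vge w 0 (cst c). Proof. exact: vgeC. Qed.
Let int_nat n : vge w 0 (n%:R : F).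
Proof. by rewrite -(rmorph_nat cst); apply: intC. Qed.
Let intM y z : vge w 0 y -> vge w 0 z -> vge w 0 (y * z).
Proof. by move=> Hy Hz; rewrite -[0]addr0; apply: vgeM. Qed.
Let maxM y z : vge w 1 y -> vge w 0 z -> vge w 1 (y * z).
Proof. by move=> Hy Hz; rewrite -[1]addr0; apply: vgeM. Qed.

Lemma vge_fev (P : {poly L}) h : vge w 0 h -> vge w 0 (fev P h).
Proof.
move=> Hh; elim/poly_ind: P => [|P c IH]; first by rewrite fev0 vge0.
by rewrite fevD fevM fevX fevC; apply: vgeD => //; apply: intM.
Qed.

(* If x([a]) and x([b]) agree at the place, then [a + b], [b - a] or [2 a] has a pole there. *)
Lemma mulx_congruence_pole a b N : (a < b)%N -> (b.+1 <= N)%N ->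
  (forall k, (0 < k)%N -> (k <= N + N)%N -> vge w 0 (X k)) ->
  ~~ vge w 1 (X b.+1 - X a.+1).
Proof.
move=> ab bN intX; apply/negP => cong; set d := X b.+1 - X a.+1 in cong.
have two0 : 2 != 0 :> F by rewrite -(rmorph_nat cst) cst_eq0 char0.
have ne : b != a by rewrite gtn_eqF.
have [i1 i2 i3 i4] : [/\ (a.+1 <= N + N)%N, (b.+1 + a.+1 <= N + N)%N,
    (0 < b.+1 - a.+1 <= N + N)%N & (a.+1.*2 <= N + N)%N].
  by move: ab bN; clear => *; split; lia.
have Xa : vge w 0 (X a.+1) by apply: intX.
have Xp : vge w 0 (X (b.+1 + a.+1)%N) by apply: intX; rewrite // addSn.
have Xm : vge w 0 (X (b.+1 - a.+1)%N) by case/andP: i3 => *; apply: intX.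
have X2 : vge w 0 (X a.+1.*2) by apply: intX; rewrite // double_gt0.
have d0 : vge w 0 d by apply: vge_le cong.
have P1 : vge w 1 (2 * fev (psi2sq E') (X a.+1)).
  have := addx_sum two0 (mulx_neq F char0 E' ne) (mulx_curve F char0 E' b) (mulx_curve F char0 E' a).
  rewrite -mulx_add // -mulx_sub // -/d => HS; rewrite fev_cubic /cubic.
  have -> : 2 * (4 * X a.+1 ^+ 3 + cst (wb2 E') * X a.+1 ^+ 2 + 2 * cst (wb4 E') * X a.+1 + cst (wb6 E')) =
    d * (2 * (X (b.+1 + a.+1)%N + X (b.+1 - a.+1)%N) * d) -
    d * (X a.+1 * (4 * (X a.+1 + X a.+1 + X a.+1 + d) + 2 * cst (wb2 E')) + 2 * cst (wb4 E')).
    have -> : d * (2 * (X (b.+1 + a.+1)%N + X (b.+1 - a.+1)%N) * d) =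
       2 * (X (b.+1 + a.+1)%N + X (b.+1 - a.+1)%N) * d ^+ 2 by ring.
    have Xb : X b.+1 = X a.+1 + d by rewrite /d addrC subrK.
    by rewrite HS Xb; ring.
  apply: vgeB; apply: maxM => //; first by apply: intM => //; apply: intM => //; apply: vgeD.
  apply: vgeD; last exact: intM.
  apply: intM => //; apply: vgeD; last exact: intM.
  by apply: intM => //; do 3?[apply: vgeD => //].
have P2 : vge w 1 (fev (psi2sq E') (X a.+1)).
  have -> : fev (psi2sq E') (X a.+1) = 2 * fev (psi2sq E') (X a.+1) * cst (2^-1).
    by rewrite fmorphV rmorph_nat mulrAC mulfV // mul1r.
  exact: maxM.
have P3 : vge w 1 (fev (psi2sq E')^`() (X a.+1) ^+ 2).
  have C0 := mulx_cubic_neq0 F char0 E' a; have H2 := mulx_dup F char0 E' a.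
  have four0 : 4 != 0 :> F by rewrite -(rmorph_nat cst) cst_eq0 char0.
  have s0 : 16 != 0 :> F by rewrite -(rmorph_nat cst) cst_eq0 char0.
  have -> : fev (psi2sq E')^`() (X a.+1) ^+ 2 = fev (psi2sq E') (X a.+1) *
     (4 * (4 * X a.+1.*2 + cst (wb2 E') + 8 * X a.+1)).
    by rewrite H2 fev_deriv_psi2sq fev_cubic /dupx; field; rewrite C0 four0 s0.
  apply: maxM => //; apply: intM => //; apply: vgeD; last exact: intM.
  by apply: vgeD => //; apply: intM.
have P4 : vge w 1 (fev (psi2sq E')^`() (X a.+1)).
  move: P3; set z := fev _ _; case: (eqVneq z 0) => [->|z0]; first by rewrite !vge0.
  rewrite !vgeP ?expf_neq0 // valX //; move: (w z); clear; lia.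
have [[u t] /= ut] := Bezout_eq1_coprimepP _ _ (psi2sq_separable char0 ellE').
have := congr1 (fun P => fev P (X a.+1)) ut; rewrite fevD !fevM fev1 => E1.
have : vge w 1 1.
  by rewrite -E1; apply: vgeD; rewrite mulrC; apply: maxM => //; apply: vge_fev.
by rewrite vgeP ?oner_neq0 // place_val1.
Qed.

End OnePlace.

Variables (p q : {poly L}) (c : L).
Hypotheses (c0 : c != 0) (q0 : q != 0) (co : coprimep p q) (spq : size p = (size q).+1).
Hypothesis solf : sol E' E c (T p / T q).

Variable s : {poly L}.
Hypotheses (irr : irreducible_poly s) (sq : s %| q).
Local Notation w := (fin_place F char0 irr).
Local Notation th n := (theta E' n).
Local Notation g n := (psi_sq E' n).

Let p0 : p != 0. Proof. by rewrite -size_poly_gt0 spq. Qed.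
Let s_p : ~~ (s %| p).
Proof.
apply/negP => sp; have := coprimep_def p q; rewrite co => /esym/eqP sg.
have : s %| gcdp p q by rewrite dvdp_gcd sp.
by move/eqP: sg; rewrite size_poly_eq1 => /eqp_dvdr ->; rewrite dvdp1; case: irr => /gtn_eqF ->.
Qed.

Lemma frac_pole_fin : T p / T q != 0 /\ w (T p / T q) = - (pmult s q)%:Z.
Proof.
split; first by rewrite mulf_neq0 ?invr_eq0 ?toF_eq0.
rewrite pvalM ?invr_eq0 ?toF_eq0 // valV ?toF_eq0 // !fin_placeE //.
by rewrite pmult_ndvd // add0r.
Qed.

Let wf : w (T p / T q) < 0.
Proof.
have [_ ->] := frac_pole_fin; rewrite oppr_lt0 ltz_nat -pmult_dvd // expr1.
Qed.

Let fracB (a b d e : {poly L}) : b != 0 -> e != 0 ->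
  T a / T b - T d / T e = T (a * e - d * b) / T (b * e).
Proof.
move=> b0 e0; rewrite rmorphB !(rmorphM T).
move: b0 e0; rewrite -!(toF_eq0 F); move: (T _) (T _) (T _) (T _) => a' b' d' e' b0 e0.
by field; rewrite e0 b0.
Qed.

(** Let N = size q, the degree of p. If no such k exists, x'_1, ..., x'_N are integral at s. Since f
    o x'_i = x_i o f has a pole there and p(x'_i) is integral, q(x'_i) vanishes at s. So the N
    residues are roots of q, of degree N - 1, two of them coincide, and [mulx_congruence_pole]
    yields a pole with index at most 2N. *)
Lemma kernel_torsion : exists k, [/\ (0 < k)%N, (k <= size q + size q)%N & s %| g k].
Proof.
apply: NNPP => H; set N := size q in H.
have ndv k : (0 < k)%N -> (k <= N + N)%N -> ~~ (s %| g k).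
  by move=> k0 kN; apply/negP => sk; apply: H; exists k.
have intX k : (0 < k)%N -> (k <= N + N)%N -> vge w 0 (mulx F E' k).
  case: k => // k _ kN; have sk := @ndv k.+1 isT kN; rewrite (mulxE char0).
  have g0 := psi_sq_neq0 char0 E' F k.
  have [t0|t0] := eqVneq (th k.+1) 0; first by rewrite t0 rmorph0 mul0r vge0.
  rewrite vgeP ?mulf_neq0 ?invr_eq0 ?toF_eq0 // pvalM ?invr_eq0 ?toF_eq0 //.
  by rewrite valV ?toF_eq0 // !fin_placeE // (pmult_ndvd irr g0 sk) subr0.
have [L1 _ [z rz _]] := irredp_FAdjoin irr.
(* Reduction modulo s, with values in the residue field [L1] = L[x]/(s). *)
have [ev evs] : exists ev : {rmorphism {poly L} -> L1}, ev s = 0.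
  by exists (horner_eval z \o map_poly (in_alg L1)); apply/eqP.
have ev0 a : (ev a == 0) = (s %| a).
  apply/idP/idP; last by case/dvdpP=> r ->; rewrite rmorphM evs mulr0.
  apply: contraTT => /(irreducible_coprime irr)/Bezout_eq1_coprimepP[[u t] /= ut].
  apply/eqP => ea; move/(congr1 ev)/eqP: ut.
  by rewrite rmorphD !rmorphM ea evs !mulr0 addr0 rmorph1 eq_sym oner_eq0.
pose x (i : 'I_N) : L1 := ev (th i.+1) / ev (g i.+1).
have eg (i : 'I_N) : ev (g i.+1) != 0.
  by rewrite ev0 ndv // ltn_addl.
have rx i : root (map_poly (ev \o polyC) q) (x i).
  have g0 := psi_sq_neq0 char0 E' F i.
  have szq : (size q <= (size q).-1.+1)%N by rewrite prednK // size_poly_gt0.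
  (* The denominator of the multiple is a unit at s, so vanishing of q at the residue amounts to
     divisibility of the homogenized polynomial by s. *)
  suff d : s %| phom (size q).-1 q (th i.+1) (g i.+1).
    have E1 := @phom_rmorph _ _ ev _ q (th i.+1) (g i.+1) szq (eg i).
    move: d; rewrite -ev0 -E1 mulf_eq0 expf_eq0 (negPf (eg i)) andbF orbF.
    by rewrite /root.
  have [h0 vh _] := mulx_sol F char0 E' i.
  have [P0 _] := fev_pole h0 vh p0; have [Q0 _] := fev_pole h0 vh q0.
  have [f0 vf] := frac_pole_fin.
  have [tE _] := theta_size_monic char0 E F i.
  have tE0 : theta E i.+1 != 0 by rewrite -size_poly_gt0 tE.
  have := mulx_isogeny char0 i c0 q0 _ solf; rewrite spq ltnSn => /(_ isT) /(congr1 w).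
  have [_ ->] := frac_fev_pole f0 wf tE0 (psi_sq_neq0 char0 E F i).
  rewrite tE (psi_sq_size char0 E F) pvalM ?invr_eq0 // valV // => EW.
  have W0 : vge w 0 (fev p (mulx F E' i.+1)).
    by apply: vge_fev; apply: intX; rewrite // ltn_addl.
  rewrite vgeP // in W0.
  have WQ : 1 <= w (fev q (mulx F E' i.+1)).
    have e : (i.+1 ^ 2).+1.-1 = (i.+1 ^ 2).-1.+1 by rewrite prednK // expn_gt0.
    move: EW; rewrite e mulrS addrK; move: wf W0; clear.
    by move: (w _) (w _) (w _) => ? ? ?; lia.
  have TP' := @phom_toF L F _ q (th i.+1) (g i.+1) szq g0.
  rewrite -mulxE // in TP'.
  have n0 : phom (size q).-1 q (th i.+1) (g i.+1) != 0.
    rewrite -(toF_eq0 F) -TP'; apply: mulf_neq0; first exact: Q0.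
    by apply: expf_neq0; rewrite toF_eq0; exact: g0.
  have Tg0 : T (g i.+1) != 0 by rewrite toF_eq0; exact: g0.
  have := congr1 w TP'; rewrite (pvalM w Q0 (expf_neq0 _ Tg0)) (valX w _ Tg0) !fin_placeE //.
  rewrite (pmult_ndvd irr g0) ?mul0rn ?addr0; last by apply: ndv; rewrite // ltn_addl.
  move=> Ew; rewrite -[s]expr1 (pmult_dvd irr _ n0) -lez_nat -Ew.
  exact: WQ.
have [inj|] := boolP (injectiveb x).
  pose rs := codom x.
  have qm0 : map_poly (ev \o polyC) q != 0 by rewrite map_poly_eq0.
  have : (size rs < size (map_poly (ev \o polyC) q))%N.
    apply: max_poly_roots => //; first by apply/allP => y /codomP[i ->].
  by rewrite size_map_poly size_codom card_ord ltnn.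
case/injectivePn => i [j ij xij].
wlog lt : i j ij xij / (i < j)%N.
  move=> WL; case: (ltngtP i j) => [lt|lt|/val_inj E1]; [exact: (WL i j) | | by rewrite E1 eqxx in ij].
  by apply: (WL j i) => //; rewrite eq_sym.
have := @mulx_congruence_pole w i j N lt (ltn_ord j) intX; case/negP.
have gi := psi_sq_neq0 char0 E' F i; have gj := psi_sq_neq0 char0 E' F j.
have -> : mulx F E' j.+1 - mulx F E' i.+1 =
   T (th j.+1 * g i.+1 - th i.+1 * g j.+1) / T (g j.+1 * g i.+1).
  rewrite !mulxE //; exact: fracB.
have [n0|n0] := eqVneq (th j.+1 * g i.+1 - th i.+1 * g j.+1) 0; first by rewrite n0 rmorph0 mul0r vge0.
have d0 : g j.+1 * g i.+1 != 0 by rewrite mulf_neq0.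
rewrite vgeP ?mulf_neq0 ?invr_eq0 ?toF_eq0 // pvalM ?invr_eq0 ?toF_eq0 // valV ?toF_eq0 // !fin_placeE //.
rewrite (pmultM irr gj gi) (pmult_ndvd irr gj) ?(pmult_ndvd irr gi) ?ndv ?ltn_addl //.
rewrite addn0 subr0 lez_nat -pmult_dvd // expr1.
rewrite -ev0 rmorphB !(rmorphM ev) subr_eq0; apply/eqP.
by apply/eqP; rewrite -eqr_div ?eg // -/(x i) -/(x j) xij.
Qed.

End KernelTorsion.

(** * Factoring multiplication through an isogeny *)

Transparent phom mulx.

Section PadeDefect.
Variables (L : fieldType) (F : diff_frac L).
Hypothesis char0 : forall n, (n%:R == 0 :> L) = (n == 0)%N.
Local Notation T := (toF F).
Local Notation cst := (cst F).
Variables (E' E : wcurve L) (f h : F) (c m : L) (D : {poly L}).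
Hypotheses (c0 : c != 0) (m0 : m != 0) (f0 : f != 0) (h0 : h != 0) (D0 : D != 0).
Hypothesis odef : fD f ^+ 2 * T D = cst c ^+ 2 * fev (psi2sq E) f.
Hypothesis odeh : fD h ^+ 2 * T D = cst m ^+ 2 * fev (psi2sq E') h.
Local Notation gam := (m / c).
Local Notation S := (fev (psi2sq E) f / f ^+ 2).

Section AtPole.
Variable w : place F.
Hypotheses (wf : w f < 0) (wh : w h < 0).

Let gam0 : gam != 0. Proof. by rewrite mulf_neq0 ?invr_eq0. Qed.
Let f'0 : fD f != 0. Proof. exact: (fD_neq0 char0 f0 wf). Qed.

Let lead4 : size (psi2sq E) = 4%N /\ lead_coef (psi2sq E) = 4.
Proof. exact: psi2sq_size_lead. Qed.

Lemma resS_pole : res w (S / f) 4.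
Proof.
have [s4 l4] := lead4.
have p0 : psi2sq E != 0 by rewrite -size_poly_gt0 s4.
have := fev_lead f0 wf p0; rewrite l4 s4 /=.
by have -> : fev (psi2sq E) f / f ^+ 3 = S / f by field.
Qed.

(** Dividing the equation of h by that of f eliminates D: as a function of f, h satisfies the
    equation with multiplier m/c that belongs to a map E -> E'. A rational function A/B with h =
    (A/B)(f) is a solution of the same equation. *)
Lemma eul_ode : eul f h ^+ 2 * S = cst gam ^+ 2 * fev (psi2sq E') h.
Proof.
have T0 : T D != 0 by rewrite toF_eq0.
have C0 : cst c != 0 by rewrite cst_eq0.
have C1 : cst gam = cst m / cst c by rewrite rmorphM fmorphV.
have -> : fev (psi2sq E) f = fD f ^+ 2 * T D / cst c ^+ 2 by rewrite odef; field.
have -> : fev (psi2sq E') h = fD h ^+ 2 * T D / cst m ^+ 2.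
  by rewrite odeh; field; rewrite cst_eq0.
rewrite C1 /eul; field.
by rewrite ?T0 ?f0 ?f'0 ?C0 ?cst_eq0 ?m0.
Qed.

Lemma res_pole_ratio : w h = w f /\ res w (h / f) (gam ^- 2).
Proof. exact: (ode_lead char0 f0 wf gam0 resS_pole h0 wh eul_ode). Qed.

Variables A B : {poly L}.
Hypotheses (B0 : B != 0).

(** B^4 times the amount by which A/B fails the equation of multiplier m/c from E to E'. *)
Definition pade_defect : {poly L} :=
  wronskian A B ^+ 2 * psi2sq E - (gam ^+ 2)%:P * B * hcub E' A B.

Hypotheses (sAB : size A = (size B).+1) (lAB : lead_coef A / lead_coef B = gam ^- 2).
Hypothesis u0 : h * fev B f - fev A f != 0.

(** [ode_diff] applied to G = (A/B)(f), whose defect is Z(f) / B(f)^4 with Z = [pade_defect]. The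
    point is that the factor next to [w f] depends on A and B only, not on the place: the order of
    the error at infinity dictates its order at every other common pole of f and h. *)
Lemma pade_val : pade_defect != 0 /\
  w (h * fev B f - fev A f) = w f * ((size pade_defect).-1%:Z - 3 * (size B).-1%:Z - 2).
Proof.
have A0 : A != 0 by rewrite -size_poly_gt0 sAB.
have [FA vA] := fev_pole f0 wf A0; have [FB vB] := fev_pole f0 wf B0.
have hG : h != fev A f / fev B f.
  by apply: contraNneq u0 => ->; rewrite divfK // subrr.
have [wh' rh] := res_pole_ratio.
have rG : res w (fev A f / fev B f / f) (gam ^- 2).
  have sA : (size A).-1 = (size B).-1.+1.
    by rewrite sAB /= prednK // size_poly_gt0.
  have lB : lead_coef B != 0 by rewrite lead_coef_eq0.
  have := resdiv lB (fev_lead f0 wf A0) (fev_lead f0 wf B0).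
  rewrite lAB sA exprS; suff -> : fev A f / (f * f ^+ (size B).-1) / (fev B f / f ^+ (size B).-1) = fev A f / fev B f / f by [].
  by field; rewrite f0 FB expf_neq0.
have Eep : fev pade_defect f / fev B f ^+ 4 =
  eul f (fev A f / fev B f) ^+ 2 * S - cst gam ^+ 2 * fev (psi2sq E') (fev A f / fev B f).
  have W : fD (fev A f / fev B f) = fev (wronskian A B) f * fD f / fev B f ^+ 2.
    rewrite fDdiv // !fD_fev /wronskian fevB !fevM.
    by congr (_ / _); ring.
  rewrite /eul W /pade_defect fevB fevM fevXn fevM fevM fevC fev_hcub // rmorphXn.
  by field; rewrite cst_eq0 c0 f0 f'0.
have [e0 ve] := ode_diff char0 f0 wf gam0 resS_pole hG rh rG eul_ode Eep.
have Z0 : pade_defect != 0 by apply: contraNneq e0 => ->; rewrite fev0 mul0r.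
split=> //; have [FZ vZ] := fev_pole f0 wf Z0.
have U0 : h - fev A f / fev B f != 0 by rewrite subr_eq0.
have -> : h * fev B f - fev A f = (h - fev A f / fev B f) * fev B f by field.
rewrite pvalM // vB; move: ve; rewrite pvalM ?invr_eq0 ?expf_neq0 // valV ?expf_neq0 // valX // vZ vB.
clear.
move: (w (h - _)) (w f) (size _).-1 (size _).-1 => a b z d.
rewrite -[b *+ z]mulr_natr -[b *+ d]mulr_natr -[_ *+ 4]mulr_natr -[b *+ 2]mulr_natr => E1.
have -> : a = (a + b * 2) - b * 2 by rewrite addrK.
rewrite -E1 !natz; move: z%:Z d%:Z; clear=> z d.
ring.
Qed.

End AtPole.
End PadeDefect.

(** * Approximants by linear algebra *)

Lemma poly_small_combination (K : fieldType) (m r s : nat) (P : 'I_m -> {poly K}) :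
  (r < m)%N -> (forall i, (size (P i) <= s + r)%N) ->
  exists2 c : 'rV[K]_m, c != 0 & (size (\sum_i c 0%R i *: P i)%R <= s)%N.
Proof.
move=> rm sP; pose M := \matrix_(i < m, j < r) (P i)`_(s + j).
have k0 : kermx M != 0.
  rewrite -mxrank_eq0 mxrank_ker -lt0n subn_gt0.
  exact: leq_ltn_trans (rank_leq_col M) rm.
exists (nz_row (kermx M)); first by rewrite nz_row_eq0.
have := nz_row_sub (kermx M); move: (nz_row _) => c /sub_kermxP cM.
apply/leq_sizeP => j sj; rewrite coef_sum.
have [jr|jr] := ltnP (j - s) r; last first.
  apply: big1 => i _; rewrite coefZ nth_default ?mulr0 //.
  by apply: leq_trans (sP i) _; move: sj jr; clear; lia.
have := congr1 (fun M : 'rV[K]_r => M 0 (Ordinal jr)) cM; rewrite !mxE => E1.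
rewrite -[RHS]E1; apply: eq_bigr => i _.
by rewrite coefZ !mxE /= subnKC.
Qed.

Lemma size_mul_le (K : fieldType) (a b : {poly K}) x y : (size a <= x.+1)%N -> (size b <= y.+1)%N ->
  (size (a * b)%R <= (x + y).+1)%N.
Proof.
move=> sa sb; apply: leq_trans (size_polyMleq _ _) _.
by move: sa sb; move: (size a) (size b); clear; lia.
Qed.

Lemma size_exp_le (K : fieldType) (a : {poly K}) x i : (size a <= x.+1)%N -> (size (a ^+ i)%R <= (x * i).+1)%N.
Proof.
move=> sa; elim: i => [|i IH]; first by rewrite expr0 muln0 size_poly1.
by rewrite exprS mulnS size_mul_le.
Qed.

(** With f = p/q and h = t/g this is g q^(k+1) (h B(f) - A(f)). *)
Definition pade_numerator (L : fieldType) (t g p q A B : {poly L}) k :=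
  t * (q * phom k B p q) - g * phom k.+1 A p q.

(** A has k + 2 coefficients and B has k + 1, together 2k + 3. Every term of the numerator has size
    at most (k + 1) n + 2k + 2, so cutting the size down to (k + 1) n imposes 2k + 2 linear
    conditions. *)
Lemma pade_exists (L : fieldType) (t g p q : {poly L}) k n :
  (size t <= k.+2)%N -> (size g <= k.+1)%N -> (size p <= n.+2)%N -> (size q <= n.+1)%N ->
  exists A B : {poly L}, [/\ (size A <= k.+2)%N, (size B <= k.+1)%N, (A != 0) || (B != 0) &
    (size (pade_numerator t g p q A B k) <= k.+1 * n)%N].
Proof.
move=> st sg sp sq.
pose P (i : 'I_(k.+1 + k.+2)) := match split i with
  | inl j => t * (q * (p ^+ j * q ^+ (k - j)))
  | inr j => - (g * (p ^+ j * q ^+ (k.+1 - j))) end.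
have rm : (k.+1 + k.+1 < k.+1 + k.+2)%N by rewrite ltn_add2l.
have sP i : (size (P i) <= k.+1 * n + (k.+1 + k.+1))%N.
  rewrite /P; case: (split i) => j; rewrite ?size_polyN.
    have s1 := size_mul_le (size_exp_le j sp) (size_exp_le (k - j) sq).
    apply: leq_trans (size_mul_le st (size_mul_le sq s1)) _.
    have : (j <= k)%N by rewrite -ltnS.
    move: (j : nat); clear => j jk.
    have : (j + (k - j) = k)%N by rewrite subnKC.
    by move: (k - j)%N; clear => d; nia.
  have s1 := size_mul_le (size_exp_le j sp) (size_exp_le (k.+1 - j) sq).
  apply: leq_trans (size_mul_le sg s1) _.
  have : (j <= k.+1)%N by rewrite -ltnS.
  move: (j : nat); clear => j jk.
  have : (j + (k.+1 - j) = k.+1)%N by rewrite subnKC.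
  by move: (k.+1 - j)%N; clear => d; nia.
have [c c0 sc] := poly_small_combination rm sP.
pose B := \poly_(i < k.+1) c 0 (lshift k.+2 (inord i)).
pose A := \poly_(i < k.+2) c 0 (rshift k.+1 (inord i)).
exists A, B; split; rewrite ?size_poly //.
  apply: contraNT c0; rewrite negb_or !negbK => /andP[/eqP A0 /eqP B0].
  apply/eqP/rowP => i; rewrite mxE -[i]splitK /unsplit; case: (split i) => j.
    by have := congr1 (fun a : {poly L} => a`_j) B0; rewrite coef0 coef_poly ltn_ord inord_val.
  by have := congr1 (fun a : {poly L} => a`_j) A0; rewrite coef0 coef_poly ltn_ord inord_val.
suff -> : pade_numerator t g p q A B k = \sum_i c 0 i *: P i by [].
rewrite big_split_ord /= /pade_numerator /phom !mulr_sumr -sumrN; congr (_ + _).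
  apply: eq_bigr => i _; rewrite /P -[lshift _ _]/(unsplit (inl i)) unsplitK coef_poly ltn_ord inord_val.
  by rewrite -!scalerAr.
apply: eq_bigr => i _; rewrite /P -[rshift _ _]/(unsplit (inr i)) unsplitK coef_poly ltn_ord inord_val.
by rewrite -!scalerAr scalerN.
Qed.

Section IsogenyFactor.
Variables (L : fieldType) (F : diff_frac L).
Hypothesis char0 : forall n, (n%:R == 0 :> L) = (n == 0)%N.
Local Notation T := (toF F).
Local Notation v := (inf_place F).
Variables (E' E : wcurve L) (p q : {poly L}) (c : L).
Hypotheses (c0 : c != 0) (q0 : q != 0) (co : coprimep p q) (spq : size p = (size q).+1).
Hypothesis solf : sol E' E c (T p / T q).
Local Notation f := (T p / T q).
Local Notation fin s := (fin_place F char0 s).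

Lemma mulx_pole_dvd (w : place F) k M : (0 < M)%N -> (k %| M)%N ->
  w (mulx F E' k) < 0 -> w (mulx F E' M) < 0.
Proof.
move=> M0 /dvdnP[j E1]; move: M0; rewrite {}E1 muln_gt0.
case: j k => [|j] [|k] // _ wk; rewrite (mulx_comp F char0).
have [k0 _ _] := mulx_sol F char0 E' k.
have [tE _] := theta_size_monic char0 E' F j; have gE := psi_sq_size char0 E' F j.
have t0 : theta E' j.+1 != 0 by rewrite -size_poly_gt0 tE.
have [_ ->] := frac_fev_pole k0 wk t0 (psi_sq_neq0 char0 E' F j).
have e : (j.+1 ^ 2).+1.-1 = (j.+1 ^ 2).-1.+1 by rewrite prednK // expn_gt0.
by rewrite tE gE e mulrS addrK.
Qed.

Lemma psi_sq_pole (s : {poly L}) (irr : irreducible_poly s) k : elliptic E' ->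
  s %| psi_sq E' k.+1 -> fin irr (mulx F E' k.+1) < 0.
Proof.
move=> ellE' sg; have g0 := psi_sq_neq0 char0 E' F k.
have [tE _] := theta_size_monic char0 E' F k.
have t0 : theta E' k.+1 != 0 by rewrite -size_poly_gt0 tE.
rewrite (mulxE char0) pvalM ?invr_eq0 ?toF_eq0 // valV ?toF_eq0 // !fin_placeE //.
have st : ~~ (s %| theta E' k.+1).
  apply/negP => st; have := coprime_theta_psi_sq char0 F ellE' k.
  rewrite /coprimep => /eqP/eqP; rewrite size_poly_eq1 => g1.
  have := dvdp_gcd s (theta E' k.+1) (psi_sq E' k.+1); rewrite st sg (eqp_dvdr _ g1) dvdp1.
  by case: irr => /gtn_eqF ->.
by rewrite (pmult_ndvd irr t0 st) sub0r oppr_lt0 ltz_nat -pmult_dvd // expr1.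
Qed.

Lemma kernel_pole (s : {poly L}) (irr : irreducible_poly s) : elliptic E' -> s %| q ->
  fin irr (mulx F E' (size q + size q)`!) < 0.
Proof.
move=> ellE' sq; have [k [k0 kn sk]] := kernel_torsion char0 ellE' c0 q0 co spq solf irr sq.
case: k k0 kn sk => // k _ kn sk.
apply: (mulx_pole_dvd (fact_gt0 _) _ (psi_sq_pole irr ellE' sk)).
by rewrite dvdn_fact.
Qed.

Variable M : nat.
Hypothesis poles : forall (s : {poly L}) (irr : irreducible_poly s), s %| q -> fin irr (mulx F E' M.+1) < 0.
Local Notation h := (mulx F E' M.+1).

Lemma pade_numeratorE (A B : {poly L}) k : (size A <= k.+2)%N -> (size B <= k.+1)%N ->
  (h * fev B f - fev A f) * (T (psi_sq E' M.+1) * T q ^+ k.+1) =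
  T (pade_numerator (theta E' M.+1) (psi_sq E' M.+1) p q A B k).
Proof.
move=> sA sB; have g0 := psi_sq_neq0 char0 E' F M.
have PB := @phom_toF L F _ _ p q sB q0; have PA := @phom_toF L F _ _ p q sA q0.
rewrite /pade_numerator (mulxE char0).
move: g0; move: (theta _ _) (psi_sq _ _) => t g g0.
rewrite rmorphB !(rmorphM T) -PA -PB /=.
have : T g != 0 by rewrite toF_eq0.
move: (T t) (T g) (fev A f) (fev B f) (T q) => t' g' a b q' g'0.
by rewrite exprS; move: (q' ^+ k) => qk; field.
Qed.

Let pade_id1 (a b x y : F) : b != 0 -> x != 0 -> a / (x * b) = y / x - (y * b - a) / (x * b).
Proof. by move=> b0 x0; field; rewrite b0 x0. Qed.

Let pade_id2 (a b x y : F) : b != 0 -> x != 0 -> y != 0 -> a / (x * y) / (b / y) = a / (x * b).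
Proof. by move=> b0 x0 y0; field; rewrite b0 x0 y0. Qed.

Lemma isogeny_factor : exists A B : {poly L},
  [/\ B != 0, size A = (size B).+1 & h * fev B f = fev A f].
Proof.
have g0 := psi_sq_neq0 char0 E' F M.
have [tE _] := theta_size_monic char0 E' F M; have gE := psi_sq_size char0 E' F M.
have [k kE] : exists k, (M.+1 ^ 2)%N = k.+1 by exists (M.+1 ^ 2).-1; rewrite prednK // expn_gt0.
rewrite {}kE in tE gE.
have [n nE] : exists n, size q = n.+1 by exists (size q).-1; rewrite prednK // size_poly_gt0.
have [A [B [sA sB AB0 sN]]] : exists A B : {poly L}, [/\ (size A <= k.+2)%N, (size B <= k.+1)%N, (A != 0) || (B != 0) &
    (size (pade_numerator (theta E' M.+1) (psi_sq E' M.+1) p q A B k) <= k.+1 * n)%N].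
  by apply: pade_exists; rewrite ?tE ?gE ?spq ?nE.
have NE := pade_numeratorE sA sB; set N := pade_numerator _ _ _ _ _ _ _ in sN NE.
set u := h * fev B f - fev A f in NE.
have Tg0 : T (psi_sq E' M.+1) != 0 by rewrite toF_eq0.
have Tq0 : T q != 0 by rewrite toF_eq0.
have [f0 vf Hf] := solf; have [h0 vh Hh] := mulx_sol F char0 E' M.
have vfE : v f = -1.
  by rewrite pvalM ?invr_eq0 ?toF_eq0 // ?valV // ?inf_placeE // -?size_poly_gt0 spq //; clear; lia.
have N0 : (N == 0) = (u == 0).
  by rewrite -(toF_eq0 F) -NE mulf_eq0 [X in _ || X]mulf_eq0 (negPf Tg0) expf_eq0 (negPf Tq0) andbF !orbF.
have vu (w : place F) : u != 0 -> w (T N) = w u + (w (T (psi_sq E' M.+1)) + w (T q) *+ k.+1).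
  by move=> u0; rewrite -NE pvalM ?mulf_neq0 ?expf_neq0 // pvalM ?expf_neq0 // valX.
have vuoo : u != 0 -> k.+1%:Z <= v u.
  move=> u0; have NN : N != 0 by rewrite N0.
  have := vu v u0; rewrite !inf_placeE // gE nE; move: sN; rewrite -mulr_natr.
  have : (n.+1 = 1 + n)%N by [].
  move: (v u) (size N) => a b; clear => _ bn E1.
  have {E1} -> : a = 1 - b%:Z - (1 - k.+1%:Z + (1 - n.+1%:Z) * k.+1%:R) by rewrite E1; ring.
  by rewrite !natz; move: bn; nia.
(* If B = 0, then u = - A(f) has order at most 0 at infinity, against [vuoo]. *)
have B0 : B != 0.
  apply/eqP => B0; rewrite B0 eqxx orbF in AB0.
  have [FA vA] := fev_pole f0 vf AB0.
  have uE : u = - fev A f by rewrite /u B0 fev0 mulr0 sub0r.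
  have u0 : u != 0 by rewrite uE oppr_eq0.
  have := vuoo u0; rewrite uE valN vA vfE; move: (size A).-1 => a.
  by rewrite -mulr_natr natz; clear; lia.
have [FB vB] := fev_pole f0 vf B0.
have gam0 : M.+1%:R / c != 0 by rewrite mulf_neq0 ?invr_eq0 ?char0.
have m0 : M.+1%:R != 0 :> L by rewrite char0.
have D0 : psi2sq E' != 0 by rewrite (psi2sq_neq0 char0).
have [_ rh] := @res_pole_ratio L F char0 E' E f h c M.+1%:R _ c0 m0 f0 h0 D0 Hf Hh v vf vh.
have rA : res v (fev A f / (f * fev B f)) ((M.+1%:R / c) ^- 2).
  have -> : fev A f / (f * fev B f) = h / f - u / (f * fev B f) by exact: pade_id1.
  rewrite -[_ ^- 2]subr0; apply: resB => //; rewrite res0.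
  have [->|u0] := eqVneq u 0; first by rewrite mul0r vge0.
  have fB0 : f * fev B f != 0 by rewrite mulf_neq0.
  rewrite vgeP ?mulf_neq0 ?invr_eq0 // pvalM ?invr_eq0 // valV // pvalM // vB vfE.
  have := vuoo u0; rewrite -mulr_natr natz; move: (v u) (size B).-1; clear; lia.
have A0 : A != 0.
  apply/eqP => A0; have : (M.+1%:R / c) ^- 2 != 0 by rewrite invr_eq0 expf_neq0.
  by case/(res_neq0)/(_ rA); rewrite A0 fev0 mul0r eqxx.
have [FA vA] := fev_pole f0 vf A0.
have rA0 : (M.+1%:R / c) ^- 2 != 0 by rewrite invr_eq0 expf_neq0.
have sAB : size A = (size B).+1.
  have [_] := res_neq0 rA0 rA; have fB0 : f * fev B f != 0 by rewrite mulf_neq0.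
  rewrite pvalM ?invr_eq0 // (valV _ fB0) pvalM // vA vB vfE.
  move: A0 B0; rewrite -!size_poly_gt0 -[_ *+ (size A).-1]mulr_natr -[_ *+ (size B).-1]mulr_natr !natz.
  by move: (size A) (size B); clear; lia.
have lAB : lead_coef A / lead_coef B = (M.+1%:R / c) ^- 2.
  apply: (@res_uniq _ _ v (fev A f / (f * fev B f))) => //.
  have lB : lead_coef B != 0 by rewrite lead_coef_eq0.
  have sA' : (size A).-1 = (size B).-1.+1 by rewrite sAB /= prednK // size_poly_gt0.
  have := resdiv lB (fev_lead f0 vf A0) (fev_lead f0 vf B0); rewrite sA' exprS.
  by rewrite pade_id2 ?expf_neq0.
exists A, B; split=> //; apply/eqP; rewrite -subr_eq0 -/u; apply: contraT => u0.
have val w wf wh := @pade_val L F char0 E' E f h c M.+1%:R _ c0 m0 f0 h0 D0 Hf Hh w wf wh A B B0 sAB lAB u0.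
have [_ voo] := val v vf vh; rewrite vfE -/u in voo.
have voo' := vuoo u0.
have NN : N != 0 by rewrite N0.
(* By [pade_val] the ratio of the orders of u and f is the same at s as at infinity, so u has order
   at least k + 1 times the multiplicity of s in q; the factor q^(k+1) contributes as much again to
   N. But q^(2k+2) has degree n (2k + 2), more than N can have. *)
have qN : q ^+ (k.+1 + k.+1) %| N.
  apply: dvdp_pmult => //; first by rewrite expf_neq0.
  move=> s irr; rewrite -lez_nat -!(fin_placeE F char0 irr) ?expf_neq0 //.
  rewrite rmorphXn valX // fin_placeE //.
  have [sq|sq] := boolP (s %| q); last by rewrite (pmult_ndvd irr q0 sq) mul0rn fin_placeE.
  have [_ wfE] := frac_pole_fin F char0 q0 co spq irr sq.
  have wf : fin irr f < 0 by rewrite wfE oppr_lt0 ltz_nat -pmult_dvd // expr1.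
  have [_] := val _ wf (poles irr sq); rewrite -/u wfE vu // => ->.
  rewrite !fin_placeE //; move: voo voo'; set e := (_ - _ - _).
  rewrite -[_ *+ k.+1]mulr_natr -[_ *+ (k.+1 + k.+1)]mulr_natr !natz.
  by move: (v u) e (pmult s q) (pmult s (psi_sq _ _)); clear; nia.
have := dvdp_leq NN qN; rewrite leqNgt => /negP[].
apply: leq_ltn_trans sN _; have := size_exp q (k.+1 + k.+1); rewrite nE /=.
have : (0 < size (q ^+ (k.+1 + k.+1)))%N by rewrite size_poly_gt0 expf_neq0.
by move: (size _); clear; nia.
Qed.

End IsogenyFactor.

(** * Magnified implies reducible in characteristic zero *)

(** For u in K[x] of degree below deg d, the condition r | u amounts to [L : K] deg r linear
    equations over K. If deg d were larger, some nonzero u would satisfy them; it is coprime to d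
    over K, hence over L, although r divides both. *)
Lemma irreducible_factor_degree (K : fieldType) (L : fieldExtType K) (d : {poly K}) (r : {poly L}) :
  irreducible_poly d -> (1 < size r)%N -> r %| map_poly (in_alg L) d ->
  ((size d).-1 <= \dim {: L} * (size r).-1)%N.
Proof.
move=> irr r1 rd; rewrite leqNgt; apply/negP => lt.
set N := (size d).-1 in lt; set n := \dim _ in lt; set k := (size r).-1 in lt.
pose b := vbasis {: L}.
pose M := \matrix_(i < N) mxvec (\matrix_(l < n, j < k) coord b l (('X^i %% r)`_j)).
have k0 : kermx M != 0.
  rewrite -mxrank_eq0 mxrank_ker -lt0n subn_gt0.
  exact: leq_ltn_trans (rank_leq_col M) lt.
have c0 : nz_row (kermx M) != 0 by rewrite nz_row_eq0.
have := nz_row_sub (kermx M); move: (nz_row _) c0 => c c0 /sub_kermxP cM.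
pose u := rVpoly c.
have uE : map_poly (in_alg L) u = \sum_i (in_alg L (c 0 i)) *: 'X^i.
  apply/polyP => l; rewrite coef_map coef_sum /=.
  have [lN|lN] := ltnP l N.
    rewrite (bigD1 (Ordinal lN)) //= coefZ coefXn eqxx mulr1 big1 ?addr0; last first.
      by move=> i; rewrite coefZ coefXn -val_eqE /= eq_sym => /negPf->; rewrite mulr0.
    by rewrite -[l]/(val (Ordinal lN)) coef_rVpoly_ord.
  rewrite nth_default ?(leq_trans (size_poly _ _) lN) // scale0r big1 // => i _.
  rewrite coefZ coefXn; have -> : (l == i) = false by rewrite gtn_eqF // (leq_trans (ltn_ord i)).
  by rewrite mulr0.
have u0 : u != 0.
  by apply: contraNneq c0 => u0; rewrite -(rVpolyK c) -/u u0 linear0.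
have ru : r %| map_poly (in_alg L) u.
  rewrite /dvdp uE (big_morph (fun a => a %% r) (fun a b => modpD r a b) (mod0p r)).
  apply/eqP/polyP => j; rewrite coef0 coef_sum.
  have r0 : r != 0 by rewrite -size_poly_gt0 ltnW.
  have [jk|jk] := ltnP j k; last first.
    apply: big1 => i _; rewrite nth_default //; apply: leq_trans jk.
    by rewrite -ltnS prednK ?ltn_modp // ltnW.
  rewrite (coord_vbasis (memvf (\sum_i _))); apply: big1 => l _.
  have E1 := congr1 (fun A : 'rV_(n * k) => A 0 (mxvec_index l (Ordinal jk))) cM.
  suff -> : coord b l (\sum_i ((in_alg L (c 0 i) *: 'X^i) %% r)`_j) = 0 by rewrite scale0r.
  rewrite !mxE in E1; rewrite -[RHS]E1 linear_sum; apply: eq_bigr => i _.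
  by rewrite /M !mxE mxvecE mxE modpZl coefZ /= mulr_algl linearZ.
have nd : ~~ (d %| u).
  apply/negP => /(dvdp_leq u0); rewrite leqNgt => /negP[].
  apply: leq_ltn_trans (size_poly _ _) _; rewrite prednK //.
  by case: irr => /ltnW.
have := irreducible_coprime irr nd; rewrite -(coprimep_map (in_alg L)) => co.
have := dvdp_gcd r (map_poly (in_alg L) d) (map_poly (in_alg L) u); rewrite rd ru.
move: co; rewrite /coprimep size_poly_eq1 => /eqp_dvdr ->; rewrite dvdp1.
by move=> /eqP r1'; rewrite r1' in r1.
Qed.

Lemma coprime_fraction (K : fieldType) (A B : {poly K}) : B != 0 -> size A = (size B).+1 ->
  exists A1 B1 d : {poly K}, [/\ A = A1 * d, B = B1 * d, coprimep A1 B1, B1 != 0 & size A1 = (size B1).+1].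
Proof.
move=> B0 sAB; pose d := gcdp A B.
have A0 : A != 0 by rewrite -size_poly_gt0 sAB.
have d0 : d != 0 by rewrite gcdp_eq0 negb_and A0.
have EA : A = (A %/ d) * d by rewrite divpK // dvdp_gcdl.
have EB : B = (B %/ d) * d by rewrite divpK // dvdp_gcdr.
have A1 : A %/ d != 0 by apply: contraNneq A0 => e; rewrite EA e mul0r.
have B1 : B %/ d != 0 by apply: contraNneq B0 => e; rewrite EB e mul0r.
exists (A %/ d), (B %/ d), d; split=> //; first by rewrite coprimep_div_gcd ?A0.
move: sAB; rewrite {1}EA {1}EB !size_mul // /d.
move: A1 B1 d0; rewrite -!size_poly_gt0 -/d.
by move: (size _) (size _) (size _); clear; lia.
Qed.

Section IsogenyDelta.
Variables (L : fieldType) (F : diff_frac L).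
Hypothesis char0 : forall n, (n%:R == 0 :> L) = (n == 0)%N.
Local Notation T := (toF F).
Local Notation v := (inf_place F).
Variables (E' E : wcurve L) (p q : {poly L}) (c : L).
Hypotheses (ellE' : elliptic E') (ellE : elliptic E).
Hypotheses (c0 : c != 0) (q0 : q != 0) (co : coprimep p q) (spq : size p = (size q).+1).
Hypothesis solf : sol E' E c (T p / T q).
Local Notation f := (T p / T q).

Lemma fev_inj (a b : {poly L}) : fev a f = fev b f -> a = b.
Proof.
move=> /eqP ab; apply/eqP; rewrite -subr_eq0; apply: contraT => ab0.
have [f0 vf _] := solf; have [] := fev_pole f0 vf ab0.
by rewrite fevB subr_eq0 ab.
Qed.

(** From x'_M = (A/B) o f and f o x'_M = x_M o f, cancelling f on the right gives f o (A/B) = x_M.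
    Both sides in lowest terms, the homogenizations of p and q at (A, B) are proportional to theta_M
    and psi_M^2; this gives deg A = M^2 / deg p. As x - x0 divides p - f(x0) q, homogenizing makes r
    = A - x0 B divide theta_M - f(x0) psi_M^2. *)
Lemma isogeny_delta_factor (x0 : L) : q.[x0] != 0 -> exists M (r : {poly L}),
  [/\ (M = (size q + size q)`!)%N, (size q * (size r).-1 = M ^ 2)%N &
      r %| theta E M - (p.[x0] / q.[x0])%:P * psi_sq E M].
Proof.
move=> qx0; have [M ME] : exists M, (size q + size q)`!%N = M.+1.
  by exists (size q + size q)`!.-1; rewrite prednK // fact_gt0.
have poles (s : {poly L}) (irr : irreducible_poly s) : s %| q -> fin_place F char0 irr (mulx F E' M.+1) < 0.
  by rewrite -ME; apply: (kernel_pole char0 c0 q0 co spq solf irr ellE').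
have [A0 [B0 [nB0 sAB0 hAB0]]] := isogeny_factor c0 q0 co spq solf poles.
have [A [B [d [EA EB coAB nB sAB]]]] := coprime_fraction nB0 sAB0.
have d0 : d != 0 by apply: contraNneq nB0 => d0; rewrite EB d0 mulr0.
have [f0 vf _] := solf; have [FB _] := fev_pole f0 vf nB.
have [Fd _] := fev_pole f0 vf d0.
have hE : mulx F E' M.+1 = fev A f / fev B f.
  apply: (mulIf FB); rewrite divfK //; apply: (mulIf Fd).
  by rewrite -mulrA -!fevM -EA -EB.
clear A0 B0 nB0 sAB0 hAB0 EA EB d d0 Fd.
have t0 : theta E M.+1 != 0.
  by have [tE _] := theta_size_monic char0 E F M; rewrite -size_poly_gt0 tE.
have g0 := psi_sq_neq0 char0 E F M.
pose n := size q.
have sp : (size p <= n.+1)%N by rewrite spq.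
have sq : (size q <= n.+1)%N by [].
have lt : (size q < size p)%N by rewrite spq.
have pn : p`_n != 0.
  have := lead_coef_eq0 p; rewrite /lead_coef spq /= -/n => ->.
  by rewrite -size_poly_gt0 spq.
pose Ph := phom n p A B; pose Qh := phom n q A B.
have P1 := phom_fev A sp FB; have Q1 := phom_fev A sq FB.
have key : Ph * psi_sq E M.+1 = theta E M.+1 * Qh.
  apply: fev_inj; rewrite !fevM -P1 -Q1 -hE.
  have := mulx_isogeny char0 M c0 q0 lt solf.
  have [h0 vh _] := mulx_sol F char0 E' M.
  have [QN _] := fev_pole h0 vh q0; have [GN _] := fev_pole f0 vf g0.
  move: QN GN; move: (fev q _) (fev (psi_sq E M.+1) f) (fev p _) (fev (theta E M.+1) f) (_ ^+ n).
  move=> a b c' d e a0 b0 E1; have -> : c' = d / b * a by rewrite -E1 divfK.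
  by field.
have ltBA : (size B < size A)%N by rewrite sAB.
have [gp vg] := frac_pole F nB ltBA.
have vgE : v (T A / T B) < 0 by rewrite vg sAB; clear; lia.
have p0 : p != 0 by rewrite -size_poly_gt0 spq.
have [FP vP] := fev_pole gp vgE p0.
have TB0 : T B != 0 by rewrite toF_eq0.
have TP := phom_toF F A sp nB.
have Ph0 : Ph != 0 by rewrite -(toF_eq0 F) -TP mulf_neq0 ?expf_neq0.
have coP : coprimep Ph Qh by apply: phom_coprime.
have e : Ph %= theta E M.+1.
  apply/andP; split.
    by rewrite -(Gauss_dvdpl _ coP) -key dvdp_mulr.
  rewrite -(Gauss_dvdpl _ (coprime_theta_psi_sq char0 F ellE M)).
  by rewrite key dvdp_mulr.
have degA : (n * (size B) = M.+1 ^ 2)%N.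
  have := congr1 v TP; rewrite pvalM ?expf_neq0 // vP vg valX // spq !inf_placeE //.
  rewrite (eqp_size e); have [-> _] := theta_size_monic char0 E F M.
  rewrite /= sAB -/n -mulrnDl -mulr_natr natz.
  by clear; move: (M.+1 ^ 2)%N (size B) (n : nat) => a b d; nia.
have /eqpP[[a b] /= /andP[a0 b0] Eab] := e.
have EQ : a *: Qh = b *: psi_sq E M.+1.
  by apply: (mulfI t0); rewrite -!scalerAr -key scalerAl Eab -scalerAl.
pose s0 := p - (p.[x0] / q.[x0]) *: q.
have Es : a *: phom n s0 A B = b *: (theta E M.+1 - (p.[x0] / q.[x0])%:P * psi_sq E M.+1).
  rewrite /s0 phomD -scaleNr phomZ -/Ph -/Qh mul_polyC scaleNr (scalerBr a) Eab (scalerBr b (theta _ _)).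
  by congr (_ - _); rewrite ![_ *: (_ *: _)]scalerA [a * _]mulrC [b * _]mulrC -!scalerA EQ.
have n0 : (0 < n)%N by rewrite size_poly_gt0.
have rs : root s0 x0 by rewrite /root /s0 hornerD hornerN hornerZ divfK // subrr.
have [r Er] := factor_theorem _ _ rs.
exists M.+1, (A - x0 *: B); split=> //.
  by rewrite size_polyDl sAB ?size_polyN ?ltnS ?size_scale_leq.
rewrite -(dvdpZr _ _ b0) -Es dvdpZr // Er.
have sr : (size r <= n.-1.+1)%N.
  rewrite prednK //; have [->|r0] := eqVneq r 0; first by rewrite size_poly0.
  have s0n : (size s0 <= n.+1)%N.
    apply: leq_trans (size_polyD _ _) _; rewrite geq_max sp size_polyN.
    by apply: leq_trans (size_scale_leq _ _) _; rewrite leqW.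
  by move: s0n; rewrite Er size_Mmonic ?monicXsubC // size_XsubC addn2.
have -> : n = (n.-1 + 1)%N by rewrite addn1 prednK.
by rewrite (phomM F) ?size_XsubC // phom_XsubC dvdp_mull.
Qed.

End IsogenyDelta.

Lemma reducible_mul (K : fieldType) (a b : {poly K}) : (1 < size a)%N -> (1 < size b)%N ->
  reducible_poly (a * b).
Proof.
move=> a1 b1; have a0 : a != 0 by rewrite -size_poly_gt0 ltnW.
have b0 : b != 0 by rewrite -size_poly_gt0 ltnW.
split; first by rewrite size_mul //; move: a1 b1; move: (size a) (size b); clear; lia.
case=> _ /(_ a); rewrite neq_ltn a1 orbT => /(_ isT (dvdp_mulr _ (dvdpp a))) /eqp_size.
by rewrite size_mul //; move: a1 b1; move: (size a) (size b); clear; lia.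
Qed.

Section MagnifiedReducible.
Variables (K : fieldType) (E : wcurve K).
Hypothesis ellE : elliptic E.

Lemma size_gt_coef (p : {poly K}) k : p`_k != 0 -> (k < size p)%N.
Proof. by apply: contraNT; rewrite -leqNgt => /leq_sizeP/(_ k (leqnn k))->. Qed.

Transparent psi2sq.

(** psi_3^2 is the square of a polynomial with leading term 3 x^4. In characteristic 3 that term is
    lost and m = 4 serves: psi_4^2 = psi_2^2 f_4^2, with leading terms 4 x^3 of psi_2^2 and 2 x^6 of
    f_4. *)
Lemma psi_sq_reducible : exists m : nat, (1 < m)%N /\ reducible_poly (psi_sq E m).
Proof.
have [z|nz] := eqVneq (3 : K) 0; last first.
  exists 3%N; split=> //; rewrite psi_sqE wsE /= mul1r divf3E expr2.
  have s3 : (4 < size (divf3 E))%N.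
    by apply: size_gt_coef; rewrite /divf3 !(coefD, coefZ, coefCM, coefXn, coefC, coefX) /= !mulr0 !addr0 mulr1.
  by apply: reducible_mul; apply: leq_trans s3.
have two0 : 2 != 0 :> K.
  by apply/eqP => z2; have /eqP := oner_neq0 K; apply; rewrite -[1](addrK 2) -(natrD _ 1 2) z z2 subrr.
exists 4%N; split=> //; rewrite psi_sqE wsE /= divf4E expr2 mulrA.
have s4 : (6 < size (divf4 E))%N.
  by apply: size_gt_coef; rewrite /divf4 !(coefD, coefZ, coefCM, coefXn, coefC, coefX) /= !mulr0 !addr0 mulr1.
have s2 : (3 < size (psi2sq E))%N.
  apply: size_gt_coef; rewrite /psi2sq !(coefD, coefZ, coefCM, coefXn, coefC, coefX) /= !mulr0 !addr0 mulr1.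
  by rewrite (natrM _ 2 2) mulf_neq0.
apply: reducible_mul; last by apply: leq_trans s4.
rewrite size_mul -?size_poly_gt0 ?(leq_trans _ s2) ?(leq_trans _ s4) //.
by move: s2 s4; move: (size _) (size _); clear; lia.
Qed.

Opaque psi2sq.

Lemma magnified_reducible (char0 : forall n, (n%:R == 0 :> K) = (n == 0)%N) P :
  magnified E P -> exists m : nat, (1 < m)%N /\ reducible_poly (delta E P m).
Proof.
case: P => [|xP yP]; first by move=> _; apply: psi_sq_reducible.
case=> L [E' [phi [Q [ellE' [/and3P[q0 _ _] [co _] lt /weq_dvdpE[U V]] _ maps dim]]]].
have char0L := char0_ext L char0; pose f : {rmorphism K -> L} := in_alg L.
pose EL := wcurve_map f E; have ellEL : elliptic EL by rewrite elliptic_map.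
have [spq [c c0 solf]] := isogeny_sol char0L ellE' ellEL q0 co lt U V.
(* As P is affine, Q is neither O nor a point whose x-coordinate is a pole of f. *)
move: maps; case: Q => [|x0 y0] //=; case: eqP => // /eqP qx0 [xE _].
have [M [r [ME sr rd]]] := isogeny_delta_factor char0L ellE' ellEL c0 q0 co spq solf qx0.
have dim0 : (0 < \dim {: L})%N by rewrite adim_gt0.
have {}dim : (\dim {: L} < size (iso_q1 phi))%N by move: dim; rewrite /isog_deg spq.
have M1 : (1 < M)%N.
  rewrite ME; apply: (dvdn_leq (fact_gt0 _)); apply: dvdn_fact => /=.
  by move: dim dim0; move: (\dim _) (size _); clear; lia.
case: M M1 ME sr rd => // M M1 ME sr rd.
have sd := delta_size E xP yP char0 M.
exists M.+1; split=> //; split; first by rewrite sd ltnS expn_gt0.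
move=> irr.
have r1 : (1 < size r)%N.
  by move: sr; case: (size r) => [|[|k]] //; rewrite muln0 => /esym/eqP; rewrite expn_eq0.
have rd' : r %| map_poly (in_alg L) (delta E (PAff xP yP) M.+1).
  by rewrite -/f (delta_map f) /delta /= xE.
have D := irreducible_factor_degree irr r1 rd'.
have {sd}sd : (size (delta E (PAff xP yP) M.+1)).-1 = (size (iso_q1 phi) * (size r).-1)%N by rewrite sd sr.
have r2 : (0 < (size r).-1)%N by move: r1; clear; case: (size r) => [|[|]].
have lt1 : (\dim {: L} * (size r).-1 < size (iso_q1 phi) * (size r).-1)%N by rewrite ltn_pmul2r.
have := leq_ltn_trans D lt1.
by rewrite sd ltnn.
Qed.

End MagnifiedReducible.

(** * Positive characteristic *)

(* Coefficients of y^n = U y + V modulo y^2 + h y = c. *)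
Fixpoint ypow (R : comNzRingType) (h c : R) n : R * R :=
  if n is m.+1 then let: (u, v) := ypow h c m in (v - h * u, u * c) else (0, 1).

Lemma ypowE (R S : comNzRingType) (f : {rmorphism R -> S}) (h c : R) (y : S) n : exists r,
  f (ypow h c n).1 * y + f (ypow h c n).2 = y ^+ n + r * (y ^+ 2 + f h * y - f c).
Proof.
elim: n => [|n [r IH]]; first by exists 0; rewrite /= rmorph0 rmorph1 expr0; ring.
rewrite /=; case: (ypow h c n) IH => u v /= IH.
exists (r * y - f u); rewrite rmorphB !rmorphM exprS.
have -> : y ^+ n = f u * y + f v - r * (y ^+ 2 + f h * y - f c) by rewrite IH; ring.
by ring.
Qed.

Section FrobeniusRing.
Variables (R : comNzRingType) (p : nat).
Hypothesis charp : p \in [pchar R].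
Implicit Types x y : R.

Lemma frobD x y : (x + y) ^+ p = x ^+ p + y ^+ p.
Proof. by apply: exprDn_pchar; rewrite pnatE ?(pcharf_prime charp). Qed.

Lemma frobN x : (- x) ^+ p = - x ^+ p.
Proof. by rewrite -!(pFrobenius_autE charp) pFrobenius_autN. Qed.

(** In characteristic p, w^p is the equation with all coefficients and both variables raised to the
    p-th power. Replacing y^p by z, congruent to it modulo w, changes the value by a multiple of
    w. *)
Lemma frobenius_pullback (x y a1 a2 a3 a4 a6 z r : R) :
  let w := y ^+ 2 + (a1 * x + a3) * y - (x ^+ 3 + a2 * x ^+ 2 + a4 * x + a6) in
  z = y ^+ p + r * w -> exists s,
  z ^+ 2 + (a1 ^+ p * x ^+ p + a3 ^+ p) * z
    - ((x ^+ p) ^+ 3 + a2 ^+ p * (x ^+ p) ^+ 2 + a4 ^+ p * x ^+ p + a6 ^+ p) = s * w.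
Proof.
move=> w ->; have p0 := prime_gt0 (pcharf_prime charp).
exists (w ^+ p.-1 + r * (y ^+ p *+ 2 + r * w + (a1 ^+ p * x ^+ p + a3 ^+ p))).
have -> : (w ^+ p.-1 + r * (y ^+ p *+ 2 + r * w + (a1 ^+ p * x ^+ p + a3 ^+ p))) * w =
   w ^+ p + r * (y ^+ p *+ 2 + r * w + (a1 ^+ p * x ^+ p + a3 ^+ p)) * w.
  by rewrite mulrDl -exprSr prednK.
have -> : w ^+ p = (y ^+ p) ^+ 2 + (a1 ^+ p * x ^+ p + a3 ^+ p) * y ^+ p
    - ((x ^+ p) ^+ 3 + a2 ^+ p * (x ^+ p) ^+ 2 + a4 ^+ p * x ^+ p + a6 ^+ p).
  rewrite /w !(frobD, frobN) !exprMn !frobD !exprMn.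
  by ring.
by ring.
Qed.

End FrobeniusRing.

Section Frobenius.
Variables (K : fieldType) (E : wcurve K) (p : nat).
Hypothesis charp : p \in [pchar K].
Hypothesis perf : perfect_field K.

Lemma frobenius_dvdp a1 a2 a3 a4 a6 (b1 b2 b3 b4 b6 : K) (G : fieldType) (T : {rmorphism {poly K} -> G}) :
  a1 ^+ p = b1 -> a2 ^+ p = b2 -> a3 ^+ p = b3 -> a4 ^+ p = b4 -> a6 ^+ p = b6 ->
  let uv := ypow (a1 *: 'X + a3%:P) ('X^3 + a2 *: 'X^2 + a4 *: 'X + a6%:P) p in
  let X := T 'X^p / T 1 in
  let Y := (T uv.1 / T 1)%:P * 'X + (T uv.2 / T 1)%:P in
  'X^2 + (T a1%:P * T 'X + T a3%:P)%:P * 'X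
    - (T 'X ^+ 3 + T a2%:P * T 'X ^+ 2 + T a4%:P * T 'X + T a6%:P)%:P %|
  Y ^+ 2 + (T b1%:P * X + T b3%:P)%:P * Y
    - (X ^+ 3 + T b2%:P * X ^+ 2 + T b4%:P * X + T b6%:P)%:P.
Proof.
move=> <- <- <- <- <-; cbv zeta; set h := _ + a3%:P; set c := _ + a6%:P.
set uv := ypow h c p; set X := T 'X^p / T 1; set Y := (T uv.1 / T 1)%:P * 'X + _.
pose f : {rmorphism {poly K} -> {poly G}} := polyC \o T.
have charf : p \in [pchar {poly G}] by apply: (rmorph_pchar (f \o polyC)).
have [r Er] := ypowE f h c 'X p.
have fh : f h = f a1%:P * f 'X + f a3%:P by rewrite /h -mul_polyC rmorphD rmorphM.
have fc : f c = f 'X ^+ 3 + f a2%:P * f 'X ^+ 2 + f a4%:P * f 'X + f a6%:P.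
  by rewrite /c -!mul_polyC !(rmorphD f, rmorphXn f, rmorphM f).
rewrite -/uv fh fc in Er.
have YE : Y = f uv.1 * 'X + f uv.2 by rewrite /Y rmorph1 !divr1.
have fX a : f a%:P ^+ p = f (a ^+ p)%:P by rewrite (rmorphXn polyC) (rmorphXn f).
have [s] := frobenius_pullback charf Er; rewrite -YE -(rmorphXn f p 'X) !fX => Es.
apply/dvdpP; exists s.
have XE : X%:P = f 'X^p by rewrite /X rmorph1 divr1.
have CD (x y : G) : (x + y)%:P = x%:P + y%:P by exact: polyCD.
have CM (x y : G) : (x * y)%:P = x%:P * y%:P by exact: polyCM.
have CX (x : G) n : (x ^+ n)%:P = x%:P ^+ n by exact: (rmorphXn polyC).
clearbody X Y; rewrite !(CD, CX, CM) XE.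
exact: Es.
Qed.

(** E' has the p-th roots of the coefficients of E, so that Frobenius goes from E' to E, and Q has
    the p-th roots of the coordinates of P. Isogeny data must be linear in y, so y^p is reduced
    modulo the equation of E' by [ypow]. *)
Lemma frobenius_isogeny P : elliptic E -> on_curve E P -> exists (E' : wcurve K) phi Q,
  [/\ elliptic E', is_isogeny E' E phi, on_curve E' Q, isog_maps E' phi Q P & isog_deg phi = p].
Proof.
move=> ellE onP; have pr := pcharf_prime charp.
have p0 := prime_gt0 pr; have p1 := prime_gt1 pr.
have fr := pFrobenius_autE charp; pose fb : {rmorphism K -> K} := pFrobenius_aut charp.
have [a1 E1] := perf charp (wa1 E); have [a2 E2] := perf charp (wa2 E).
have [a3 E3] := perf charp (wa3 E); have [a4 E4] := perf charp (wa4 E).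
have [a6 E6] := perf charp (wa6 E).
pose E' := WCurve a1 a2 a3 a4 a6.
have EE : wcurve_map fb E' = E by rewrite /wcurve_map /= !fr E1 E2 E3 E4 E6; case: (E).
have ellE' : elliptic E' by rewrite -(elliptic_map fb) EE.
pose c : {poly K} := 'X^3 + a2 *: 'X^2 + a4 *: 'X + a6%:P.
pose h : {poly K} := a1 *: 'X + a3%:P.
pose u := (ypow h c p).1; pose v := (ypow h c p).2.
pose phi := IsogData 'X^p 1 u 1 v 1.
have isoE : is_isogeny E' E phi.
  split.
  - by rewrite !oner_neq0.
  - by rewrite !coprimep1.
  - by rewrite size_poly1 size_polyXn.
  exact: (frobenius_dvdp (@tofrac {poly K}) E1 E2 E3 E4 E6).
have [Q [onQ mapsQ]] : exists Q, on_curve E' Q /\ isog_maps E' phi Q P.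
  case: P onP => [|xP yP] onP; first by exists PInf.
  have [x0 Ex] := perf charp xP; have [y0 Ey] := perf charp yP.
  have on0 : on_curve E' (PAff x0 y0).
    rewrite /on_curve /=; apply/eqP; apply: (fmorph_inj fb).
    rewrite !(rmorphD fb, rmorphXn fb, rmorphM fb) /= !fr Ex Ey E1 E2 E3 E4 E6.
    exact/eqP.
  exists (PAff x0 y0); split=> //=.
  have H1 : (1 : {poly K}).[x0] = 1 by rewrite -polyC1 hornerC.
  rewrite H1 oner_eq0 hornerXn !divr1; split=> //; right; split=> //.
  have [r Er] := ypowE (horner_eval x0) h c y0 p.
  have {}Er : u.[x0] * y0 + v.[x0] = y0 ^+ p + r * (y0 ^+ 2 + h.[x0] * y0 - c.[x0]) := Er.
  rewrite Er Ey.
  suff -> : y0 ^+ 2 + h.[x0] * y0 - c.[x0] = 0 by rewrite mulr0 addr0.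
  rewrite /h /c !(hornerD, hornerZ, hornerXn, hornerX, hornerC).
  by move/eqP: on0 => /= on0; rewrite -on0; ring.
by exists E', phi, Q; split; rewrite // /isog_deg size_polyXn.
Qed.

End Frobenius.

Lemma magnified_pchar (K : fieldType) (E : wcurve K) P p : p \in [pchar K] -> perfect_field K ->
  elliptic E -> on_curve E P -> magnified E P.
Proof.
(* K as an extension of itself has degree 1, less than the degree p of Frobenius. *)
move=> charp perf ellE onP; pose L : fieldExtType K := K^o; pose f : {rmorphism K -> L} := in_alg L.
have perfL : perfect_field L.
  move=> q; rewrite (fmorph_pchar f) => charq x; have [y Ey] := perf q charq x.
  by exists (f y); rewrite -rmorphXn Ey /f /= /GRing.scale /= mulr1.
have charL : p \in [pchar L] by rewrite (fmorph_pchar f).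
have ellL : elliptic (wcurve_map f E) by rewrite elliptic_map.
have [E' [phi [Q [? ? ? ? deg]]]] := frobenius_isogeny charL perfL ellL (on_curve_map f onP).
exists L, E', phi, Q; split=> //.
by rewrite deg dimvf prime_gt1 // (pcharf_prime charp).
Qed.

Lemma psi_sq_rE (K : fieldType) (E : wcurve K) n :
  psi_sq E n = rpsi_sq (wb2 E) (wb4 E) (wb6 E) (wb8 E) n.
Proof. by rewrite psi_sqE rpsi_sqE divfE. Qed.

Lemma theta_rE (K : fieldType) (E : wcurve K) n :
  theta E n.+1 = rtheta (wb2 E) (wb4 E) (wb6 E) (wb8 E) n.+1.
Proof. by rewrite thetaE rthetaE psi_sq_rE !divfE. Qed.

Transparent wb2 wb4 wb6 wb8.

(** * Transfer of the characteristic 0 identities to other characteristics *)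

Section Descent.
Variables (A : idomainType) (G : fieldType) (T : {rmorphism A -> G}) (a2 a4 a6 : A).
Hypotheses (injT : injective T) (char0 : forall n, (n%:R == 0 :> G) = (n == 0)%N).
Local Notation b2 := (4 * a2).
Local Notation b4 := (2 * a4).
Local Notation b6 := (4 * a6).
Local Notation b8 := (4 * a2 * a6 - a4 ^+ 2).
Local Notation th n := (rtheta b2 b4 b6 b8 n).
Local Notation ps n := (rpsi_sq b2 b4 b6 b8 n).

(** The b-invariants are those of y^2 = x^3 + a2 x^2 + a4 x + a6. The identities hold over the field
    G of characteristic 0, all polynomials have coefficients in A, and [T] is injective. In odd or
    zero characteristic, completing the square brings any b2, b4, b6 to this form. *)
Lemma rtheta_facts n : [/\
  (th n.+1)^`() * ps n.+1 - th n.+1 * (ps n.+1)^`() = n.+1%:R * rdivf b2 b4 b6 b8 n.+1.*2,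
  (size (ps n.+1) <= n.+1 ^ 2)%N, size (th n.+1) = (n.+1 ^ 2).+1 & th n.+1 \is monic].
Proof.
pose E := WCurve 0 (T a2) 0 (T a4) (T a6).
have e2 : wb2 E = T b2 by rewrite /wb2 /= expr0n add0r rmorphM rmorph_nat.
have e4 : wb4 E = T b4 by rewrite /wb4 /= mul0r addr0 rmorphM rmorph_nat.
have e6 : wb6 E = T b6 by rewrite /wb6 /= expr0n add0r rmorphM rmorph_nat.
have e8 : wb8 E = T b8.
  by rewrite /wb8 /= !(rmorphB T, rmorphXn T, rmorphM T, rmorph_nat T); ring.
have pE : psi_sq E n.+1 = map_poly T (ps n.+1) by rewrite psi_sq_rE map_rpsi_sq e2 e4 e6 e8.
have tE : theta E n.+1 = map_poly T (th n.+1) by rewrite theta_rE map_rtheta e2 e4 e6 e8.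
have dE : divf E n.+1.*2 = map_poly T (rdivf b2 b4 b6 b8 n.+1.*2).
  by rewrite divfE map_rdivf e2 e4 e6 e8.
have F := frac_diff G.
have injP : injective (map_poly T) by apply: map_inj_poly; rewrite ?rmorph0.
have [st mt] := theta_size_monic char0 E F n.
have := theta_deriv char0 E F n; have sp := psi_sq_size char0 E F n.
rewrite pE tE dE in sp st mt *; rewrite (size_map_inj_poly injT) ?rmorph0 // in sp.
rewrite (size_map_inj_poly injT) ?rmorph0 // in st => H.
split=> //; last by move: mt; rewrite !monicE (lead_coef_map_inj injT) ?rmorph0 // -(rmorph1 T) (inj_eq injT).
  apply: injP; rewrite rmorphB !(rmorphM (map_poly T)) rmorph_nat /= -!deriv_map.
  exact: H.
by rewrite sp.
Qed.

End Descent.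

Lemma eval_rmorphism (R S : comNzRingType) (f : {rmorphism R -> S}) (u : S) :
  exists g : {rmorphism {poly R} -> S}, g 'X = u /\ forall c, g c%:P = f c.
Proof.
exists (horner_eval u \o map_poly f); split=> [|c] /=.
  by rewrite map_polyX /horner_eval hornerX.
by rewrite map_polyC /horner_eval hornerC.
Qed.

(* The identities of characteristic 0 specialize from the generic curve
   y^2 = x^3 + a2 x^2 + a4 x + a6 over Z[a2, a4, a6]. *)
Lemma theta_facts (K : fieldType) (E : wcurve K) n : 2 != 0 :> K -> [/\
  (theta E n.+1)^`() * psi_sq E n.+1 - theta E n.+1 * (psi_sq E n.+1)^`() = n.+1%:R * divf E n.+1.*2,
  (size (psi_sq E n.+1) <= n.+1 ^ 2)%N & size (theta E n.+1) = (n.+1 ^ 2).+1 /\ theta E n.+1 \is monic].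
Proof.
move=> two0; have four0 : 4 != 0 :> K by rewrite (natrM _ 2 2) mulf_neq0.
have [g1 [g1X g1C]] := eval_rmorphism (intmul 1 : {rmorphism int -> K}) (wb6 E / 4).
have [g2 [g2X g2C]] := eval_rmorphism g1 (wb4 E / 2).
have [g [gX gC]] := eval_rmorphism g2 (wb2 E / 4).
pose A : idomainType := {poly {poly {poly int}}}.
pose T : {rmorphism A -> {fraction A}} := @tofrac A.
have injT : injective T by move=> x y /eqP; rewrite tofrac_eq => /eqP.
have char0 m : (m%:R == 0 :> {fraction A}) = (m == 0)%N.
  rewrite -(rmorph_nat T) -(rmorph0 T) (inj_eq injT).
  by rewrite -!polyC_natr !polyC_eq0 pnatr_eq0.
have := rtheta_facts ('X : A) ('X%:P : A) ('X%:P%:P : A) injT char0 n.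
set c2 := 4 * ('X : A); set c4 := 2 * ('X%:P : A); set c6 := 4 * _; set c8 := c2 * _ - _ ^+ 2.
have e2 : g c2 = wb2 E by rewrite /c2 rmorphM rmorph_nat gX mulrC divfK.
have e4 : g c4 = wb4 E by rewrite /c4 rmorphM rmorph_nat gC g2X mulrC divfK.
have e6 : g c6 = wb6 E by rewrite /c6 rmorphM rmorph_nat gC g2C g1X mulrC divfK.
have e8 : g c8 = wb8 E.
  rewrite /c8 !(rmorphB g, rmorphXn g, rmorphM g, rmorph_nat g) gX !gC g2X g2C g1X.
  rewrite /wb2 /wb4 /wb6 /wb8; field; by rewrite ?two0 ?four0.
have pE : psi_sq E n.+1 = map_poly g (rpsi_sq c2 c4 c6 c8 n.+1).
  by rewrite psi_sq_rE map_rpsi_sq e2 e4 e6 e8.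
have tE : theta E n.+1 = map_poly g (rtheta c2 c4 c6 c8 n.+1).
  by rewrite theta_rE map_rtheta e2 e4 e6 e8.
have dE : divf E n.+1.*2 = map_poly g (rdivf c2 c4 c6 c8 n.+1.*2).
  by rewrite divfE map_rdivf e2 e4 e6 e8.
case=> H sp st mt; rewrite pE tE dE; split.
- by rewrite !deriv_map -!(rmorphM (map_poly g)) -rmorphB H rmorphM rmorph_nat.
- by apply: leq_trans (size_poly _ _) sp.
split; last exact: monic_map.
by rewrite size_map_poly_id0 // (monicP mt) rmorph1 oner_neq0.
Qed.

Transparent psi2sq.

Section PerfectReducible.
Variables (K : fieldType) (p : nat).
Hypotheses (charp : p \in [pchar K]) (perf : perfect_field K).

Lemma poly_pth_root (a : {poly K}) : a^`() = 0 -> exists b, a = b ^+ p.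
Proof.
move=> da; have pr := pcharf_prime charp; have p0 := prime_gt0 pr.
have H x : exists y : K, y ^+ p == x by have [y <-] := perf charp x; exists y.
have az i : ~~ (p %| i)%N -> a`_i = 0.
  case: i => [|i]; first by rewrite dvdn0.
  move=> ni; have /eqP := congr1 (fun d : {poly K} => d`_i) da.
  by rewrite coef_deriv coef0 -mulr_natr mulf_eq0 -(dvdn_pcharf charp) (negPf ni) orbF => /eqP.
have charP : p \in [pchar {poly K}] by apply: (rmorph_pchar polyC).
exists (\sum_(i < size a) xchoose (H a`_(p * i)) *: 'X^i).
rewrite -(pFrobenius_autE charP) rmorph_sum /=; apply/polyP => j; rewrite coef_sum.
have E i : (pFrobenius_aut charP (xchoose (H a`_(p * i)) *: 'X^i))`_j = a`_(p * i) * (j == p * i)%N%:R.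
  by rewrite pFrobenius_autE exprZn (eqP (xchooseP (H _))) -exprM mulnC coefZ coefXn.
under eq_bigr => i _ do rewrite E.
have [/dvdnP[k ->]|pj] := boolP (p %| j)%N; last first.
  rewrite (az _ pj) big1 // => i _; have -> : (j == p * i)%N = false; last by rewrite mulr0.
  by apply: contraNF pj => /eqP ->; rewrite dvdn_mulr.
have [ks|ks] := ltnP k (size a).
  rewrite (bigD1 (Ordinal ks)) //= mulnC eqxx mulr1 big1 ?addr0 // => i ik.
  rewrite eqn_mul2l gtn_eqF //=; have -> : (k == i) = false; last by rewrite mulr0.
  by apply: contraNF ik => /eqP ki; apply/eqP/val_inj.
rewrite nth_default; last by apply: leq_trans ks _; rewrite leq_pmulr.
rewrite big1 // => i _; have -> : (k * p == p * i)%N = false; last by rewrite mulr0.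
by rewrite mulnC eqn_mul2l gtn_eqF //= gtn_eqF // (leq_trans (ltn_ord i)).
Qed.

Lemma reducible_deriv0 (a : {poly K}) : (1 < size a)%N -> a^`() = 0 -> reducible_poly a.
Proof.
move=> a1 /poly_pth_root[b E]; have p1 := prime_gt1 (pcharf_prime charp).
have sE n : (size (b ^+ n)).-1 = ((size b).-1 * n)%N by rewrite size_exp.
have b1 : (1 < size b)%N.
  by move: a1; rewrite E; have := sE p; case: (size b) => [|[|k]] //=; rewrite mul0n; case: (size _) => [|[|]].
rewrite E -(prednK (ltnW p1)) exprS; apply: reducible_mul => //.
by have := sE p.-1; move: b1 p1; move: (size b) (size _); clear; nia.
Qed.

Variable E : wcurve K.

(** Characteristic 2 is out of reach of the specialization, which divides by 2, so m = 2 is checked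
    by hand: the derivative is a multiple of 2. *)
Lemma delta2_deriv xP yP : 2 = 0 :> K -> (delta E (PAff xP yP) 2)^`() = 0.
Proof.
move=> z2; have nC n : (n%:R : K)%:P = n%:R by exact: polyC_natr.
have CM (x y : K) : (x * y)%:P = x%:P * y%:P by exact: polyCM.
have P2 : 2 = 0 :> {poly K} by rewrite -nC z2.
rewrite /delta theta2 psi_sq2 /psi2sq /divf3 -!mul_polyC !CM !nC.
set b2 := (wb2 E)%:P; set b4 := (wb4 E)%:P; set b6 := (wb6 E)%:P; set x0 := xP%:P.
have dC c : (c%:P : {poly K})^`() = 0 := derivC c.
have dn n : (n%:R : {poly K})^`() = 0 by rewrite -nC dC.
rewrite !(derivN, derivB, derivD, derivM, derivX, derivXn, dC, dn) /=.
transitivity (2 * (- (4 * 'X^3 + b2 * 'X^2 + 2 * b4 * 'X + b6)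
   + (6 * 'X^2 + b2 * 'X + b4) * ('X - x0))); last by rewrite P2 mul0r.
by ring.
Qed.

Lemma delta2_size xP yP : (4 < size (delta E (PAff xP yP) 2))%N.
Proof.
apply: size_gt_coef; rewrite /delta theta2 psi_sq2 /psi2sq /divf3.
rewrite !(coefD, coefN, coefXM, coefZ, coefCM, coefXn, coefC, coefX) /=.
rewrite !mulr0 !addr0 mulr0 !mulr1 subr0.
by rewrite (natrD _ 1 3) addrK oner_neq0.
Qed.

Lemma psi2sq_size : 2 != 0 :> K -> size (psi2sq E) = 4%N.
Proof.
move=> two0; apply/eqP; rewrite eqn_leq; apply/andP; split.
  apply/leq_sizeP => -[|[|[|[|j]]]] // _.
  by rewrite /psi2sq !(coefD, coefZ, coefCM, coefXn, coefC, coefX) /= !mulr0 !addr0.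
apply: size_gt_coef; rewrite /psi2sq !(coefD, coefZ, coefCM, coefXn, coefC, coefX) /= !mulr0 !addr0 mulr1.
by rewrite (natrM _ 2 2) mulf_neq0.
Qed.

Opaque psi2sq.

Lemma delta_reducible_affine xP yP : exists m : nat, (1 < m)%N /\ reducible_poly (delta E (PAff xP yP) m).
Proof.
have pr := pcharf_prime charp; have p1 := prime_gt1 pr.
have [p2|p2] := eqVneq p 2%N.
  have z2 : 2 = 0 :> K by move: charp; rewrite p2 => /andP[_ /eqP].
  exists 2%N; split=> //; apply: reducible_deriv0; last exact: delta2_deriv.
  exact: leq_trans (delta2_size xP yP).
have two0 : 2 != 0 :> K.
  rewrite -(dvdn_pcharf charp); apply/negP => /(@dvdn_leq p 2 isT).
  by move: p1 p2; clear; case: p => [|[|[|]]].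
have pn : p.-1.+1 = p by rewrite prednK // ltnW.
have [W sg [st mt]] := theta_facts E p.-1 two0; rewrite pn in W sg st mt.
rewrite (_ : p%:R = 0) ?mul0r in W; last first.
  by apply/eqP; rewrite -polyC_natr polyC_eq0 -(dvdn_pcharf charp).
exists p; split=> //.
have sd : size (delta E (PAff xP yP) p) = (p ^ 2).+1.
  rewrite /delta size_polyDl st // size_polyN mul_polyC ltnS.
  exact: leq_trans (size_scale_leq _ _) sg.
have d1 : (1 < size (delta E (PAff xP yP) p))%N by rewrite sd ltnS expn_gt0 ltnW.
apply: NNPP => nred.
have irr : irreducible_poly (delta E (PAff xP yP) p).
  by apply: NNPP => nirr; apply: nred; split.
apply: nred; set d := delta _ _ _ in sd d1 irr *.
have dW : d %| d^`() * psi_sq E p.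
  suff -> : d^`() * psi_sq E p = d * (psi_sq E p)^`() by apply: dvdp_mulr.
  move/eqP: W; rewrite subr_eq0 => /eqP W.
  rewrite /d /delta; move: (theta E p) (psi_sq E p) W => t g W.
  rewrite derivB derivM derivC mul0r add0r.
  have -> : (t^`() - xP%:P * g^`()) * g = t^`() * g - xP%:P * g^`() * g by ring.
  by rewrite W; ring.
have d0 : d != 0 by rewrite -size_poly_gt0 ltnW.
move: dW; rewrite irreducible_dvdM // => /orP[dd|dg].
  apply: reducible_deriv0 => //; apply/eqP; apply: contraT => dd0.
  by have := dvdp_leq dd0 dd; rewrite leqNgt lt_size_deriv.
(* Here the irreducible delta_p^P divides psi_p^2, of smaller degree, so psi_p^2 = 0. Then delta_p^P
   = theta_p has the factor psi_2^2 of degree 3 because p is odd, and irreducibility would force p^2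
   = 3. *)
have g0 : psi_sq E p = 0.
  apply/eqP; apply: contraT => g0; have := dvdp_leq g0 dg.
  by rewrite sd leqNgt ltnS sg.
have opn : odd p by rewrite -[odd p]negbK; apply: contra p2 => ep; rewrite -(dvdn2 p) in ep; rewrite eq_sym -(dvdn_prime2 _ pr).
have dE : d = psi2sq E * - (divf E p.+1 * divf E p.-1).
  rewrite /d /delta g0 mulr0 subr0 -{1}pn thetaE pn g0 mulr0 sub0r wsE.
  by have -> : odd p.-1 = false; [move: opn; rewrite -{1}pn /= => /negbTE | rewrite mulrN].
have s4 := psi2sq_size two0; case: irr => _ /(_ (psi2sq E)).
rewrite s4 dE => /(_ isT (dvdp_mulr _ (dvdpp _))) /eqp_size; rewrite -dE sd s4 => - [p3].
by move: p1 p3; rewrite -mulnn; clear; case: p => [|[|[|k]]] // _; rewrite mulnS; lia.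
Qed.

End PerfectReducible.

Theorem theorem2p3 (K : fieldType) (E : wcurve K) (P : point K) :
  perfect_field K -> elliptic E -> on_curve E P ->
  (magnified E P <-> exists m : nat, (1 < m)%N /\ reducible_poly (delta E P m)).
Proof.
move=> perf ellE onP.
case: (classic (exists p, p \in [pchar K])) => [[p charp]|nop].
  split=> _; last exact: magnified_pchar charp perf ellE onP.
  case: P {onP} => [|xP yP]; first exact: psi_sq_reducible.
  exact: delta_reducible_affine charp perf E xP yP.
have char0 : forall n, (n%:R == 0 :> K) = (n == 0)%N.
  by apply/pcharf0P => p; apply/negP => charp; apply: nop; exists p.
split; first exact: magnified_reducible.
by case=> m [m1 red]; apply: (magnified_of_reducible char0 ellE onP m1 red).
Qed.
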